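(* Let $m,n,p,q$ be positive integers. Consider Bayesian error-in-variable regression with additional error in the responses and Berkson errors in the features: for $i=1,\ldots,n$, independently, $$Y_i\mid\mathcal{V}_i\sim N_m(\mathcal{V}_i,U_i),\qquad \mathcal{V}_i\mid\mathcal{A}_i,\theta,\beta,\Sigma\sim N_m(\Theta^TZ_i+\mathcal{B}^T\mathcal{A}_i,\Sigma),\qquad \mathcal{A}_i\mid X_i\sim N_p(X_i,V_i),$$ with known symmetric positive-definite (SPD) $U_i\in\mathbb{R}^{m\times m}$, $V_i\in\mathbb{R}^{p\times p}$ and fixed known $Z_i\in\mathbb{R}^q$, an improper flat prior on each $\mathcal{A}_i$, and independent priors $\Sigma\sim\mathcal{W}^{-1}(a_0,B_0)$, $(\theta,\beta)^T\sim N_{m(q+p)}(j_0,J_0)$, where $a_0\ge m$ is an integer, $B_0\in\mathbb{R}^{m\times m}$ is SPD, $j_0\in\mathbb{R}^{m(q+p)}$ and $J_0\in\mathbb{R}^{m(q+p)\times m(q+p)}$ is SPD. Write $\mathcal{V}=(\mathcal{V}_1,\ldots,\mathcal{V}_n)^T\in\mathbb{R}^{n\times m}$ and $\nu=\mathrm{vec}(\mathcal{V})$. Given any observed data $y_i\in\mathbb{R}^m$, $x_i\in\mathbb{R}^p$, $i=1,\ldots,n$, the posterior density is $$\pi_n(\mathcal{A},\nu,\theta,\beta,\Sigma)\propto\det(\Sigma)^{-(n+a_0+m+1)/2}\exp\Big[-\tfrac12\mathrm{tr}(\Sigma^{-1}B_0)-\tfrac12\sum_{i=1}^n(\mathcal{V}_i-\Theta^TZ_i-\mathcal{B}^T\mathcal{A}_i)^T\Sigma^{-1}(\mathcal{V}_i-\Theta^TZ_i-\mathcal{B}^T\mathcal{A}_i)\Big]$$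 $$\times\exp\Big[-\tfrac12\sum_{i=1}^n(\mathcal{V}_i-y_i)^TU_i^{-1}(\mathcal{V}_i-y_i)-\tfrac12\sum_{i=1}^n(\mathcal{A}_i-x_i)^TV_i^{-1}(\mathcal{A}_i-x_i)-\tfrac12((\theta,\beta)^T-j_0)^TJ_0^{-1}((\theta,\beta)^T-j_0)\Big].$$ Then the 3-variable deterministic scan Gibbs sampler $(\mathcal{A}_t,\nu_t,\theta_t,\beta_t,\Sigma_t)_{t\ge0}$ for this posterior, which at each step $t\ge1$ generates $\Sigma_t\sim\pi_n(\cdot\mid\mathcal{A}_{t-1},\nu_{t-1},\theta_{t-1},\beta_{t-1})$, then $(\nu_t,\theta_t,\beta_t)\sim\pi_n(\cdot\mid\mathcal{A}_{t-1},\Sigma_t)$ jointly, then $\mathcal{A}_t\sim\pi_n(\cdot\mid\nu_t,\theta_t,\beta_t,\Sigma_t)$, is geometrically ergodic.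
   Context: Here $\mathcal{A}=(\mathcal{A}_1,\ldots,\mathcal{A}_n)^T\in\mathbb{R}^{n\times p}$, $\theta=\mathrm{vec}(\Theta)$ with $\Theta\in\mathbb{R}^{q\times m}$, $\beta=\mathrm{vec}(\mathcal{B})$ with $\mathcal{B}\in\mathbb{R}^{p\times m}$, $\Sigma\in\mathbb{R}^{m\times m}$ is SPD, $\mathrm{vec}$ stacks the columns of a matrix, and $(\theta,\beta)^T$ is the concatenated column vector. $N_d(\mu,C)$ is the $d$-dimensional normal distribution; $\mathcal{W}^{-1}(\kappa,S)$ is the inverse-Wishart distribution on SPD $m\times m$ matrices with density proportional to $\det(\Sigma)^{-(\kappa+m+1)/2}\exp(-\tfrac12\mathrm{tr}(\Sigma^{-1}S))$. Densities are with respect to Lebesgue measure (for $\Sigma$: on the open cone of SPD matrices in the symmetric matrices). The conditional densities $\pi_n(\cdot\mid\cdot)$ are the full conditionals obtained by normalizing $\pi_n$ in the indicated block with the other variables fixed (inverse-Wishart for $\Sigma$, Gaussian for the other two blocks). Let $P$ be the Markov transition kernel of the chain, $P^t$ its $t$-step iterate, and $\Pi_n$ the probability measure with density $\pi_n$. The chain is called geometrically ergodic if there are $\rho\in(0,1)$ and a function $M$ from the state space to $[0,\infty)$ such that for every initial state $s=(\mathcal{A},\nu,\theta,\beta,\Sigma)$ and every $t\ge1$, $\sup_B|P^t(s,B)-\Pi_n(B)|\le M(s)\rho^t$, the supremum being over Borel sets $B$. *)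

(* Defs.v *)
From HB Require Import structures.
From mathcomp Require Import all_boot all_order all_algebra.
From mathcomp Require Import all_classical all_reals all_analysis.

Set Implicit Arguments.
Unset Strict Implicit.
Unset Printing Implicit Defensive.
Import Order.TTheory GRing.Theory Num.Theory.
Import numFieldNormedType.Exports.

Local Open Scope classical_set_scope.
Local Open Scope ring_scope.

Definition mx_display : measure_display.
Proof. exact: default_measure_display. Qed.

(* The Borel sigma-algebra of the space of matrices, presented (as the library
   does for tuples) as the one generated by the entries. *)
Section measurable_matrix.
Context {R : realType} (m n : nat).

Definition mx_cylinder : set (set 'M[R]_(m, n)) :=
  [set A | exists i j (B : set R),
     measurable B /\ A = (fun M : 'M[R]_(m, n) => M i j) @^-1` B].

Let mx_setC A : <<s mx_cylinder >> A -> <<s mx_cylinder >> (~` A).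
Proof. exact: sigma_algebraC. Qed.

HB.instance Definition _ := @isMeasurable.Build mx_display 'M[R]_(m, n)
  <<s mx_cylinder >> (@sigma_algebra0 _ setT mx_cylinder) mx_setC
  (@sigma_algebra_bigcup _ setT mx_cylinder).

Lemma measurable_mxE i j :
  measurable_fun [set: 'M[R]_(m, n)] (fun M : 'M[R]_(m, n) => M i j).
Proof.
move=> _ B mB; rewrite setTI; apply: sub_sigma_algebra.
by exists i, j, B.
Qed.

Lemma measurable_fun_mxP d (T : measurableType d) (f : T -> 'M[R]_(m, n)) :
  (forall i j, measurable_fun setT (fun x => f x i j)) -> measurable_fun setT f.
Proof.
move=> mf; apply: (@measurability _ _ _ _ _ _ mx_cylinder) => //.
by move=> _ [_ [i [j [B [mB ->]]]] <-]; exact: mf.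
Qed.

End measurable_matrix.


Definition is_sigma_finite_measure d (T : measurableType d) (R : realType)
    (mu : set T -> \bar R) :=
  exists nu : {sigma_finite_measure set T -> \bar R}, mu = nu.

Lemma sigma_finite_measure_fun d (T : measurableType d) (R : realType)
    (mu : set T -> \bar R) :
  mu set0 = 0%E -> (forall A, (0 <= mu A)%E) -> semi_sigma_additive mu ->
  sigma_finite setT mu -> is_sigma_finite_measure mu.
Proof.
move=> mu0 mu_ge0 mu_add mu_sf.
pose M := isMeasure.Build _ _ _ mu mu0 mu_ge0 mu_add.
pose muM : {measure set T -> \bar R} := HB.pack mu M.
pose S := Measure_isSigmaFinite.Build _ _ _ muM mu_sf.
pose muS : {sigma_finite_measure set T -> \bar R} := HB.pack mu M S.
by exists muS.
Qed.

Lemma sigma_finite_pushforward d1 d2 (T1 : measurableType d1)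
    (T2 : measurableType d2) (R : realType)
    (mu : {sigma_finite_measure set T1 -> \bar R}) (f : T1 -> T2) (g : T2 -> T1) :
  measurable_fun setT f -> measurable_fun setT g -> cancel f g ->
  is_sigma_finite_measure (pushforward mu f).
Proof.
move=> mf mg fK.
have [nu nuE] : exists nu, nu = pushforward mu f by exists (pushforward mu f).
rewrite -nuE.
have nu0 : nu set0 = 0%E by rewrite nuE /pushforward preimage_set0 measure0.
have nu_ge0 A : (0 <= nu A)%E by rewrite nuE /pushforward; exact: measure_ge0.
have nu_add : semi_sigma_additive nu.
  by rewrite nuE; apply: measure_semi_sigma_additive.
have nu_sf : sigma_finite setT nu.
  have [F UF mF] := sigma_finiteT mu.
  exists (fun i => g @^-1` F i); first by rewrite -preimage_bigcup -UF.
  move=> i; have [mFi Fioo] := mF i; split.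
    by rewrite -[X in measurable X]setTI; exact: mg.
  rewrite nuE /pushforward -comp_preimage.
  by rewrite (_ : g \o f = id)//; apply/funext => x /=; rewrite fK.
exact: sigma_finite_measure_fun.
Qed.

Lemma sigma_finite_product d1 d2 (T1 : measurableType d1)
    (T2 : measurableType d2) (R : realType)
    (m1 : {sigma_finite_measure set T1 -> \bar R})
    (m2 : {sigma_finite_measure set T2 -> \bar R}) :
  is_sigma_finite_measure (m1 \x m2)%E.
Proof.
have [nu nuE] : exists nu, nu = (m1 \x m2)%E by exists (m1 \x m2)%E.
rewrite -nuE.
have nu0 : nu set0 = 0%E by rewrite nuE measure0.
have nu_ge0 A : (0 <= nu A)%E by rewrite nuE; exact: measure_ge0.
have nu_add : semi_sigma_additive nu.
  by rewrite nuE; apply: measure_semi_sigma_additive.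
have nu_sf : sigma_finite setT nu.
  have /sigma_finiteP[F [TF ndF Foo]] := sigma_finiteT m1.
  have /sigma_finiteP[G [TG ndG Goo]] := sigma_finiteT m2.
  exists (fun n => F n `*` G n).
    rewrite -setXTT TF TG predeqE => -[x y]; split.
      move=> [/= [n _ Fnx] [k _ Gky]]; exists (maxn n k) => //; split.
      - by move: x Fnx; exact/subsetPset/ndF/leq_maxl.
      - by move: y Gky; exact/subsetPset/ndG/leq_maxr.
    by move=> [n _ []/= ? ?]; split; exists n.
  move=> k; have [? ?] := Foo k; have [? ?] := Goo k.
  split; first exact: measurableX.
  by rewrite nuE product_measure1E// lte_mul_pinfty// ge0_fin_numE.
exact: sigma_finite_measure_fun.
Qed.

Section lebesgue_matrix.
Context {R : realType}.
Local Open Scope ereal_scope.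

Definition row_cons n (x : measurableTypeR R * 'rV[R]_n) : 'rV[R]_n.+1 :=
  row_mx (const_mx x.1 : 'rV[R]_1) x.2.

Fixpoint lebesgue_rV n : set 'rV[R]_n -> \bar R :=
  match n with
  | 0%N => \d_(0%R : 'rV[R]_0)
  | k.+1 => pushforward (lebesgue_measure \x @lebesgue_rV k) (@row_cons k)
  end.

Definition lebesgue_mx m n : set 'M[R]_(m, n) -> \bar R :=
  pushforward (@lebesgue_rV (m * n)) vec_mx.

Definition sym_cons n (x : measurableTypeR R * 'rV[R]_n * 'M[R]_n) :
    'M[R]_n.+1 :=
  block_mx (const_mx x.1.1 : 'M[R]_1) x.1.2 (x.1.2)^T x.2.

(* Lebesgue measure of the space of symmetric matrices, in the coordinates
   given by the entries on and above the diagonal, as a measure on all square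
   matrices. *)
Fixpoint lebesgue_sym n : set 'M[R]_n -> \bar R :=
  match n with
  | 0%N => \d_(0%R : 'M[R]_0)
  | k.+1 => pushforward (lebesgue_measure \x @lebesgue_rV k \x @lebesgue_sym k)
              (@sym_cons k)
  end.

End lebesgue_matrix.
Arguments lebesgue_rV {R} n _.
Arguments lebesgue_mx {R} m n _.
Arguments lebesgue_sym {R} n _.

Section lebesgue_matrix_sigma_finite.
Context {R : realType}.

Lemma lebesgue_rV_sigma_finite n :
  is_sigma_finite_measure (@lebesgue_rV R n).
Proof.
elim: n => [|n [nu nuE]] /=; first by eexists.
have [L LE] := sigma_finite_product (@lebesgue_measure R) nu.
rewrite nuE LE.
apply: (@sigma_finite_pushforward _ _ _ _ _ _ _
  (fun v : 'rV[R]_n.+1 => (v 0 0 : measurableTypeR R, rsubmx (v : 'M[R]_(1, 1 + n))))).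
- apply: measurable_fun_mxP => i j; rewrite /row_cons.
  case: (split_ordP (j : 'I_(1 + n))) => k ->.
    under eq_fun do rewrite (row_mxEl (const_mx _ : 'rV[R]_1)) mxE.
    exact: measurable_fst.
  under eq_fun do rewrite (row_mxEr (const_mx _ : 'rV[R]_1)).
  exact: (measurableT_comp (measurable_mxE _ _) measurable_snd).
- apply: measurable_fun_pair; first exact: measurable_mxE.
  apply: measurable_fun_mxP => i j /=.
  under eq_fun do rewrite mxE.
  exact: measurable_mxE.
- case=> a v; rewrite /row_cons; congr (_, _); last by rewrite row_mxKr.
  have -> : (0 : 'I_n.+1) = lshift n (0 : 'I_1) by exact: val_inj.
  by rewrite (row_mxEl (const_mx _ : 'rV[R]_1)) mxE.
Qed.

Lemma lebesgue_mx_sigma_finite m n :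
  is_sigma_finite_measure (@lebesgue_mx R m n).
Proof.
have [nu nuE] := lebesgue_rV_sigma_finite (m * n).
rewrite /lebesgue_mx nuE.
apply: (sigma_finite_pushforward _ _ _ (@vec_mxK _ _ _)).
- apply: measurable_fun_mxP => i j.
  under eq_fun do rewrite mxE.
  exact: measurable_mxE.
- apply: measurable_fun_mxP => i j; case/mxvec_indexP: j => k l.
  apply: eq_measurable_fun (measurable_mxE k l) => M _.
  by rewrite ord1 mxvecE.
Qed.

Lemma lebesgue_sym_sigma_finite n :
  is_sigma_finite_measure (@lebesgue_sym R n).
Proof.
elim: n => [|n [nu nuE]] /=; first by eexists.
have [mu muE] := lebesgue_rV_sigma_finite n.
have [L1 L1E] := sigma_finite_product (@lebesgue_measure R) mu.
have [L LE] := sigma_finite_product L1 nu.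
rewrite nuE muE L1E LE.
apply: (@sigma_finite_pushforward _ _ _ _ _ _ _
  (fun M : 'M[R]_n.+1 => (M 0 0 : measurableTypeR R, ursubmx (M : 'M[R]_(1 + n)),
                          drsubmx (M : 'M[R]_(1 + n))))).
- apply: measurable_fun_mxP => i j; rewrite /sym_cons.
  case: (split_ordP (i : 'I_(1 + n))) => k ->;
    case: (split_ordP (j : 'I_(1 + n))) => l ->.
  + under eq_fun do rewrite (block_mxEul (const_mx _ : 'M[R]_1)) mxE.
    exact: (measurableT_comp measurable_fst measurable_fst).
  + under eq_fun do rewrite (block_mxEur (const_mx _ : 'M[R]_1)).
    apply: (measurableT_comp (measurable_mxE _ _)).
    exact: (measurableT_comp measurable_snd measurable_fst).
  + under eq_fun do rewrite (block_mxEdl (const_mx _ : 'M[R]_1)) mxE.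
    apply: (measurableT_comp (measurable_mxE _ _)).
    exact: (measurableT_comp measurable_snd measurable_fst).
  + under eq_fun do rewrite (block_mxEdr (const_mx _ : 'M[R]_1)).
    exact: (measurableT_comp (measurable_mxE _ _) measurable_snd).
- apply: measurable_fun_pair; first apply: measurable_fun_pair.
  + exact: measurable_mxE.
  + apply: measurable_fun_mxP => i j /=.
    under eq_fun do rewrite !mxE.
    exact: measurable_mxE.
  + apply: measurable_fun_mxP => i j /=.
    under eq_fun do rewrite !mxE.
    exact: measurable_mxE.
- case=> -[a v] M; rewrite /sym_cons; congr (_, _, _).
  + have -> : (0 : 'I_n.+1) = lshift n (0 : 'I_1) by exact: val_inj.
    by rewrite (block_mxEul (const_mx _ : 'M[R]_1)) mxE.
  + by rewrite block_mxKur.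
  + by rewrite block_mxKdr.
Qed.
End lebesgue_matrix_sigma_finite.

Section lebesgue_matrix_instances.
Context {R : realType}.

Lemma is_sigma_finite_measureP d (T : measurableType d)
    (mu : set T -> \bar R) : is_sigma_finite_measure mu ->
  [/\ mu set0 = 0%E, forall A, (0 <= mu A)%E, semi_sigma_additive mu &
      sigma_finite setT mu].
Proof.
move=> [nu ->]; split; [exact: measure0|exact: measure_ge0|
  exact: measure_semi_sigma_additive|exact: sigma_finiteT].
Qed.

Section rV.
Variable n : nat.
Let H := is_sigma_finite_measureP (@lebesgue_rV_sigma_finite R n).
Let H0 : @lebesgue_rV R n set0 = 0%E. Proof. by case: H. Qed.
Let H1 A : (0 <= @lebesgue_rV R n A)%E. Proof. by case: H. Qed.
Let H2 : semi_sigma_additive (@lebesgue_rV R n). Proof. by case: H. Qed.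
Let H3 : sigma_finite setT (@lebesgue_rV R n). Proof. by case: H. Qed.
HB.instance Definition _ := isMeasure.Build _ _ _ (@lebesgue_rV R n) H0 H1 H2.
HB.instance Definition _ :=
  Measure_isSigmaFinite.Build _ _ _ (@lebesgue_rV R n) H3.
End rV.

Section mx.
Variables m n : nat.
Let H := is_sigma_finite_measureP (@lebesgue_mx_sigma_finite R m n).
Let H0 : @lebesgue_mx R m n set0 = 0%E. Proof. by case: H. Qed.
Let H1 A : (0 <= @lebesgue_mx R m n A)%E. Proof. by case: H. Qed.
Let H2 : semi_sigma_additive (@lebesgue_mx R m n). Proof. by case: H. Qed.
Let H3 : sigma_finite setT (@lebesgue_mx R m n). Proof. by case: H. Qed.
HB.instance Definition _ := isMeasure.Build _ _ _ (@lebesgue_mx R m n) H0 H1 H2.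
HB.instance Definition _ :=
  Measure_isSigmaFinite.Build _ _ _ (@lebesgue_mx R m n) H3.
End mx.

Section sym.
Variable n : nat.
Let H := is_sigma_finite_measureP (@lebesgue_sym_sigma_finite R n).
Let H0 : @lebesgue_sym R n set0 = 0%E. Proof. by case: H. Qed.
Let H1 A : (0 <= @lebesgue_sym R n A)%E. Proof. by case: H. Qed.
Let H2 : semi_sigma_additive (@lebesgue_sym R n). Proof. by case: H. Qed.
Let H3 : sigma_finite setT (@lebesgue_sym R n). Proof. by case: H. Qed.
HB.instance Definition _ := isMeasure.Build _ _ _ (@lebesgue_sym R n) H0 H1 H2.
HB.instance Definition _ :=
  Measure_isSigmaFinite.Build _ _ _ (@lebesgue_sym R n) H3.
End sym.

End lebesgue_matrix_instances.

Section geometric_ergodicity.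
Context d (T : measurableType d) (R : realType).

Fixpoint iter_kernel (P : R.-pker T ~> T) (t : nat) : R.-spker T ~> T :=
  match t with
  | 0%N => kdirac (@measurable_id _ T setT)
  | k.+1 => mkcomp_noparam P (iter_kernel P k)
  end.

(* E is the state space of the chain; P need only be meaningful on the ambient
   type T. The supremum is over all measurable sets of T. *)
Definition geometrically_ergodic (E : set T) (P : R.-pker T ~> T)
    (Pi : probability T R) : Prop :=
  exists rho : R, 0 < rho < 1 /\
  exists M : T -> R, (forall s, E s -> 0 <= M s) /\
  forall (s : T) (t : nat), E s -> (1 <= t)%N ->
    (ereal_sup [set `|iter_kernel P t s B - Pi B| | B in measurable]
      <= (M s * rho ^+ t)%:E)%E.

Definition normalize_density (mu : set T -> \bar R) (f : T -> R) (x : T) : R :=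
  f x / fine (\int[mu]_z (f z)%:E)%E.

End geometric_ergodicity.

Section matrix_densities.
Context {R : realType}.

(* mxvec stacks the rows; vec stacks the columns. *)
Definition vec m n (A : 'M[R]_(m, n)) : 'cV[R]_(n * m) := (mxvec A^T)^T.
Definition unvec m n (v : 'cV[R]_(n * m)) : 'M[R]_(m, n) := (vec_mx v^T)^T.

Lemma vecK m n : cancel (@vec m n) (@unvec m n).
Proof. by move=> A; rewrite /vec /unvec !trmxK mxvecK trmxK. Qed.

Lemma unvecK m n : cancel (@unvec m n) (@vec m n).
Proof. by move=> v; rewrite /vec /unvec trmxK vec_mxK trmxK. Qed.

Definition qform d (C : 'M[R]_d) (x : 'cV[R]_d) : R := (x^T *m C *m x) 0 0.

Definition spd d (C : 'M[R]_d) : Prop :=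
  C^T = C /\ forall x : 'cV[R]_d, x != 0 -> 0 < qform C x.

Definition mvnormal_pdf d (mu : 'cV[R]_d) (C : 'M[R]_d) (x : 'cV[R]_d) : R :=
  expR (- (qform (invmx C) (x - mu) / 2)) /
  Num.sqrt ((2 * pi) ^+ d * \det C).

Definition invwishart_pdf d (k : nat) (B S : 'M[R]_d) : R :=
  normalize_density (lebesgue_sym d)
    (fun S' => if `[< spd S' >] then
       \det S' `^ (- ((k + d + 1)%:R / 2)) * expR (- (\tr (invmx S' *m B) / 2))
     else 0) S.

End matrix_densities.

(* A state is (A, nu, theta, beta, Sigma), with nu, theta and beta the vec's of
   matrices with m columns and n, q and p rows. *)
Notation eiv_state R m n p q :=
  ('M[R]_(n, p) * 'cV[R]_(m * n) * 'cV[R]_(m * q) * 'cV[R]_(m * p) * 'M[R]_m)%type.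

Section errors_in_variables.
Context {R : realType} (m n p q : nat).
Local Notation state := (eiv_state R m n p q).

Definition lebesgue_state : set state -> \bar R :=
  (lebesgue_mx n p \x lebesgue_mx (m * n) 1 \x lebesgue_mx (m * q) 1
    \x lebesgue_mx (m * p) 1 \x lebesgue_sym m)%E.

Definition lebesgue_latent :
    set ('cV[R]_(m * n) * 'cV[R]_(m * q) * 'cV[R]_(m * p)) -> \bar R :=
  (lebesgue_mx (m * n) 1 \x lebesgue_mx (m * q) 1 \x lebesgue_mx (m * p) 1)%E.

Definition eiv_space : set state := [set s | spd s.2].

Section posterior.
Variables (U : 'I_n -> 'M[R]_m) (V : 'I_n -> 'M[R]_p) (Z : 'I_n -> 'cV[R]_q).
Variables (y : 'I_n -> 'cV[R]_m) (x : 'I_n -> 'cV[R]_p).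
Variables (a0 : nat) (B0 : 'M[R]_m).
Variables (j0 : 'cV[R]_(m * q + m * p)) (J0 : 'M[R]_(m * q + m * p)).

Definition latent_response (nu : 'cV[R]_(m * n)) (i : 'I_n) : 'cV[R]_m :=
  (row i (unvec nu))^T.

Definition latent_feature (A : 'M[R]_(n, p)) (i : 'I_n) : 'cV[R]_p :=
  (row i A)^T.

Definition regression_mean (A : 'M[R]_(n, p)) (th : 'cV[R]_(m * q))
    (be : 'cV[R]_(m * p)) (i : 'I_n) : 'cV[R]_m :=
  (unvec th)^T *m Z i + (unvec be)^T *m latent_feature A i.

(* Joint density of the model at the observed data; the flat prior on the
   latent features contributes the factor 1. *)
Definition eiv_model_density (s : state) : R :=
  let: (A, nu, th, be, Sg) := s in
  (\prod_(i < n)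
     (mvnormal_pdf (latent_response nu i) (U i) (y i) *
      mvnormal_pdf (regression_mean A th be i) Sg (latent_response nu i) *
      mvnormal_pdf (x i) (V i) (latent_feature A i))) *
  invwishart_pdf a0 B0 Sg * mvnormal_pdf j0 J0 (col_mx th be).

(* The posterior density up to its normalizing constant, extended by 0 to the
   states in which Sigma is not symmetric positive-definite. *)
Definition eiv_posterior (s : state) : R :=
  let: (A, nu, th, be, Sg) := s in
  if `[< spd Sg >] then
    \det Sg `^ (- ((n + a0 + m + 1)%:R / 2)) *
    expR (- (\tr (invmx Sg *m B0) / 2)
          - (\sum_(i < n) qform (invmx Sg)
               (latent_response nu i - regression_mean A th be i)) / 2) *
    expR (- (\sum_(i < n) qform (invmx (U i)) (latent_response nu i - y i)) / 2
          - (\sum_(i < n) qform (invmx (V i)) (latent_feature A i - x i)) / 2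
          - qform (invmx J0) (col_mx th be - j0) / 2)
  else 0.

End posterior.

Section gibbs.
Variable f : state -> R.

Definition cond_Sigma A nu th be : 'M[R]_m -> R :=
  normalize_density (lebesgue_sym m) (fun Sg => f (A, nu, th, be, Sg)).

Definition cond_latent A Sg :
    'cV[R]_(m * n) * 'cV[R]_(m * q) * 'cV[R]_(m * p) -> R :=
  normalize_density lebesgue_latent (fun w => f (A, w.1.1, w.1.2, w.2, Sg)).

Definition cond_feature nu th be Sg : 'M[R]_(n, p) -> R :=
  normalize_density (lebesgue_mx n p) (fun A => f (A, nu, th, be, Sg)).

(* The current Sigma is discarded: a step draws Sigma, then (nu, theta, beta)
   jointly, then A. *)
Definition gibbs_transition (s : state) (B : set state) : \bar R :=
  let: (A, nu, th, be, _) := s in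
  (\int[lebesgue_sym m]_Sg ((cond_Sigma A nu th be Sg)%:E *
   \int[lebesgue_latent]_w ((cond_latent A Sg w)%:E *
   \int[lebesgue_mx n p]_A' ((cond_feature w.1.1 w.1.2 w.2 Sg A')%:E *
     (\1_B (A', w.1.1, w.1.2, w.2, Sg))%:E))))%E.

Definition has_density_proportional_to (Pi : set state -> \bar R) : Prop :=
  forall B, measurable B ->
    Pi B = (\int[lebesgue_state]_(s in B) (normalize_density lebesgue_state f s)%:E)%E.

End gibbs.
End errors_in_variables.
Arguments eiv_space {R} m n p q _.

(* Main.v *)
Require Import Defs.
From HB Require Import structures.
From mathcomp Require Import all_boot all_order all_algebra.
From mathcomp Require Import all_classical all_reals all_analysis.
From mathcomp Require Import measurable_realfun.
From mathcomp Require Import ring lra.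
Set Implicit Arguments.
Unset Strict Implicit.
Unset Printing Implicit Defensive.
Import Order.TTheory GRing.Theory Num.Theory.
Import numFieldNormedType.Exports.
Local Open Scope classical_set_scope.
Local Open Scope ring_scope.

(* The chain is uniformly ergodic, by Doeblin's argument in two steps.
   First, the law after one step is tight uniformly in the starting state:
   - the full conditional of Sigma has an exponential moment of
     tr (Sigma^-1 B0) bounded independently of the conditioning variables,
     because that trace and the quadratic misfit are homogeneous of degree -1
     in Sigma, so that rescaling Sigma compares the two integrals involved;
   - the full conditional of (nu, theta, beta) is the Gaussian prior factor
     times exp (- misfit / 2), where the misfit is nonnegative and homogeneous
     of degree 2, and the same rescaling bounds its exponential moments;
   - the conditional density of the latent features is then bounded below by
     a multiple of its Gaussian prior factor.
   Second, from a state with bounded features and (nu, theta, beta), the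
   transition density is bounded below by a fixed density, because the misfit
   is at most tr (Sigma^-1) times the sum of the squared residuals.
   The normalizing constants are finite by a Schur complement induction, which
   computes the Gaussian and inverse-Wishart integrals. *)

(** * Densities and kernels *)

(** One step has no minorization valid from all states: as the residuals of the current state grow,
    the full conditional of [Sigma] escapes to infinity. Since [B0] bounds the inverse-Wishart scale
    from below, that conditional nevertheless stays uniformly away from singular matrices, and a
    large [Sigma] is harmless because it flattens the misfit. Hence only [Sigma^-1] has to be
    controlled; and as the next step does not read the current [Sigma], the set from which it is
    minorized does not restrict [Sigma] at all. The moment bounds have to be relative, comparing an
    integral with the normalizing constant of the same conditional, because that constant has no
    positive lower bound uniform in the conditioning variables. A dilation relates the two integrals
    without evaluating either. Traces and squared Frobenius norms stand for eigenvalues and norms,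
    and pivoting replaces the spectral theorem. The probabilistic part is carried out for an
    abstract density [g z * expR (- (h x y z / 2)) * phi y * psi x] in which [h] is nonnegative and
    bounded by a product of gauges of the blocks. *)

Section measurable_inverse.
Context d (T : measurableType d) (R : realType).

Lemma measurable_fun_inv (f : T -> R) : measurable_fun setT f ->
  measurable_fun setT (fun x => (f x)^-1).
Proof.
move=> mf.
(* Squaring makes the base nonnegative, where the power [-1] is the inverse; at the zeros of [f]
   both sides are [0]. *)
have -> : (fun x => (f x)^-1) = (fun x => f x * (f x ^+ 2) `^ (-1)).
  apply/funext => x; rewrite powR_inv1 ?sqr_ge0//.
  have [->|fx] := eqVneq (f x) 0; first by rewrite mul0r invr0.
  by rewrite expr2 invfM mulrA divff// mul1r.
apply: measurable_funM => //.
apply: (measurableT_comp (measurable_powR _)).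
exact: measurable_funX.
Qed.

End measurable_inverse.

Section density_measures.
Local Open Scope ereal_scope.
Context d (T : measurableType d) (R : realType).

Lemma measure_of_fun (mu : set T -> \bar R) : mu set0 = 0 ->
  (forall A, 0 <= mu A) -> semi_sigma_additive mu ->
  exists nu : {measure set T -> \bar R}, nu = mu :> (set T -> \bar R).
Proof.
move=> mu0 mu_ge0 mu_add.
pose M := isMeasure.Build _ _ _ mu mu0 mu_ge0 mu_add.
pose muM : {measure set T -> \bar R} := HB.pack mu M.
by exists muM.
Qed.

Lemma probability_of_fun (mu : set T -> \bar R) : mu set0 = 0 ->
  (forall A, 0 <= mu A) -> semi_sigma_additive mu -> mu setT = 1 ->
  exists nu : probability T R, nu = mu :> (set T -> \bar R).
Proof.
move=> mu0 mu_ge0 mu_add mu1.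
pose M := isMeasure.Build _ _ _ mu mu0 mu_ge0 mu_add.
pose muM : {measure set T -> \bar R} := HB.pack mu M.
pose S := Measure_isProbability.Build _ _ _ muM mu1.
pose muP : probability T R := HB.pack mu M S.
by exists muP.
Qed.

Variable m : {measure set T -> \bar R}.

Lemma density_measure_properties (f : T -> R) : measurable_fun setT f ->
  (forall x, (0 <= f x)%R) ->
  [/\ \int[m]_(x in set0) (f x)%:E = 0,
      forall A, 0 <= \int[m]_(x in A) (f x)%:E &
      semi_sigma_additive (fun A => \int[m]_(x in A) (f x)%:E)].
Proof.
move=> mf f0; split; first by rewrite integral_set0.
  by move=> A; apply: integral_ge0 => x _; rewrite lee_fin.
move=> F mF tF mUF; rewrite ge0_integral_bigcup//.
- by apply: is_cvg_ereal_nneg_natsum_cond => n _ _; apply: integral_ge0 => x _;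
    rewrite lee_fin.
- by apply/measurable_EFinP; apply: measurable_funTS.
- by move=> x _; rewrite lee_fin.
Qed.

Lemma density_measure (f : T -> R) : measurable_fun setT f ->
  (forall x, (0 <= f x)%R) ->
  exists nu : {measure set T -> \bar R},
    forall A, nu A = \int[m]_(x in A) (f x)%:E.
Proof.
move=> mf f0; have [h0 h1 h2] := density_measure_properties mf f0.
by have [nu E] := measure_of_fun h0 h1 h2; exists nu => A; rewrite E.
Qed.

Lemma density_probability (f : T -> R) : measurable_fun setT f ->
  (forall x, (0 <= f x)%R) -> \int[m]_x (f x)%:E = 1 ->
  exists nu : probability T R, forall A, nu A = \int[m]_(x in A) (f x)%:E.
Proof.
move=> mf f0 f1; have [h0 h1 h2] := density_measure_properties mf f0.
by have [nu E] := probability_of_fun h0 h1 h2 f1; exists nu => A; rewrite E.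
Qed.

Import HBNNSimple.

(** True for indicators by hypothesis, for simple functions by linearity, and in general by monotone
    convergence along [nnsfun_approx]. *)
Lemma integral_density (nu : {measure set T -> \bar R}) (f : T -> R)
    (g : T -> \bar R) : measurable_fun setT f -> (forall x, (0 <= f x)%R) ->
  (forall A, measurable A -> nu A = \int[m]_(x in A) (f x)%:E) ->
  measurable_fun setT g -> (forall x, 0 <= g x) ->
  \int[nu]_x g x = \int[m]_x ((f x)%:E * g x).
Proof.
move=> mf f0 nuE mg g0.
pose g_ := nnsfun_approx measurableT mg.
have gcvg x : EFin (g_ n x) @[n --> \oo] --> g x.
  by apply: cvg_nnsfun_approx => // *; exact: g0.
have mfE : measurable_fun setT (EFin \o f) by exact/measurable_EFinP.
transitivity (limn (fun n => \int[nu]_x (g_ n x)%:E)).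
  rewrite -monotone_convergence//.
  - by apply: eq_integral => x _; apply/esym/cvg_lim => //; exact: gcvg.
  - by move=> n; exact/measurable_EFinP/measurable_funP.
  - by move=> n x _; rewrite lee_fin.
  - by move=> x _ i j ij; rewrite lee_fin; exact/lefP/nd_nnsfun_approx.
transitivity (limn (fun n => \int[m]_x ((f x)%:E * (g_ n x)%:E))); last first.
  rewrite -monotone_convergence//.
  - apply: eq_integral => x _; apply/cvg_lim => //.
    apply: cvgeZl => //; exact: gcvg.
  - move=> n; apply: emeasurable_funM => //.
    exact/measurable_EFinP/measurable_funP.
  - by move=> n x _; rewrite mule_ge0 ?lee_fin.
  - move=> x _ i j ij; rewrite lee_pmul ?lee_fin//.
    exact/lefP/nd_nnsfun_approx.
congr (limn _); apply/funext => n.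
rewrite integralT_nnsfun sintegralE.
under eq_integral => x _.
  rewrite fimfunE -fsumEFin// ge0_mule_fsumr; last first.
    by move=> r; exact: nnfun_muleindic_ge0.
  over.
rewrite ge0_integral_fsum//.
- apply: eq_fsbigr => r _.
  (* A negative level has an empty preimage and contributes [0] on both sides; a nonnegative one can
     be pulled out of the integral. *)
  have [r0|r0] := ltP r 0%R.
    rewrite preimage_nnfun0// measure0 mule0.
    by under eq_integral do rewrite indic0 mulr0 mule0; rewrite integral0.
  under eq_integral => x _ do rewrite EFinM muleCA.
  rewrite ge0_integralZl_EFin//.
  + rewrite nuE//; congr (_ * _).
    rewrite integral_mkcond; apply: eq_integral => x _.
    rewrite /patch indicE; case: ifPn => /= xA; first by rewrite mule1.
    by rewrite mule0.
  + by move=> x _; rewrite mule_ge0 ?lee_fin.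
  + apply: emeasurable_funM => //; exact/measurable_EFinP.
- move=> r; apply: emeasurable_funM => //.
  by apply/measurable_EFinP; apply: measurable_funM => //.
- move=> r x _; rewrite mule_ge0 ?lee_fin//; exact: nnfun_muleindic_ge0.
Qed.

End density_measures.

Section density_kernels.
Local Open Scope ereal_scope.
Context d1 d2 (T1 : measurableType d1) (T2 : measurableType d2) (R : realType).

Lemma pkernel_of_fun (k : T1 -> {measure set T2 -> \bar R}) :
  (forall B, measurable B -> measurable_fun setT (k ^~ B)) ->
  (forall x, k x setT = 1) ->
  exists P : R.-pker T1 ~> T2, forall x B, P x B = k x B.
Proof.
move=> mk k1.
pose K := isKernel.Build _ _ T1 T2 R k mk.
pose kK : R.-ker T1 ~> T2 := HB.pack k K.
pose S := Kernel_isProbability.Build _ _ T1 T2 R kK k1.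
pose kP : R.-pker T1 ~> T2 := HB.pack k K S.
by exists kP.
Qed.

(** Writing the integral over [B] as the integral of [k] times an indicator turns measurability in
    the starting point into a case of Tonelli's theorem. *)
Lemma density_pkernel (m : {sigma_finite_measure set T2 -> \bar R})
    (k : T1 * T2 -> R) : measurable_fun setT k ->
  (forall z, (0 <= k z)%R) -> (forall x, \int[m]_y (k (x, y))%:E = 1) ->
  exists P : R.-pker T1 ~> T2,
    forall x B, P x B = \int[m]_(y in B) (k (x, y))%:E.
Proof.
move=> mk k0 k1.
have mkx x : measurable_fun setT (fun y => k (x, y)).
  exact: (measurableT_comp mk (measurable_pair1 x)).
have [K KE] : {K : T1 -> {measure set T2 -> \bar R} &
    forall x B, K x B = \int[m]_(y in B) (k (x, y))%:E}.
  have H x : exists nu : {measure set T2 -> \bar R},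
      forall A, nu A = \int[m]_(y in A) (k (x, y))%:E.
    exact: density_measure.
  by exists (fun x => sval (cid (H x))) => x B; case: cid.
have [P PE] : exists P : R.-pker T1 ~> T2, forall x B, P x B = K x B.
  apply: pkernel_of_fun => [B mB|x]; last by rewrite KE.
  under eq_fun do rewrite KE integral_mkcond.
  rewrite (_ : (fun x => _) = fubini_F m
      (fun z => (k z * \1_(B) z.2)%:E)); last first.
    apply/funext => x; apply: eq_integral => y _ /=.
    rewrite /patch indicE; case: ifPn => _ /=; first by rewrite mulr1.
    by rewrite mulr0.
  apply: measurable_fun_fubini_tonelli_F.
    apply/measurable_EFinP/measurable_funM => //.
    exact: (measurableT_comp (measurable_indic mB)).
  by move=> z /=; rewrite lee_fin mulr_ge0.
by exists P => x B; rewrite PE KE.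
Qed.

End density_kernels.

(** * Doeblin's condition *)

Section bounded_integration.
Context d (T : measurableType d) (R : realType).

Lemma bounded_integrable (mu : {measure set T -> \bar R}) (u : T -> R) a b :
  (mu setT < +oo)%E -> measurable_fun setT u -> (forall s, a <= u s <= b) ->
  mu.-integrable setT (EFin \o u).
Proof.
move=> muT mu_u ab; apply: measurable_bounded_integrable => //.
exists (`|a| + `|b|); split; first by rewrite num_real.
move=> c lc z _ /=; apply: le_trans (ltW lc).
have /andP[az zb] := ab z; rewrite ler_norml; apply/andP; split.
  rewrite lerNl; apply: (@le_trans _ _ (- a)); first by rewrite lerN2.
  by apply: (le_trans (ler_norm _)); rewrite normrN lerDl.
by rewrite (le_trans zb)// (le_trans (ler_norm _))// lerDr.
Qed.

Variables (mu : {measure set T -> \bar R}) (mu1 : mu setT = 1%E).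

Lemma prob_Rintegral_cst (c : R) : \int[mu]_z c = c.
Proof. by rewrite Rintegral_cst//= mu1 mulr1. Qed.

Lemma prob_integrable (u : T -> R) a b :
  measurable_fun setT u -> (forall s, a <= u s <= b) ->
  mu.-integrable setT (EFin \o u).
Proof. by apply: bounded_integrable; rewrite mu1 ltry. Qed.

Lemma prob_Rintegral_bounds (u : T -> R) a b :
  measurable_fun setT u -> (forall s, a <= u s <= b) ->
  a <= \int[mu]_z u z <= b.
Proof.
move=> mu_u ab; have iu := prob_integrable mu_u ab.
have ic (c : R) : mu.-integrable setT (EFin \o cst c).
  by apply: (@prob_integrable _ c c) => // s; rewrite !lexx.
apply/andP; split.
  rewrite -{1}(prob_Rintegral_cst a); apply: le_Rintegral => //; first exact: ic.
  by move=> z _; case/andP: (ab z).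
rewrite -{1}(prob_Rintegral_cst b); apply: le_Rintegral => //; first exact: ic.
by move=> z _; case/andP: (ab z).
Qed.

Lemma prob_RintegralB (u v : T -> R) a b a' b' :
  measurable_fun setT u -> (forall s, a <= u s <= b) ->
  measurable_fun setT v -> (forall s, a' <= v s <= b') ->
  \int[mu]_z (u z - v z) = \int[mu]_z u z - \int[mu]_z v z.
Proof.
move=> mu_u ub mv vb; apply: RintegralB => //.
  exact: prob_integrable mu_u ub.
exact: prob_integrable mv vb.
Qed.

End bounded_integration.

Section doeblin.
Context d (T : measurableType d) (R : realType).
Variable P : R.-pker T ~> T.

Let PT s : P s setT = 1%E. Proof. exact: prob_kernel. Qed.

(** The Markov operator of [P] on functions, kept real-valued so that bounds can be subtracted. *)
Definition kernel_mean (u : T -> R) (s : T) : R := \int[P s]_z u z.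

Lemma measurable_kernel_mean (u : T -> R) :
  measurable_fun setT u -> (forall s, 0 <= u s) ->
  measurable_fun setT (kernel_mean u).
Proof.
move=> mu_u u0; apply: measurableT_comp => //.
apply: (measurable_fun_integral_kernel (l := P)) => //.
- by move=> U mU; exact: measurable_kernel.
- exact/measurable_EFinP.
Qed.

Variables (Q : {measure set T -> \bar R}) (C : set T) (delta : R).
Hypotheses (mC : measurable C) (delta0 : 0 < delta).
Hypothesis PC : forall s, (delta%:E <= P s C)%E.
Hypothesis QP : forall z, C z -> forall B, measurable B -> (Q B <= P z B)%E.

(** Takes a point of [T]: on an empty space [PC] is vacuous and [C] is empty. *)
Let C_neq0 (s : T) : exists z, C z.
Proof.
apply: contrapT => nC; have := PC s.
have -> : C = set0 by apply/seteqP; split => // z Cz; apply: nC; exists z.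
by rewrite measure0 lee_fin leNgt delta0.
Qed.

Let QT_le1 (s : T) : (Q setT <= 1)%E.
Proof.
by have [z Cz] := C_neq0 s; apply: le_trans (QP Cz measurableT) _; rewrite PT.
Qed.

Let QT_fin (s : T) : (Q setT < +oo)%E.
Proof. exact: le_lt_trans (QT_le1 s) (ltry _). Qed.

Lemma minorized_mean (w : T -> R) z b : C z -> measurable_fun setT w ->
  (forall s, 0 <= w s <= b) -> \int[Q]_x w x <= kernel_mean w z.
Proof.
move=> Cz mw w0; apply: fine_le.
- apply: integrable_fin_num => //.
  by apply: bounded_integrable mw w0; exact: QT_fin z.
- apply: integrable_fin_num => //.
  by apply: bounded_integrable mw w0; rewrite PT ltry.
apply: ge0_le_measure_integral => //.
- by move=> S mS; exact: QP.
- by move=> x; rewrite lee_fin; case/andP: (w0 x).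
- exact/measurable_EFinP.
Qed.

Lemma reached_mean (w : T -> R) s b kappa : measurable_fun setT w ->
  (forall z, 0 <= w z <= b) -> 0 <= kappa -> (forall z, C z -> kappa <= w z) ->
  delta * kappa <= kernel_mean w s.
Proof.
move=> mw w0 k0 kw.
have iw : (P s).-integrable setT (EFin \o w).
  by apply: bounded_integrable mw w0; rewrite PT ltry.
rewrite -lee_fin /kernel_mean /Rintegral fineK ?integrable_fin_num//.
rewrite EFinM muleC.
apply: (@le_trans _ _ (kappa%:E * P s C)%E).
  by apply: lee_wpmul2l; rewrite ?lee_fin.
rewrite -integral_cst// integral_mkcond.
apply: ge0_le_integral => //.
- by move=> z _; rewrite /patch; case: ifPn; rewrite ?lee_fin.
- exact/(measurable_restrictT _ _).1.
- exact/measurable_EFinP.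
move=> z _; rewrite /patch; case: ifPn => [/set_mem Cz|_]; rewrite lee_fin.
  exact: kw.
by case/andP: (w0 z).
Qed.

Let eps := delta * fine (Q setT).

(* [delta * Q] minorizes two steps of the chain, so that the oscillation of a
   bounded function shrinks by the factor [1 - delta * Q setT]. *)
Lemma two_step_contraction (u : T -> R) a b : measurable_fun setT u -> 0 <= a ->
  (forall s, a <= u s <= b) ->
  exists a' b', [/\ 0 <= a', b' - a' = (1 - eps) * (b - a) &
    forall s, a' <= kernel_mean (kernel_mean u) s <= b'].
Proof.
move=> mu_u a0 ab.
have iab (v : T -> R) : measurable_fun setT v -> (forall s, a <= v s <= b) ->
    forall s, a <= kernel_mean v s <= b.
  by move=> mv vb s; exact: prob_Rintegral_bounds.
have mPu : measurable_fun setT (kernel_mean u).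
  by apply: measurable_kernel_mean => // s; case/andP: (ab s) => /(le_trans a0).
have lowE (v : T -> R) s : measurable_fun setT v -> (forall s, a <= v s <= b) ->
    kernel_mean (fun z => v z - a) s = kernel_mean v s - a.
  move=> mv vb; rewrite /kernel_mean (prob_RintegralB (PT s) (a' := a) (b' := a) mv vb)//.
    by rewrite prob_Rintegral_cst.
  by move=> z; rewrite lexx.
have upE (v : T -> R) s : measurable_fun setT v -> (forall s, a <= v s <= b) ->
    kernel_mean (fun z => b - v z) s = b - kernel_mean v s.
  move=> mv vb; rewrite /kernel_mean (prob_RintegralB (PT s) (a := b) (b := b) _ _ mv vb)//.
    by rewrite prob_Rintegral_cst.
  by move=> z; rewrite lexx.
have mlow (v : T -> R) : measurable_fun setT v -> measurable_fun setT (fun z => v z - a).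
  by move=> mv; exact: measurable_funB.
have mup (v : T -> R) : measurable_fun setT v -> measurable_fun setT (fun z => b - v z).
  by move=> mv; exact: measurable_funB.
have blow (v : T -> R) : (forall s, a <= v s <= b) ->
    forall s, 0 <= v s - a <= b - a.
  by move=> vb s; rewrite subr_ge0 lerD2r.
have bup (v : T -> R) : (forall s, a <= v s <= b) ->
    forall s, 0 <= b - v s <= b - a.
  by move=> vb s; rewrite subr_ge0 lerD2l lerN2 andbC.
(* The [Q]-masses lying above [a] and below [b]. One of them may be small, but they add up to
   [(b - a) * Q setT], and this sum is the length lost by the interval, up to the factor [delta]. *)
pose k := \int[Q]_x (u x - a); pose k' := \int[Q]_x (b - u x).
have k0 : 0 <= k by apply: Rintegral_ge0 => x _; case/andP: (blow _ ab x).
have k'0 : 0 <= k' by apply: Rintegral_ge0 => x _; case/andP: (bup _ ab x).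
exists (a + delta * k), (b - delta * k'); split.
- by rewrite addr_ge0// mulr_ge0// ltW.
(* On an empty space [Q] is null, so [eps = 0] and the interval keeps its length. *)
- have [[s]|nT] := pselect (exists s : T, True); last first.
    have T0 : [set: T] = set0.
      by apply/seteqP; split => // z _; apply: nT; exists z.
    rewrite /eps /k /k' T0 !Rintegral_set0 measure0/=; ring.
  have kk' : k + k' = (b - a) * fine (Q setT).
    rewrite /k /k' -RintegralD//.
    + rewrite -[in RHS]Rintegral_cst//.
      by apply: eq_Rintegral => x _; ring.
    + exact: (bounded_integrable (QT_fin s) (mlow _ mu_u) (blow _ ab)).
    + exact: (bounded_integrable (QT_fin s) (mup _ mu_u) (bup _ ab)).
  transitivity (b - a - delta * (k + k')); first ring.
  by rewrite kk' /eps; ring.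
move=> s; apply/andP; split.
  rewrite -lerBrDl -(lowE _ s mPu (iab _ mu_u ab)).
  apply: (reached_mean s (mlow _ mPu) (blow _ (iab _ mu_u ab))) => // z Cz.
  rewrite -(lowE _ z mu_u ab).
  exact: minorized_mean (mlow _ mu_u) (blow _ ab).
rewrite lerBrDr addrC -lerBrDr -(upE _ s mPu (iab _ mu_u ab)).
apply: (reached_mean s (mup _ mPu) (bup _ (iab _ mu_u ab))) => // z Cz.
rewrite -(upE _ z mu_u ab).
exact: minorized_mean (mup _ mu_u) (bup _ ab).
Qed.

(** One interval serves all starting points, so it can be fed back into [two_step_contraction]; [e]
    absorbs the parity of the number of steps. *)
Lemma iter_kernel_contraction B t e : measurable B ->
  exists a b, [/\ 0 <= a, b - a = (1 - eps) ^+ t &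
    forall s, a <= fine (iter_kernel P (t.*2 + e) s B) <= b].
Proof.
move=> mB; elim: t => [|t [a [b [a0 ba ab]]]].
  exists 0, 1; split => //; first by rewrite subr0.
  move=> s; have le1 : (iter_kernel P (0.*2 + e) s B <= 1)%E.
    apply: (@le_trans _ _ (iter_kernel P (0.*2 + e) s setT)).
      by apply: le_measure; rewrite ?inE.
    exact: sprob_kernel_le1.
  rewrite fine_ge0//= -lee_fin fineK// ge0_fin_numE//.
  exact: le_lt_trans le1 (ltry _).
have mu_ k : measurable_fun setT (fun s => fine (iter_kernel P k s B)).
  by apply: measurableT_comp => //; exact: measurable_kernel.
have [a' [b' [a'0 b'a' ab']]] := two_step_contraction (mu_ _) a0 ab.
exists a', b'; split => //; first by rewrite b'a' ba exprS.
have iter_fin k s : (iter_kernel P k s B \is a fin_num).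
  rewrite ge0_fin_numE//; apply: (@le_lt_trans _ _ 1%E); last exact: ltry.
  apply: (@le_trans _ _ (iter_kernel P k s setT)).
    by apply: le_measure; rewrite ?inE.
  exact: sprob_kernel_le1.
have iterS k s : fine (iter_kernel P k.+1 s B) =
    kernel_mean (fun z => fine (iter_kernel P k z B)) s.
  congr fine; rewrite /= /kcomp_noparam; apply: eq_integral => z _.
  by rewrite fineK.
move=> s; have -> : (t.+1.*2 + e = (t.*2 + e).+2)%N by rewrite doubleS.
rewrite iterS; have -> : (fun z => fine (iter_kernel P (t.*2 + e).+1 z B)) =
    kernel_mean (fun z => fine (iter_kernel P (t.*2 + e) z B)).
  by apply/funext => z; rewrite iterS.
exact: ab'.
Qed.

(** By invariance [Pi B] is the [Pi]-average of the [t]-step probabilities of [B], hence lies in the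
    same short interval as each of them. *)
Lemma doeblin_geometrically_ergodic (Pi : probability T R) (E : set T) :
  (0 < Q setT)%E ->
  (forall u : T -> R, measurable_fun setT u -> (forall s, 0 <= u s <= 1) ->
     \int[Pi]_s kernel_mean u s = \int[Pi]_s u s) ->
  geometrically_ergodic E P Pi.
Proof.
move=> Q0 inv.
have [s0 _] : exists s : T, True.
  apply: contrapT => nT; have := probability_setT Pi.
  have -> : [set: T] = set0.
    by apply/seteqP; split => // z _; apply: nT; exists z.
  by rewrite measure0 => /eqP; rewrite eq_sym onee_eq0.
have q01 : 0 < fine (Q setT) <= 1.
  have Qf : Q setT \is a fin_num by rewrite ge0_fin_numE// QT_fin.
  by rewrite -!lte_fin -!lee_fin fineK// Q0 (QT_le1 s0).
have d1 : delta <= 1.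
  by rewrite -lee_fin (le_trans (PC s0))// -(PT s0) le_measure ?inE.
have e0 : 0 < eps by rewrite mulr_gt0//; case/andP: q01.
have e1 : eps <= 1.
  by case/andP: q01 => q0 q1; rewrite /eps mulr_ile1// ltW.
(* [eps / 2] instead of [eps] keeps the rate positive when [eps = 1]. The square root converts a
   rate per two steps into a rate per step, and the constant [rho^-1] pays for the unmatched step
   when [t] is odd. *)
pose r := 1 - eps / 2; pose rho := Num.sqrt r.
have r01 : 0 < r < 1 by rewrite /r; lra.
have rho01 : 0 < rho < 1.
  case/andP: r01 => r0 r1; rewrite sqrtr_gt0 r0/= -(@sqrtr1 R).
  by rewrite ltr_sqrt.
exists rho; split => //; exists (fun=> rho^-1); split => [s _|s t _ _].
  by rewrite invr_ge0; case/andP: rho01 => /ltW.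
apply: ge_ereal_sup => _ [B mB <-].
have iter_fin k z : (iter_kernel P k z B \is a fin_num).
  rewrite ge0_fin_numE//; apply: (@le_lt_trans _ _ 1%E); last exact: ltry.
  apply: (@le_trans _ _ (iter_kernel P k z setT)).
    by apply: le_measure; rewrite ?inE.
  exact: sprob_kernel_le1.
have mu_ k : measurable_fun setT (fun s => fine (iter_kernel P k s B)).
  by apply: measurableT_comp => //; exact: measurable_kernel.
have iter01 k z : 0 <= fine (iter_kernel P k z B) <= 1.
  have [a [b [a0 ba ab]]] := iter_kernel_contraction 0 k mB.
  have /andP[H1 _] := ab z; rewrite (le_trans a0 H1)/= -lee_fin fineK//.
  apply: (@le_trans _ _ (iter_kernel P k z setT)).
    by apply: le_measure; rewrite ?inE.
  exact: sprob_kernel_le1.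
(* Invariance is used once per step, on the [k]-step probability as a function of its starting
   point. *)
have PiE k : \int[Pi]_z fine (iter_kernel P k z B) = fine (Pi B).
  elim: k => [|k IH].
    rewrite /Rintegral; under eq_integral do rewrite fineK//.
    by rewrite /= integral_indic// setIT.
  rewrite -IH -[RHS]inv//; apply: eq_Rintegral => z _.
  congr fine; rewrite /= /kcomp_noparam; apply: eq_integral => w _.
  by rewrite fineK.
have [a [b [a0 ba ab]]] := iter_kernel_contraction t./2 (odd t) mB.
rewrite addnC odd_double_half in ab.
have := prob_Rintegral_bounds (probability_setT Pi) (mu_ t) ab.
rewrite PiE => PiB.
have Pif : Pi B \is a fin_num by exact: fin_num_measure.
rewrite -(fineK (iter_fin t s)) -(fineK Pif) -EFinB abse_EFin lee_fin.
apply: (@le_trans _ _ (b - a)).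
  by have := ab s; rewrite ler_norml; lra.
rewrite ba; apply: (@le_trans _ _ (r ^+ t./2)).
  by apply: lerXn2r; rewrite ?nnegrE /r; lra.
case/andP: r01 => /ltW r0 r1; case/andP: rho01 => rho0 /ltW rho1.
rewrite -{1}(sqr_sqrtr r0) -exprM mul2n -/rho.
rewrite -[in leRHS](odd_double_half t) exprD mulrA.
rewrite ler_peMl ?exprn_ge0 ?(ltW rho0)//.
case: (odd t); rewrite ?expr1 ?expr0 ?mulr1; last by rewrite invf_ge1.
by rewrite mulVf ?gt_eqF.
Qed.

End doeblin.

(** * Three-block Gibbs samplers *)

Section product_sigma_finite_measure.
Local Open Scope ereal_scope.
Context d1 d2 (X1 : measurableType d1) (X2 : measurableType d2) (R : realType).
Variables (m1 : {sigma_finite_measure set X1 -> \bar R})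
  (m2 : {sigma_finite_measure set X2 -> \bar R}).

Lemma product_sigma_finite : sigma_finite setT (m1 \x m2).
Proof.
by have [nu ->] := sigma_finite_product m1 m2; exact: sigma_finiteT.
Qed.

(* Given explicitly, because the sigma-finite structure inferred for a product
   is the one that requires both factors to be subprobabilities. *)
Definition product_sfm : {sigma_finite_measure set (X1 * X2)%type -> \bar R} :=
  HB.pack (product_measure1 m1 m2)
    (Measure_isSigmaFinite.Build _ _ _ (product_measure1 m1 m2) product_sigma_finite).

End product_sigma_finite_measure.

Section tonelli3.
Local Open Scope ereal_scope.
Context d1 d2 d3 (X1 : measurableType d1) (X2 : measurableType d2)
  (X3 : measurableType d3) (R : realType).
Variables (m1 : {sigma_finite_measure set X1 -> \bar R})
  (m2 : {sigma_finite_measure set X2 -> \bar R})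
  (m3 : {sigma_finite_measure set X3 -> \bar R}).
Variable F : X1 -> X2 -> X3 -> \bar R.
Hypothesis F0 : forall x y z, 0 <= F x y z.
Hypothesis mF : measurable_fun setT (fun t : X1 * X2 * X3 => F t.1.1 t.1.2 t.2).

Lemma measurable_fun3 d (Y : measurableType d) (g1 : Y -> X1) (g2 : Y -> X2)
    (g3 : Y -> X3) : measurable_fun setT g1 -> measurable_fun setT g2 ->
  measurable_fun setT g3 -> measurable_fun setT (fun y => F (g1 y) (g2 y) (g3 y)).
Proof.
move=> mg1 mg2 mg3.
have mg : measurable_fun setT (fun y => (g1 y, g2 y, g3 y)).
  by apply: measurable_fun_pair => //; exact: measurable_fun_pair.
exact: (measurableT_comp mF mg).
Qed.

Lemma measurable_integral3 :
  measurable_fun setT (fun t : X1 * X2 => \int[m3]_z F t.1 t.2 z).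
Proof.
exact: (measurable_fun_fubini_tonelli_F (m2 := m3)
  (fun t : X1 * X2 * X3 => F t.1.1 t.1.2 t.2)).
Qed.

Lemma integral_swap12 :
  \int[m1]_x \int[m2]_y \int[m3]_z F x y z =
  \int[m2]_y \int[m1]_x \int[m3]_z F x y z.
Proof.
apply: (fubini_tonelli (fun t : X1 * X2 => \int[m3]_z F t.1 t.2 z)).
  exact: measurable_integral3.
by move=> t; apply: integral_ge0.
Qed.

Lemma integral_swap23 :
  \int[m1]_x \int[m2]_y \int[m3]_z F x y z =
  \int[m1]_x \int[m3]_z \int[m2]_y F x y z.
Proof.
apply: eq_integral => x _.
apply: (fubini_tonelli (fun t : X2 * X3 => F x t.1 t.2)) => //.
by apply: measurable_fun3; [exact: measurable_cst|exact: measurable_fst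
  |exact: measurable_snd].
Qed.

End tonelli3.

Section tonelli_product3.
Local Open Scope ereal_scope.
Context d1 d2 d3 (X1 : measurableType d1) (X2 : measurableType d2)
  (X3 : measurableType d3) (R : realType).
Variables (m1 : {sigma_finite_measure set X1 -> \bar R})
  (m2 : {sigma_finite_measure set X2 -> \bar R})
  (m3 : {sigma_finite_measure set X3 -> \bar R}).

Lemma integral_product3 (F : X1 * X2 * X3 -> \bar R) : measurable_fun setT F ->
  (forall x, 0 <= F x) -> \int[m1 \x m2 \x m3]_x F x =
  \int[m1]_x \int[m2]_y \int[m3]_z F (x, y, z).
Proof.
move=> mF F0.
rewrite (fubini_tonelli1 (m1 := product_sfm m1 m2) F mF F0).
pose G := fubini_F m3 F.
have mG : measurable_fun setT G by exact: measurable_fun_fubini_tonelli_F.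
have G0 t : 0 <= G t by exact: integral_ge0.
exact: (fubini_tonelli1 G mG G0).
Qed.

End tonelli_product3.

Section normalize_density.
Local Open Scope ereal_scope.
Context d (T : measurableType d) (R : realType).
Variables (m : {measure set T -> \bar R}) (f : T -> R).
Hypothesis f0 : forall x, (0 <= f x)%R.

Lemma normalize_density_ge0 x : (0 <= normalize_density m f x)%R.
Proof.
by rewrite divr_ge0// fine_ge0// integral_ge0// => z _; rewrite lee_fin.
Qed.

(** A null integral makes the normalized density [0], division by [0] being [0]; the second
    hypothesis makes the right-hand side vanish as well. *)
Lemma normalize_densityK x : \int[m]_z (f z)%:E < +oo ->
  (\int[m]_z (f z)%:E = 0 -> f x = 0%R) ->
  \int[m]_z (f z)%:E * (normalize_density m f x)%:E = (f x)%:E.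
Proof.
move=> foo fz; rewrite /normalize_density.
have If : \int[m]_z (f z)%:E \is a fin_num.
  by rewrite ge0_fin_numE// integral_ge0// => z _; rewrite lee_fin.
rewrite -{1}(fineK If) -EFinM.
have [I0|I0] := eqVneq (fine (\int[m]_z (f z)%:E)) 0%R.
  by rewrite fz ?mul0r ?mulr0// -(fineK If) I0.
by rewrite mulrCA divff// mulr1.
Qed.

Lemma integral_normalize_density : measurable_fun setT f ->
  0 < \int[m]_z (f z)%:E -> \int[m]_z (f z)%:E < +oo ->
  \int[m]_x (normalize_density m f x)%:E = 1.
Proof.
move=> mf fp foo; rewrite /normalize_density.
have If : \int[m]_z (f z)%:E \is a fin_num.
  by rewrite ge0_fin_numE// ltW.
under eq_integral do rewrite mulrC EFinM.
rewrite ge0_integralZl_EFin//.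
- rewrite -[X in _ * X](fineK If) -EFinM mulVf// gt_eqF// -lte_fin fineK//.
- by move=> x _; rewrite lee_fin.
- exact/measurable_EFinP.
- by rewrite invr_ge0 fine_ge0// ltW.
Qed.

End normalize_density.
Section gibbs3.
Local Open Scope ereal_scope.
Context d1 d2 d3 d (X1 : measurableType d1) (X2 : measurableType d2)
  (X3 : measurableType d3) (T : measurableType d) (R : realType).
Variables (m1 : {sigma_finite_measure set X1 -> \bar R})
  (m2 : {sigma_finite_measure set X2 -> \bar R})
  (m3 : {sigma_finite_measure set X3 -> \bar R})
  (m : {sigma_finite_measure set T -> \bar R}).
(** The state space is given by projections and a constructor, so that a product of five components
    can be seen as three blocks without being rebuilt. *)
Variables (p1 : T -> X1) (p2 : T -> X2) (p3 : T -> X3)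
  (mk : X1 -> X2 -> X3 -> T).
Hypotheses (mp1 : measurable_fun setT p1) (mp2 : measurable_fun setT p2)
  (mp3 : measurable_fun setT p3).
Hypothesis mmk :
  measurable_fun setT (fun t : X1 * X2 * X3 => mk t.1.1 t.1.2 t.2).
Hypotheses (mk1 : forall x y z, p1 (mk x y z) = x)
  (mk2 : forall x y z, p2 (mk x y z) = y)
  (mk3 : forall x y z, p3 (mk x y z) = z).
Hypothesis integral_mk : forall F : T -> \bar R, measurable_fun setT F ->
  (forall t, 0 <= F t) ->
  \int[m]_t F t = \int[m1]_x \int[m2]_y \int[m3]_z F (mk x y z).

Lemma measurable_mk d' (Y : measurableType d') (g1 : Y -> X1) (g2 : Y -> X2)
    (g3 : Y -> X3) : measurable_fun setT g1 -> measurable_fun setT g2 ->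
  measurable_fun setT g3 ->
  measurable_fun setT (fun y => mk (g1 y) (g2 y) (g3 y)).
Proof.
move=> mg1 mg2 mg3.
have mg : measurable_fun setT (fun y => (g1 y, g2 y, g3 y)).
  by apply: measurable_fun_pair => //; exact: measurable_fun_pair.
exact: (measurableT_comp mmk mg).
Qed.

(** The order of the draws: the third block is drawn first and integrated outermost. Three exchanges
    of adjacent integrals reverse the order. *)
Lemma integral_mk_rev (F : T -> \bar R) : measurable_fun setT F ->
  (forall t, 0 <= F t) ->
  \int[m]_t F t = \int[m3]_z \int[m2]_y \int[m1]_x F (mk x y z).
Proof.
move=> mF F0; rewrite integral_mk//.
rewrite (integral_swap23 m1 m2 m3 (F := fun x y z => F (mk x y z)))//; last first.
  exact: measurableT_comp.
rewrite (integral_swap12 m1 m3 m2 (F := fun x z y => F (mk x y z)))//; last first.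
  apply: measurableT_comp => //; apply: measurable_mk.
  - exact: (measurableT_comp measurable_fst measurable_fst).
  - exact: measurable_snd.
  - exact: (measurableT_comp measurable_snd measurable_fst).
rewrite (integral_swap23 m3 m1 m2 (F := fun z x y => F (mk x y z)))//.
apply: measurableT_comp => //; apply: measurable_mk.
- exact: (measurableT_comp measurable_snd measurable_fst).
- exact: measurable_snd.
- exact: (measurableT_comp measurable_fst measurable_fst).
Qed.

Variable f : T -> R.
Hypotheses (mf : measurable_fun setT f) (f0 : forall t, (0 <= f t)%R).

Let N3 x y := \int[m3]_z (f (mk x y z))%:E.
Let N2 x z := \int[m2]_y (f (mk x y z))%:E.
Let N1 y z := \int[m1]_x (f (mk x y z))%:E.

(** The third block may leave the support of [f], and then [N2] and [N1] vanish; this is allowed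
    provided that [f] vanishes there too. *)
Hypotheses (N3_gt0 : forall x y, 0 < N3 x y) (N3_lty : forall x y, N3 x y < +oo).
Hypotheses (N2_lty : forall x z, N2 x z < +oo)
  (N2_eq0 : forall x y z, N2 x z = 0 -> f (mk x y z) = 0%R).
Hypotheses (N1_lty : forall y z, N1 y z < +oo)
  (N1_eq0 : forall x y z, N1 y z = 0 -> f (mk x y z) = 0%R).
Hypotheses (Z_gt0 : 0 < \int[m]_t (f t)%:E) (Z_lty : \int[m]_t (f t)%:E < +oo).

Let c3 x y z := normalize_density m3 (fun z => f (mk x y z)) z.
Let c2 x z y := normalize_density m2 (fun y => f (mk x y z)) y.
Let c1 y z x := normalize_density m1 (fun x => f (mk x y z)) x.

Let c3_ge0 x y z : (0 <= c3 x y z)%R. Proof. exact: normalize_density_ge0. Qed.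
Let c2_ge0 x y z : (0 <= c2 x y z)%R. Proof. exact: normalize_density_ge0. Qed.
Let c1_ge0 x y z : (0 <= c1 x y z)%R. Proof. exact: normalize_density_ge0. Qed.

Let mfE : measurable_fun setT (EFin \o f). Proof. exact/measurable_EFinP. Qed.

Let measurable_c3 d' (Y : measurableType d') (g1 : Y -> X1) (g2 : Y -> X2)
    (g3 : Y -> X3) : measurable_fun setT g1 -> measurable_fun setT g2 ->
  measurable_fun setT g3 ->
  measurable_fun setT (fun y => c3 (g1 y) (g2 y) (g3 y)).
Proof.
move=> mg1 mg2 mg3; apply: measurable_funM.
  by apply: measurableT_comp => //; exact: measurable_mk.
apply: measurable_fun_inv; apply: measurableT_comp => //.
have mN : measurable_fun setT (fun t : X1 * X2 => N3 t.1 t.2).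
  apply: (measurable_integral3 _ (F := fun x y z => (f (mk x y z))%:E)).
    by move=> *; rewrite lee_fin.
  exact: (measurableT_comp mfE mmk).
exact: (measurableT_comp mN (measurable_fun_pair mg1 mg2)).
Qed.

Let measurable_c2 d' (Y : measurableType d') (g1 : Y -> X1) (g2 : Y -> X2)
    (g3 : Y -> X3) : measurable_fun setT g1 -> measurable_fun setT g2 ->
  measurable_fun setT g3 ->
  measurable_fun setT (fun y => c2 (g1 y) (g3 y) (g2 y)).
Proof.
move=> mg1 mg2 mg3; apply: measurable_funM.
  by apply: measurableT_comp => //; exact: measurable_mk.
apply: measurable_fun_inv; apply: measurableT_comp => //.
have mN : measurable_fun setT (fun t : X1 * X3 => N2 t.1 t.2).
  apply: (measurable_integral3 _ (F := fun x z y => (f (mk x y z))%:E)).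
    by move=> *; rewrite lee_fin.
  apply: (measurableT_comp mfE); apply: measurable_mk.
  - exact: (measurableT_comp measurable_fst measurable_fst).
  - exact: measurable_snd.
  - exact: (measurableT_comp measurable_snd measurable_fst).
exact: (measurableT_comp mN (measurable_fun_pair mg1 mg3)).
Qed.

Let measurable_c1 d' (Y : measurableType d') (g1 : Y -> X1) (g2 : Y -> X2)
    (g3 : Y -> X3) : measurable_fun setT g1 -> measurable_fun setT g2 ->
  measurable_fun setT g3 ->
  measurable_fun setT (fun y => c1 (g2 y) (g3 y) (g1 y)).
Proof.
move=> mg1 mg2 mg3; apply: measurable_funM.
  by apply: measurableT_comp => //; exact: measurable_mk.
apply: measurable_fun_inv; apply: measurableT_comp => //.
have mN : measurable_fun setT (fun t : X2 * X3 => N1 t.1 t.2).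
  apply: (measurable_integral3 _ (F := fun y z x => (f (mk x y z))%:E)).
    by move=> *; rewrite lee_fin.
  apply: (measurableT_comp mfE); apply: measurable_mk.
  - exact: measurable_snd.
  - exact: (measurableT_comp measurable_fst measurable_fst).
  - exact: (measurableT_comp measurable_snd measurable_fst).
exact: (measurableT_comp mN (measurable_fun_pair mg2 mg3)).
Qed.

Definition gibbs3_density (t : T * T) : R :=
  (c3 (p1 t.1) (p2 t.1) (p3 t.2) *
   (c2 (p1 t.1) (p3 t.2) (p2 t.2) * c1 (p2 t.2) (p3 t.2) (p1 t.2)))%R.

Lemma gibbs3_density_ge0 t : (0 <= gibbs3_density t)%R.
Proof. by apply: mulr_ge0 => //; exact: mulr_ge0. Qed.

Lemma measurable_gibbs3_density : measurable_fun setT gibbs3_density.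
Proof.
have mfst d' (Y : measurableType d') (g : T -> Y) : measurable_fun setT g ->
  measurable_fun setT (fun t : T * T => g t.1).
  by move=> mg; exact: (measurableT_comp mg measurable_fst).
have msnd d' (Y : measurableType d') (g : T -> Y) : measurable_fun setT g ->
  measurable_fun setT (fun t : T * T => g t.2).
  by move=> mg; exact: (measurableT_comp mg measurable_snd).
apply: measurable_funM.
  by apply: measurable_c3; [exact: mfst|exact: mfst|exact: msnd].
apply: measurable_funM.
  by apply: measurable_c2; [exact: mfst|exact: msnd|exact: msnd].
by apply: measurable_c1; exact: msnd.
Qed.

(** Averages of a test function over the last draw and over the last two draws of a step. *)
Let H1 (G : T -> \bar R) y z := \int[m1]_x ((c1 y z x)%:E * G (mk x y z)).
Let H2 (G : T -> \bar R) x z := \int[m2]_y ((c2 x z y)%:E * H1 G y z).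

Section operator.
Variable G : T -> \bar R.
Hypotheses (mG : measurable_fun setT G) (G0 : forall t, 0 <= G t).

Let H1_ge0 y z : 0 <= H1 G y z.
Proof. by apply: integral_ge0 => x _; rewrite mule_ge0 ?lee_fin. Qed.

Let H2_ge0 x z : 0 <= H2 G x z.
Proof. by apply: integral_ge0 => y _; rewrite mule_ge0 ?lee_fin. Qed.

Let measurable_H1 : measurable_fun setT (fun t : X2 * X3 => H1 G t.1 t.2).
Proof.
apply: (measurable_integral3 _ (F := fun y z x => ((c1 y z x)%:E * G (mk x y z)))).
  by move=> *; rewrite mule_ge0 ?lee_fin.
have h1 : measurable_fun setT (fun t : X2 * X3 * X1 => t.1.1).
  exact: (measurableT_comp measurable_fst measurable_fst).
have h2 : measurable_fun setT (fun t : X2 * X3 * X1 => t.1.2).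
  exact: (measurableT_comp measurable_snd measurable_fst).
apply: emeasurable_funM.
  by apply/measurable_EFinP; apply: measurable_c1.
by apply: measurableT_comp => //; exact: measurable_mk.
Qed.

Let measurable_H2 : measurable_fun setT (fun t : X1 * X3 => H2 G t.1 t.2).
Proof.
apply: (measurable_integral3 _ (F := fun x z y => ((c2 x z y)%:E * H1 G y z))).
  by move=> *; rewrite mule_ge0 ?lee_fin.
have h1 : measurable_fun setT (fun t : X1 * X3 * X2 => t.1.1).
  exact: (measurableT_comp measurable_fst measurable_fst).
have h2 : measurable_fun setT (fun t : X1 * X3 * X2 => t.1.2).
  exact: (measurableT_comp measurable_snd measurable_fst).
apply: emeasurable_funM.
  by apply/measurable_EFinP; apply: measurable_c2.
exact: (measurableT_comp measurable_H1 (measurable_fun_pair measurable_snd h2)).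
Qed.

Lemma integral_gibbs3_density t :
  \int[m]_t' ((gibbs3_density (t, t'))%:E * G t') =
  \int[m3]_z ((c3 (p1 t) (p2 t) z)%:E *
    \int[m2]_y ((c2 (p1 t) z y)%:E *
      \int[m1]_x ((c1 y z x)%:E * G (mk x y z)))).
Proof.
rewrite integral_mk_rev; last 2 first.
- apply: emeasurable_funM => //; apply/measurable_EFinP.
  exact: (measurableT_comp measurable_gibbs3_density (measurable_pair1 t)).
- by move=> t'; rewrite mule_ge0// lee_fin gibbs3_density_ge0.
apply: eq_integral => z _.
rewrite -ge0_integralZl_EFin//; last 2 first.
- by move=> y _; rewrite mule_ge0 ?lee_fin//; exact: H1_ge0.
- apply: emeasurable_funM.
    by apply/measurable_EFinP; apply: measurable_c2 => //; exact: measurable_cst.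
  exact: (measurableT_comp measurable_H1 (measurable_pair2 z)).
apply: eq_integral => y _.
rewrite /H1 -ge0_integralZl_EFin//; last 2 first.
- by move=> x _; rewrite mule_ge0 ?lee_fin.
- apply: emeasurable_funM.
    by apply/measurable_EFinP; apply: measurable_c1 => //; exact: measurable_cst.
  by apply: measurableT_comp => //; apply: measurable_mk => //; exact: measurable_cst.
rewrite -ge0_integralZl_EFin//; last 2 first.
- by move=> x _; rewrite !mule_ge0 ?lee_fin.
- apply: emeasurable_funM => //; apply: emeasurable_funM.
    by apply/measurable_EFinP; apply: measurable_c1 => //; exact: measurable_cst.
  by apply: measurableT_comp => //; apply: measurable_mk => //; exact: measurable_cst.
apply: eq_integral => x _.
by rewrite /gibbs3_density/= !mk1 !mk2 !mk3 !EFinM !muleA.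
Qed.

(** Each draw preserves [f]: the marginal left after integrating out a block, times the conditional
    density of that block, is [f] again by [normalize_densityK]. The draws are removed one at a
    time, Tonelli bringing the block concerned innermost. *)
Lemma gibbs3_density_invariant :
  \int[m]_t ((f t)%:E * \int[m]_t' ((gibbs3_density (t, t'))%:E * G t')) =
  \int[m]_t ((f t)%:E * G t).
Proof.
have mp12 : measurable_fun setT (fun t => (p1 t, p2 t)).
  exact: measurable_fun_pair.
pose K x y := \int[m3]_z ((c3 x y z)%:E * H2 G x z).
have K_ge0 x y : 0 <= K x y.
  by apply: integral_ge0 => z _; rewrite mule_ge0 ?lee_fin.
have mK : measurable_fun setT (fun t : X1 * X2 => K t.1 t.2).
  apply: (measurable_integral3 _ (F := fun x y z => ((c3 x y z)%:E * H2 G x z))).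
    by move=> *; rewrite mule_ge0 ?lee_fin.
  have h1 : measurable_fun setT (fun t : X1 * X2 * X3 => t.1.1).
    exact: (measurableT_comp measurable_fst measurable_fst).
  have h2 : measurable_fun setT (fun t : X1 * X2 * X3 => t.1.2).
    exact: (measurableT_comp measurable_snd measurable_fst).
  apply: emeasurable_funM.
    by apply/measurable_EFinP; apply: measurable_c3.
  exact: (measurableT_comp measurable_H2 (measurable_fun_pair h1 measurable_snd)).
have mcst1 x y : measurable_fun setT (fun z => f (mk x y z)).
  by apply: measurableT_comp => //; apply: measurable_mk => //; exact: measurable_cst.
have mcst2 x z : measurable_fun setT (fun y => f (mk x y z)).
  by apply: measurableT_comp => //; apply: measurable_mk => //; exact: measurable_cst.
have mcst3 y z : measurable_fun setT (fun x => f (mk x y z)).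
  by apply: measurableT_comp => //; apply: measurable_mk => //; exact: measurable_cst.
under eq_integral do rewrite integral_gibbs3_density.
rewrite (integral_mk (F := fun t => (f t)%:E * K (p1 t) (p2 t))); last 2 first.
- apply: emeasurable_funM => //.
  exact: (measurableT_comp mK mp12).
- by move=> t; rewrite mule_ge0 ?lee_fin//; exact: K_ge0.
(* Draw of the third block: integrating [f] over the old [z] gives [N3], and [N3 * c3] is [f] at the
   new [z]. *)
transitivity (\int[m1]_x \int[m2]_y \int[m3]_z
    ((f (mk x y z))%:E * H2 G x z)).
  apply: eq_integral => x _; apply: eq_integral => y _.
  under eq_integral do rewrite mk1 mk2.
  rewrite ge0_integralZr//; last 2 first.
  - exact/measurable_EFinP.
  - by move=> z _; rewrite lee_fin.
  have N3f : N3 x y \is a fin_num by rewrite ge0_fin_numE// ltW.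
  rewrite -/(N3 x y) -(fineK N3f).
  rewrite -ge0_integralZl_EFin//; last 3 first.
  - by move=> z _; rewrite mule_ge0 ?lee_fin//; exact: H2_ge0.
  - apply: emeasurable_funM.
      by apply/measurable_EFinP; apply: measurable_c3 => //; exact: measurable_cst.
    exact: (measurableT_comp measurable_H2 (measurable_pair1 x)).
  - by rewrite fine_ge0// ltW.
  apply: eq_integral => z _.
  rewrite (fineK N3f) muleA normalize_densityK//; first exact: N3_lty.
  by move=> N0; have := N3_gt0 x y; rewrite /N3 N0 ltxx.
rewrite (integral_swap23 m1 m2 m3 (F := fun x y z => (f (mk x y z))%:E * H2 G x z)); last 2 first.
- by move=> *; rewrite mule_ge0 ?lee_fin.
- apply: emeasurable_funM; first exact: (measurableT_comp mfE mmk).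
  have h1 : measurable_fun setT (fun t : X1 * X2 * X3 => t.1.1).
    exact: (measurableT_comp measurable_fst measurable_fst).
  exact: (measurableT_comp measurable_H2 (measurable_fun_pair h1 measurable_snd)).
(* Draw of the second block, in the same way with [N2] and [c2]. *)
transitivity (\int[m1]_x \int[m3]_z \int[m2]_y
    ((f (mk x y z))%:E * H1 G y z)).
  apply: eq_integral => x _; apply: eq_integral => z _.
  have N2_ge0 : 0 <= N2 x z.
    by apply: integral_ge0 => y _; rewrite lee_fin.
  rewrite ge0_integralZr//; last 2 first.
  - exact/measurable_EFinP.
  - by move=> y _; rewrite lee_fin.
  have N2f : N2 x z \is a fin_num by rewrite ge0_fin_numE.
  rewrite -/(N2 x z) -(fineK N2f).
  rewrite -ge0_integralZl_EFin//; last 3 first.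
  - by move=> y _; rewrite mule_ge0 ?lee_fin//; exact: H1_ge0.
  - apply: emeasurable_funM.
      by apply/measurable_EFinP; apply: measurable_c2 => //; exact: measurable_cst.
    exact: (measurableT_comp measurable_H1 (measurable_pair2 z)).
  - by rewrite fine_ge0.
  apply: eq_integral => y _.
  rewrite (fineK N2f) muleA normalize_densityK//; first exact: N2_lty.
  exact: N2_eq0.
rewrite -(integral_swap23 m1 m2 m3 (F := fun x y z => (f (mk x y z))%:E * H1 G y z)); last 2 first.
- by move=> *; rewrite mule_ge0 ?lee_fin.
- apply: emeasurable_funM; first exact: (measurableT_comp mfE mmk).
  have h2 : measurable_fun setT (fun t : X1 * X2 * X3 => t.1.2).
    exact: (measurableT_comp measurable_snd measurable_fst).
  exact: (measurableT_comp measurable_H1 (measurable_fun_pair h2 measurable_snd)).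
(* A detour through [m], from which the integrals can be unfolded with the first block innermost;
   [N1] and [c1] then account for its draw. *)
transitivity (\int[m]_t ((f t)%:E * H1 G (p2 t) (p3 t))).
  rewrite integral_mk.
  - apply: eq_integral => x _; apply: eq_integral => y _.
    by apply: eq_integral => z _; rewrite mk2 mk3.
  - apply: emeasurable_funM => //.
    exact: (measurableT_comp measurable_H1 (measurable_fun_pair mp2 mp3)).
  - by move=> t; rewrite mule_ge0 ?lee_fin.
rewrite !integral_mk_rev; last 4 first.
- by apply: emeasurable_funM.
- by move=> t; rewrite mule_ge0 ?lee_fin.
- apply: emeasurable_funM => //.
  exact: (measurableT_comp measurable_H1 (measurable_fun_pair mp2 mp3)).
- by move=> t; rewrite mule_ge0 ?lee_fin.
apply: eq_integral => z _; apply: eq_integral => y _.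
under eq_integral do rewrite mk2 mk3.
have N1_ge0 : 0 <= N1 y z.
  by apply: integral_ge0 => x _; rewrite lee_fin.
rewrite ge0_integralZr//; last 2 first.
- exact/measurable_EFinP.
- by move=> x _; rewrite lee_fin.
have N1f : N1 y z \is a fin_num by rewrite ge0_fin_numE.
rewrite -/(N1 y z) -(fineK N1f).
rewrite -ge0_integralZl_EFin//; last 3 first.
- by move=> x _; rewrite mule_ge0 ?lee_fin.
- apply: emeasurable_funM.
    by apply/measurable_EFinP; apply: measurable_c1 => //; exact: measurable_cst.
  by apply: measurableT_comp => //; apply: measurable_mk => //; exact: measurable_cst.
- by rewrite fine_ge0.
apply: eq_integral => x _.
rewrite (fineK N1f) muleA normalize_densityK//; first exact: N1_lty.
exact: N1_eq0.
Qed.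

End operator.

(** The conditionals integrate to [1] from the inside out, except where an inner normalizing
    constant vanishes; there the outer density vanishes too. *)
Lemma integral_gibbs3_density1 t : \int[m]_t' (gibbs3_density (t, t'))%:E = 1.
Proof.
pose G (_ : T) : \bar R := 1%E.
have mG : measurable_fun setT G by exact: measurable_cst.
have G0 t' : 0 <= G t' by rewrite lee_fin.
have := integral_gibbs3_density mG G0 t; rewrite /G.
under eq_integral do rewrite mule1; move=> ->.
have mcst1 x y : measurable_fun setT (fun z => f (mk x y z)).
  by apply: measurableT_comp => //; apply: measurable_mk => //; exact: measurable_cst.
have mcst2 x z : measurable_fun setT (fun y => f (mk x y z)).
  by apply: measurableT_comp => //; apply: measurable_mk => //; exact: measurable_cst.
have mcst3 y z : measurable_fun setT (fun x => f (mk x y z)).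
  by apply: measurableT_comp => //; apply: measurable_mk => //; exact: measurable_cst.
(* Lets an inner integral be replaced by [1] only where the outer density is nonzero. *)
have f_c (r r' : R) (A : \bar R) : (r != 0%R -> A = 1) -> (r / r')%:E * A = (r / r')%:E.
  by have [->|r0 ->//] := eqVneq r 0%R; rewrite ?mul0r ?mul0e ?mule1.
transitivity (\int[m3]_z (c3 (p1 t) (p2 t) z)%:E); last first.
  apply: integral_normalize_density => //; [exact: N3_gt0|exact: N3_lty].
apply: eq_integral => z _; apply: (f_c _ _ _) => fn0.
transitivity (\int[m2]_y (c2 (p1 t) z y)%:E); last first.
  apply: integral_normalize_density => //; last exact: N2_lty.
  rewrite lt_neqAle integral_ge0 ?andbT//; last by move=> y _; rewrite lee_fin.
  by apply/eqP => N20; move: fn0; rewrite (N2_eq0 _ (esym N20)) eqxx.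
apply: eq_integral => y _; apply: (f_c _ _ _) => fn0'.
under eq_integral do rewrite mule1.
apply: integral_normalize_density => //; last exact: N1_lty.
rewrite lt_neqAle integral_ge0 ?andbT//; last by move=> x _; rewrite lee_fin.
by apply/eqP => N10; move: fn0'; rewrite (N1_eq0 _ (esym N10)) eqxx.
Qed.

Lemma gibbs3_sampler : exists (Pi : probability T R) (P : R.-pker T ~> T),
  [/\ forall B, measurable B ->
        Pi B = \int[m]_(t in B) (normalize_density m f t)%:E,
      forall t B, measurable B ->
        P t B = \int[m3]_z ((c3 (p1 t) (p2 t) z)%:E *
          \int[m2]_y ((c2 (p1 t) z y)%:E *
            \int[m1]_x ((c1 y z x)%:E * (\1_B (mk x y z))%:E))),
      forall t B, P t B = \int[m]_(t' in B) (gibbs3_density (t, t'))%:E &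
      forall u : T -> R, measurable_fun setT u ->
        (forall s, (0 <= u s <= 1)%R) ->
        (\int[Pi]_s kernel_mean P u s = \int[Pi]_s u s)%R].
Proof.
have mnf : measurable_fun setT (normalize_density m f).
  by apply: measurable_funM => //; exact: measurable_cst.
have nf0 t : (0 <= normalize_density m f t)%R by exact: normalize_density_ge0.
have [Pi PiE] : exists Pi : probability T R,
    forall B, Pi B = \int[m]_(t in B) (normalize_density m f t)%:E.
  by apply: density_probability => //; exact: integral_normalize_density.
have [P PE] := density_pkernel measurable_gibbs3_density gibbs3_density_ge0
  integral_gibbs3_density1.
have mk_ t : measurable_fun setT (fun t' => gibbs3_density (t, t')).
  exact: (measurableT_comp measurable_gibbs3_density (measurable_pair1 t)).
have Pint (G : T -> \bar R) t : measurable_fun setT G -> (forall t, 0 <= G t) ->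
    \int[P t]_t' G t' = \int[m]_t' ((gibbs3_density (t, t'))%:E * G t').
  move=> mG G0; apply: integral_density => // t'.
  exact: gibbs3_density_ge0.
exists Pi, P; split => // [t B mB|u mu u01].
  rewrite -(integral_gibbs3_density (G := fun t' => (\1_B t')%:E)); last 2 first.
  - exact/measurable_EFinP/measurable_indic.
  - by move=> t'; rewrite lee_fin.
  rewrite PE integral_mkcond; apply: eq_integral => t' _.
  by rewrite /patch indicE; case: ifPn => _; rewrite ?mule1 ?mule0.
have muE : measurable_fun setT (EFin \o u) by exact/measurable_EFinP.
have u0 t : 0 <= (u t)%:E by rewrite lee_fin; case/andP: (u01 t).
have int_fin t : \int[P t]_z (u z)%:E \is a fin_num.
  apply: integrable_fin_num => //; apply: prob_integrable mu u01.
  exact: prob_kernel.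
rewrite /kernel_mean /Rintegral; congr fine.
under eq_integral => t _.
  rewrite fineK// Pint//.
  over.
have mKu : measurable_fun setT (fun t => \int[P t]_z (u z)%:E).
  apply: (measurable_fun_integral_kernel (l := P)) => //.
  by move=> U mU; exact: measurable_kernel.
rewrite (integral_density (m := m) (nu := Pi) mnf nf0 (fun A _ => PiE A))//; last 2 first.
- by under eq_fun do rewrite -Pint//.
- by move=> t; rewrite -Pint//; exact: integral_ge0.
rewrite (integral_density (m := m) (nu := Pi) mnf nf0 (fun A _ => PiE A))//.
(* The normalizing constant factors out, reducing invariance of [Pi] to that of the unnormalized
   [f]. *)
have scale (G : T -> \bar R) : measurable_fun setT G -> (forall t, 0 <= G t) ->
    \int[m]_t ((normalize_density m f t)%:E * G t) =
    ((fine (\int[m]_t (f t)%:E))^-1)%:E * \int[m]_t ((f t)%:E * G t).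
  move=> mG G0; rewrite -ge0_integralZl_EFin//.
  - by apply: eq_integral => t _; rewrite /normalize_density mulrC EFinM muleA.
  - by move=> t _; rewrite mule_ge0 ?lee_fin.
  - exact: emeasurable_funM.
  - by rewrite invr_ge0 fine_ge0// ltW.
rewrite !scale//.
- congr (_ * _); exact: (gibbs3_density_invariant muE u0).
- by under eq_fun do rewrite -Pint//.
- by move=> t; rewrite -Pint//; exact: integral_ge0.
Qed.

End gibbs3.

(** * Positive definite matrices *)

Section squared_norm.
Context {R : realType}.

(** The squared Frobenius norm: polynomial in the entries, additive over blocks and
    submultiplicative. *)
Definition sqnorm m n (A : 'M[R]_(m, n)) : R := \sum_i \sum_j A i j ^+ 2.

Lemma sqnorm_ge0 m n (A : 'M[R]_(m, n)) : 0 <= sqnorm A.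
Proof. by apply: sumr_ge0 => i _; apply: sumr_ge0 => j _; exact: sqr_ge0. Qed.

Lemma sqnormZ m n k (A : 'M[R]_(m, n)) : sqnorm (k *: A) = k ^+ 2 * sqnorm A.
Proof.
rewrite mulr_sumr; apply: eq_bigr => i _; rewrite mulr_sumr.
by apply: eq_bigr => j _; rewrite mxE exprMn.
Qed.

Lemma sqnorm_tr m n (A : 'M[R]_(m, n)) : sqnorm A^T = sqnorm A.
Proof.
rewrite /sqnorm exchange_big; apply: eq_bigr => i _; apply: eq_bigr => j _.
by rewrite mxE.
Qed.

Lemma sqnorm_col_mx m1 m2 n (A : 'M[R]_(m1, n)) (B : 'M[R]_(m2, n)) :
  sqnorm (col_mx A B) = sqnorm A + sqnorm B.
Proof.
rewrite /sqnorm big_split_ord; congr (_ + _); apply: eq_bigr => i _;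
  by apply: eq_bigr => j _; rewrite ?col_mxEu ?col_mxEd.
Qed.

Lemma sqnorm_rows m n (A : 'M[R]_(m, n)) :
  sqnorm A = \sum_i sqnorm (row i A)^T.
Proof.
apply: eq_bigr => i _; rewrite sqnorm_tr /sqnorm big_ord1.
by apply: eq_bigr => j _; rewrite mxE.
Qed.

Lemma sqnorm_vec_mx m n (v : 'rV[R]_(m * n)) : sqnorm (vec_mx v) = sqnorm v.
Proof.
rewrite /sqnorm big_ord1 (reindex _ (curry_mxvec_bij _ _)) /=.
rewrite pair_big; apply: eq_bigr => -[i j] _.
by rewrite mxE.
Qed.

Lemma mxtrace_gram m n (L : 'M[R]_(m, n)) : \tr (L^T *m L) = sqnorm L.
Proof.
rewrite /mxtrace /sqnorm exchange_big; apply: eq_bigr => j _.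
by rewrite mxE; apply: eq_bigr => i _; rewrite mxE expr2.
Qed.

Lemma qform_gram m n (L : 'M[R]_(m, n)) (x : 'cV[R]_n) :
  qform (L^T *m L) x = sqnorm (L *m x).
Proof.
by rewrite /qform mulmxA -mulmxA -trmx_mul -mxtrace_gram /mxtrace big_ord1.
Qed.

(** Lagrange's identity: the double sum of squares is twice the difference of the two sides. *)
Lemma Cauchy_Schwarz_sum (I : finType) (a b : I -> R) :
  (\sum_i a i * b i) ^+ 2 <= (\sum_i a i ^+ 2) * (\sum_i b i ^+ 2).
Proof.
have : 0 <= \sum_i \sum_j (a i * b j - a j * b i) ^+ 2.
  by apply: sumr_ge0 => i _; apply: sumr_ge0 => j _; exact: sqr_ge0.
have -> : \sum_i \sum_j (a i * b j - a j * b i) ^+ 2 =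
    2 * ((\sum_i a i ^+ 2) * (\sum_i b i ^+ 2) - (\sum_i a i * b i) ^+ 2).
  transitivity (\sum_i \sum_j (a i ^+ 2 * b j ^+ 2) +
      \sum_i \sum_j (b i ^+ 2 * a j ^+ 2) -
      2 * \sum_i \sum_j (a i * b i) * (a j * b j)).
    rewrite -big_split/= mulr_sumr -sumrB; apply: eq_bigr => i _.
    rewrite -big_split/= mulr_sumr -sumrB; apply: eq_bigr => j _; ring.
  rewrite -!big_distrlr/= expr2; ring.
by rewrite pmulr_rge0// subr_ge0.
Qed.

Lemma sqnorm_mulmx m n p (A : 'M[R]_(m, n)) (B : 'M[R]_(n, p)) :
  sqnorm (A *m B) <= sqnorm A * sqnorm B.
Proof.
rewrite -(sqnorm_tr B) [sqnorm B^T]/sqnorm /sqnorm big_distrlr/=.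
apply: ler_sum => i _; apply: ler_sum => j _.
rewrite mxE; apply: le_trans (Cauchy_Schwarz_sum _ _) _.
rewrite ler_pM ?sumr_ge0// => *; rewrite ?sqr_ge0//.
by apply: ler_sum => k _; rewrite mxE.
Qed.

Lemma sqnormD m n (A B : 'M[R]_(m, n)) :
  sqnorm (A + B) <= 2 * sqnorm A + 2 * sqnorm B.
Proof.
rewrite !mulr_sumr -big_split/=; apply: ler_sum => i _.
rewrite !mulr_sumr -big_split/=; apply: ler_sum => j _; rewrite mxE.
have := sqr_ge0 (A i j - B i j); lra.
Qed.

Lemma sqnormN m n (A : 'M[R]_(m, n)) : sqnorm (- A) = sqnorm A.
Proof. by rewrite -scaleN1r sqnormZ sqrrN expr1n mul1r. Qed.

Lemma sqnormB m n (A B : 'M[R]_(m, n)) :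
  sqnorm (A - B) <= 2 * sqnorm A + 2 * sqnorm B.
Proof. by rewrite -(sqnormN B); exact: sqnormD. Qed.

Lemma trmx_scale m n k (A : 'M[R]_(m, n)) : (k *: A)^T = k *: A^T.
Proof. by apply/matrixP => i j; rewrite !mxE. Qed.

Lemma qform0 d (C : 'M[R]_d) : qform C 0 = 0.
Proof. by rewrite /qform mulmx0 mxE. Qed.

Lemma qformZ d (C : 'M[R]_d) k x : qform C (k *: x) = k ^+ 2 * qform C x.
Proof.
by rewrite /qform trmx_scale -!scalemxAl -scalemxAr scalerA mxE expr2.
Qed.

Lemma qform_scale d (C : 'M[R]_d) k x : qform (k *: C) x = k * qform C x.
Proof. by rewrite /qform -scalemxAr -scalemxAl mxE. Qed.

Lemma qformN d (C : 'M[R]_d) x : qform C (- x) = qform C x.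
Proof. by rewrite -scaleN1r qformZ sqrrN expr1n mul1r. Qed.

End squared_norm.

Section schur.
Context {R : realType}.

Lemma const_mx1 (a : R) : const_mx a = a%:M :> 'M[R]_1.
Proof. by apply/matrixP => i j; rewrite !ord1 !mxE eqxx mulr1n. Qed.

Section block.
Context (n : nat).
Variables (c : R) (u : 'rV[R]_n) (D : 'M[R]_n).

Definition schur_complement : 'M[R]_n := D - c^-1 *: (u^T *m u).

Let C : 'M[R]_(1 + n) := block_mx c%:M u u^T D.

(** Completing the square in the first coordinate. *)
Lemma qform_block (x : 'cV[R]_1) (y : 'cV[R]_n) : c != 0 ->
  qform C (col_mx x y) =
    c * (x 0 0 + c^-1 * (u *m y) 0 0) ^+ 2 + qform schur_complement y.
Proof.
move=> c0.
rewrite /qform tr_col_mx mul_row_block mul_row_col.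
rewrite /schur_complement mulmxBr mulmxBl -scalemxAr -scalemxAl.
have E1 : (u *m y) = ((u *m y) 0 0)%:M by exact: mx11_scalar.
have E2 : x = (x 0 0)%:M by exact: mx11_scalar.
rewrite !mulmxDl -!mulmxA [x^T *m (u *m y)]mulmxA.
have -> : y^T *m (u^T *m x) = ((u *m y)^T *m x) by rewrite trmx_mul mulmxA.
have -> : y^T *m (u^T *m (u *m y)) = (u *m y)^T *m (u *m y).
  by rewrite trmx_mul !mulmxA.
rewrite -[x^T *m u *m y]mulmxA E1.
set s := (u *m y) 0 0; rewrite E2; set r := x 0 0.
rewrite !tr_scalar_mx -!scalar_mxM.
move: (y^T *m _) => Q; rewrite !mxE eqxx !mulr1n; by field.
Qed.

Lemma spd_block : spd C <-> 0 < c /\ spd schur_complement.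
Proof.
split=> [[Csym Cpos]|[c_gt0 [Ssym Spos]]].
  have c_gt0 : 0 < c.
    have := Cpos (col_mx (const_mx 1) 0).
    rewrite /qform tr_col_mx mul_row_block mul_row_col.
    rewrite trmx0 !mul0mx !mulmx0 !addr0 trmx_const const_mx1 mul1mx mulmx1.
    rewrite mxE eqxx mulr1n; apply; apply/eqP => /matrixP/(_ (lshift n 0) 0).
    by rewrite col_mxEu !mxE => /eqP; rewrite oner_eq0.
  split => //; split.
    move: Csym; rewrite /C tr_block_mx => /(congr1 drsubmx).
    rewrite !block_mxKdr /schur_complement => Dsym.
    by rewrite linearB/= trmx_scale trmx_mul trmxK Dsym.
  (* The first coordinate that annihilates the square and leaves the form of the Schur
     complement. *)
  move=> y y0; pose x : 'cV[R]_1 := (- (c^-1 * (u *m y) 0 0))%:M.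
  have x00 : x 0 0 = - (c^-1 * (u *m y) 0 0) by rewrite mxE eqxx mulr1n.
  have := Cpos (col_mx x y); rewrite qform_block ?gt_eqF// x00.
  rewrite addNr expr0n mulr0 add0r; apply.
  apply: contra_neq y0 => /(congr1 dsubmx); rewrite col_mxKd => ->.
  by apply/matrixP => i j; rewrite !mxE.
split.
  rewrite /C tr_block_mx tr_scalar_mx trmxK; congr block_mx.
  move: Ssym; rewrite /schur_complement linearB/= trmx_scale trmx_mul trmxK.
  by move/addIr.
move=> z z0; rewrite -[z]vsubmxK qform_block ?gt_eqF//.
set x := usubmx z; set y := dsubmx z.
have [y0|y0] := eqVneq y 0; last first.
  by apply: ltr_wpDl; [rewrite mulr_ge0 ?sqr_ge0// ltW|exact: Spos].
have u0 : (u *m (0 : 'cV[R]_n)) 0 0 = 0 by rewrite mulmx0 mxE.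
rewrite y0 qform0 u0 mulr0 !addr0 mulr_gt0// exprn_even_gt0//=.
apply: contra_neq z0 => x0; rewrite -[z]vsubmxK -/x -/y y0.
have -> : x = 0 by apply/matrixP => i j; rewrite !ord1 x0 mxE.
exact: col_mx0.
Qed.

Let P : 'M[R]_(1 + n) := block_mx 1%:M (c^-1 *: u) 0 1%:M.

Lemma block_congruence : c != 0 ->
  C = P^T *m block_mx c%:M 0 0 schur_complement *m P.
Proof.
move=> c0; rewrite /P tr_block_mx !trmx1 trmx0 trmx_scale !mulmx_block.
rewrite !mul1mx !mul0mx !mulmx0 !mulmx1 !addr0 !add0r mul_scalar_mx.
rewrite mul_mx_scalar !scalerA divff// !scale1r /schur_complement.
by rewrite -scalemxAr addrC subrK.
Qed.

Lemma det_block_congruence : \det P = 1.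
Proof. by rewrite /P det_ublock !det1 mulr1. Qed.

Lemma det_block : c != 0 -> \det C = c * \det schur_complement.
Proof.
move=> c0; rewrite block_congruence// !det_mulmx det_tr det_block_congruence.
by rewrite mul1r mulr1 det_ublock det_scalar1.
Qed.

(** Inverts the factors of [block_congruence]. The last term, quadratic in [u], is what makes the
    off-diagonal row Gaussian in the inverse-Wishart integral. *)
Lemma mxtrace_inv_block : c != 0 -> schur_complement \in unitmx ->
  schur_complement^T = schur_complement ->
  \tr (invmx C) = c^-1 + \tr (invmx schur_complement) +
    qform (c ^- 2 *: invmx schur_complement) u^T.
Proof.
move=> c0; set S := schur_complement => uS Ssym.
pose P' : 'M[R]_(1 + n) := block_mx 1%:M (- (c^-1 *: u)) 0 1%:M.
have PP' : P *m P' = 1%:M.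
  rewrite /P /P' mulmx_block !mul1mx !mul0mx !mulmx0 !mulmx1 !addr0 !add0r.
  by rewrite addNr -scalar_mx_block.
have E : C *m (P' *m block_mx c^-1%:M 0 0 (invmx S) *m P'^T) = 1%:M.
  rewrite block_congruence// -!mulmxA (mulmxA P) PP' mul1mx.
  rewrite (mulmxA (block_mx c%:M _ _ _)) mulmx_block !mulmx0 !mul0mx !addr0 !add0r.
  rewrite -scalar_mxM divff// -/S mulmxV// -scalar_mx_block mul1mx.
  by rewrite -trmx_mul (mulmx1C PP') trmx1.
have -> : invmx C = P' *m block_mx c^-1%:M 0 0 (invmx S) *m P'^T.
  have [uC _] := mulmx1_unit E.
  by rewrite -[RHS](mulKmx uC) E mulmx1.
rewrite /P' tr_block_mx !trmx1 trmx0 !mulmx_block.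
rewrite !mul1mx !mul0mx !mulmx0 !mulmx1 !addr0 !add0r mxtrace_block.
rewrite mxtraceD mxtrace_scalar mulr1n.
have -> : (- (c^-1 *: u))^T = - (c^-1 *: u^T).
  by apply/matrixP => k l; rewrite !mxE.
rewrite mulNmx mulmxN mulNmx opprK.
rewrite -addrA [X in _ + X]addrC addrA; congr (_ + _).
rewrite /qform trmxK /mxtrace big_ord1.
have -> : c^-1 *: u *m invmx S *m (c^-1 *: u^T) =
    (c^-1 * c^-1) *: (u *m invmx S *m u^T).
  by rewrite -scalemxAr -!scalemxAl scalerA.
by rewrite -scalemxAr -scalemxAl expr2 invfM.
Qed.

End block.
Lemma sym_block n (C : 'M[R]_(1 + n)) : C^T = C ->
  C = block_mx (C 0 0)%:M (ursubmx C) (ursubmx C)^T (drsubmx C).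
Proof.
move=> Csym; rewrite -{1}[C]submxK; congr block_mx.
  rewrite -const_mx1; apply/matrixP => i j; rewrite !ord1 !mxE.
  by congr (C _ _); exact: val_inj.
by rewrite -{1}Csym trmx_ursub.
Qed.

(** Induction by pivoting on the upper-left entry: determinants, Cholesky factors and Gaussian
    integrals all pass from the Schur complement to the whole matrix. *)
Lemma spd_ind (Q : forall n, 'M[R]_n -> Prop) :
  (forall C : 'M[R]_0, Q 0 C) ->
  (forall n c (u : 'rV[R]_n) (D : 'M[R]_n), 0 < c ->
     spd (schur_complement c u D) -> Q n (schur_complement c u D) ->
     Q (1 + n)%N (block_mx c%:M u u^T D)) ->
  forall n (C : 'M[R]_n), spd C -> Q n C.
Proof.
move=> Q0 QS; elim=> [|n IH] C spdC; first exact: Q0.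
have Csym := sym_block (proj1 spdC : (C : 'M[R]_(1 + n))^T = C).
move: spdC; rewrite Csym => /(@spd_block n)[c0 spdS].
by apply: QS => //; exact: IH.
Qed.

Lemma spd_det_gt0 n (C : 'M[R]_n) : spd C -> 0 < \det C.
Proof.
move: n C; apply: spd_ind => [C|n c u D c0 _ IH]; first by rewrite det_mx00.
by rewrite det_block ?gt_eqF// mulr_gt0.
Qed.

Lemma spd_unitmx n (C : 'M[R]_n) : spd C -> C \in unitmx.
Proof. by move=> /spd_det_gt0 C0; rewrite unitmxE unitfE gt_eqF. Qed.

Lemma spd_inv n (C : 'M[R]_n) : spd C -> spd (invmx C).
Proof.
move=> spdC; have uC := spd_unitmx spdC; case: spdC => Csym Cpos; split.
  by rewrite trmx_inv Csym.
move=> x x0; have : invmx C *m x != 0.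
  by apply: contra_neq x0 => Cx; rewrite -(mulKVmx uC x) Cx mulmx0.
move/Cpos; rewrite /qform trmx_mul trmx_inv Csym.
by rewrite -!mulmxA (mulmxA C) mulmxV// mul1mx.
Qed.

Lemma spd_scale n (C : 'M[R]_n) k : 0 < k -> spd C -> spd (k *: C).
Proof.
move=> k0 [Csym Cpos]; split; first by rewrite trmx_scale Csym.
by move=> x x0; rewrite qform_scale mulr_gt0// Cpos.
Qed.

(** Stands in for the spectral theorem: inequalities between forms and traces become statements
    about [sqnorm] of products with [L]. *)
Lemma spd_Cholesky n (C : 'M[R]_n) : spd C ->
  exists2 L : 'M[R]_n, L \in unitmx & C = L^T *m L.
Proof.
move: n C; apply: spd_ind => [C|n c u D c0 _ [L uL LE]].
  exists 1%:M; first exact: unitmx1.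
  by rewrite [C]flatmx0 [RHS]flatmx0.
pose P : 'M[R]_(1 + n) := block_mx 1%:M (c^-1 *: u) 0 1%:M.
exists (block_mx (Num.sqrt c)%:M 0 0 L *m P).
  rewrite unitmx_mul !unitmxE !det_ublock det_scalar1 !det1 mulr1 unitr1 andbT.
  by rewrite unitrM -unitmxE uL andbT unitfE gt_eqF// sqrtr_gt0.
rewrite (@block_congruence n) ?gt_eqF// trmx_mul -!mulmxA -/P.
congr (_ *m _); rewrite mulmxA; congr (_ *m _).
rewrite tr_block_mx !trmx0 tr_scalar_mx mulmx_block !mulmx0 !mul0mx !addr0 !add0r.
by rewrite -scalar_mxM -expr2 sqr_sqrtr ?ltW// LE.
Qed.

Lemma sqnorm_eq0 m n (A : 'M[R]_(m, n)) : sqnorm A = 0 -> A = 0.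
Proof.
move=> /eqP; rewrite psumr_eq0; last first.
  by move=> i _; apply: sumr_ge0 => j _; exact: sqr_ge0.
move=> /allP Ai; apply/matrixP => i j; rewrite mxE.
have := Ai i (mem_index_enum _); rewrite psumr_eq0; last first.
  by move=> k _; exact: sqr_ge0.
by move=> /allP/(_ j (mem_index_enum _)); rewrite sqrf_eq0 => /eqP.
Qed.

(** The trace replaces the largest eigenvalue. *)
Lemma spd_qform_le n (C : 'M[R]_n) x : spd C -> qform C x <= \tr C * sqnorm x.
Proof.
move=> /spd_Cholesky[L uL ->]; rewrite qform_gram mxtrace_gram.
exact: sqnorm_mulmx.
Qed.

Lemma spd_qform_ge0 n (C : 'M[R]_n) x : spd C -> 0 <= qform C x.
Proof.
by move=> /spd_Cholesky[L uL ->]; rewrite qform_gram sqnorm_ge0.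
Qed.

Lemma spd_mxtrace_ge0 n (C : 'M[R]_n) : spd C -> 0 <= \tr C.
Proof. by move=> /spd_Cholesky[L uL ->]; rewrite mxtrace_gram sqnorm_ge0. Qed.

Lemma spd_qform_ge n (C : 'M[R]_n) : spd C ->
  exists2 b : R, 0 < b & forall x, b * sqnorm x <= qform C x.
Proof.
(* [k^-1] replaces the smallest eigenvalue; the added [1] keeps [k] positive in dimension zero. *)
move=> /spd_Cholesky[L uL ->]; pose k := sqnorm (invmx L) + 1.
have k0 : 0 < k by rewrite ltr_wpDl// sqnorm_ge0.
exists k^-1 => [|x]; first by rewrite invr_gt0.
rewrite qform_gram ler_pdivrMl// -{1}(mulKmx uL x).
apply: le_trans (sqnorm_mulmx _ _) _.
by rewrite ler_wpM2r ?sqnorm_ge0// lerDl.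
Qed.

(** Turns inequalities between the form of [B] and [sqnorm] into inequalities between traces, row by
    row. *)
Lemma mxtrace_mul_gram n (L B : 'M[R]_n) :
  \tr (L^T *m L *m B) = \sum_i qform B (row i L)^T.
Proof.
rewrite -mulmxA mxtrace_mulC; apply: eq_bigr => i _.
rewrite /qform trmxK -row_mul !mxE; apply: eq_bigr => j _.
by rewrite !mxE.
Qed.

Lemma mxtrace_mul_ge n (S B : 'M[R]_n) (b : R) : spd S ->
  (forall x, b * sqnorm x <= qform B x) -> b * \tr S <= \tr (S *m B).
Proof.
move=> /spd_Cholesky[L uL ->] bB.
rewrite mxtrace_gram mxtrace_mul_gram sqnorm_rows mulr_sumr.
by apply: ler_sum.
Qed.

Lemma mxtrace_mul_le n (S B : 'M[R]_n) : spd S -> spd B ->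
  \tr (S *m B) <= \tr B * \tr S.
Proof.
move=> /spd_Cholesky[L uL ->] spdB.
rewrite mxtrace_gram mxtrace_mul_gram sqnorm_rows mulr_sumr.
by apply: ler_sum => i _; exact: spd_qform_le.
Qed.

End schur.

(** * Integrals over spaces of matrices *)

Section measurable_matrix_functions.
Context d (T : measurableType d) (R : realType).

Lemma measurable_entry m n (f : T -> 'M[R]_(m, n)) i j :
  measurable_fun setT f -> measurable_fun setT (fun t => f t i j).
Proof. by move=> mf; exact: (measurableT_comp (measurable_mxE i j) mf). Qed.

Lemma measurable_mulmx m n p (f : T -> 'M[R]_(m, n)) (g : T -> 'M[R]_(n, p)) :
  measurable_fun setT f -> measurable_fun setT g ->
  measurable_fun setT (fun t => f t *m g t).
Proof.
move=> mf mg; apply: measurable_fun_mxP => i j.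
under eq_fun do rewrite mxE.
by apply: measurable_sum => k; apply: measurable_funM; exact: measurable_entry.
Qed.

Lemma measurable_mxD m n (f g : T -> 'M[R]_(m, n)) :
  measurable_fun setT f -> measurable_fun setT g ->
  measurable_fun setT (fun t => f t + g t).
Proof.
move=> mf mg; apply: measurable_fun_mxP => i j; under eq_fun do rewrite mxE.
by apply: measurable_funD; exact: measurable_entry.
Qed.

Lemma measurable_scalemx m n (k : T -> R) (f : T -> 'M[R]_(m, n)) :
  measurable_fun setT k -> measurable_fun setT f ->
  measurable_fun setT (fun t => k t *: f t).
Proof.
move=> mk mf; apply: measurable_fun_mxP => i j; under eq_fun do rewrite mxE.
by apply: measurable_funM => //; exact: measurable_entry.
Qed.

Lemma measurable_mxN m n (f : T -> 'M[R]_(m, n)) :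
  measurable_fun setT f -> measurable_fun setT (fun t => - f t).
Proof.
move=> mf; under eq_fun do rewrite -scaleN1r.
by apply: measurable_scalemx => //; exact: measurable_cst.
Qed.

Lemma measurable_mxB m n (f g : T -> 'M[R]_(m, n)) :
  measurable_fun setT f -> measurable_fun setT g ->
  measurable_fun setT (fun t => f t - g t).
Proof. by move=> mf mg; apply: measurable_mxD => //; exact: measurable_mxN. Qed.

(** Covers every map that only rearranges or selects entries: transposes, rows, blocks. *)
Lemma measurable_mxsub m n m' n' (f : T -> 'M[R]_(m, n)) (g : 'M[R]_(m, n) -> 'M[R]_(m', n'))
    (r : 'I_m' -> 'I_n' -> 'I_m) (c : 'I_m' -> 'I_n' -> 'I_n) :
  (forall A i j, g A i j = A (r i j) (c i j)) ->
  measurable_fun setT f -> measurable_fun setT (fun t => g (f t)).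
Proof.
move=> gE mf; apply: measurable_fun_mxP => i j.
by under eq_fun do rewrite gE; exact: measurable_entry.
Qed.

Lemma measurable_trmx m n (f : T -> 'M[R]_(m, n)) :
  measurable_fun setT f -> measurable_fun setT (fun t => (f t)^T).
Proof.
by apply: (measurable_mxsub (r := fun i j => j) (c := fun i j => i)) => A i j;
  rewrite mxE.
Qed.

Lemma measurable_col_mx m1 m2 n (f : T -> 'M[R]_(m1, n)) (g : T -> 'M[R]_(m2, n)) :
  measurable_fun setT f -> measurable_fun setT g ->
  measurable_fun setT (fun t => col_mx (f t) (g t)).
Proof.
move=> mf mg; apply: measurable_fun_mxP => i j.
case: (split_ordP i) => k ->.
  by under eq_fun do rewrite col_mxEu; exact: measurable_entry.
by under eq_fun do rewrite col_mxEd; exact: measurable_entry.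
Qed.

Lemma measurable_row_mx m n1 n2 (f : T -> 'M[R]_(m, n1)) (g : T -> 'M[R]_(m, n2)) :
  measurable_fun setT f -> measurable_fun setT g ->
  measurable_fun setT (fun t => row_mx (f t) (g t)).
Proof.
move=> mf mg; apply: measurable_fun_mxP => i j.
case: (split_ordP j) => k ->.
  by under eq_fun do rewrite row_mxEl; exact: measurable_entry.
by under eq_fun do rewrite row_mxEr; exact: measurable_entry.
Qed.

Lemma measurable_block_mx m1 m2 n1 n2 (f11 : T -> 'M[R]_(m1, n1))
    (f12 : T -> 'M[R]_(m1, n2)) (f21 : T -> 'M[R]_(m2, n1)) (f22 : T -> 'M[R]_(m2, n2)) :
  measurable_fun setT f11 -> measurable_fun setT f12 ->
  measurable_fun setT f21 -> measurable_fun setT f22 ->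
  measurable_fun setT (fun t => block_mx (f11 t) (f12 t) (f21 t) (f22 t)).
Proof.
by move=> *; apply: measurable_col_mx; exact: measurable_row_mx.
Qed.

Lemma measurable_const_mx m n (f : T -> R) :
  measurable_fun setT f ->
  measurable_fun setT (fun t => const_mx (f t) : 'M[R]_(m, n)).
Proof.
by move=> mf; apply: measurable_fun_mxP => i j; under eq_fun do rewrite mxE.
Qed.

Lemma measurable_det n (f : T -> 'M[R]_n) :
  measurable_fun setT f -> measurable_fun setT (fun t => \det (f t)).
Proof.
move=> mf; apply: measurable_sum => s; apply: measurable_funM => //.
by apply: measurable_prod => i _; exact: measurable_entry.
Qed.

Lemma measurable_adjugate n (f : T -> 'M[R]_n) :
  measurable_fun setT f -> measurable_fun setT (fun t => \adj (f t)).
Proof.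
move=> mf; apply: measurable_fun_mxP => i j.
under eq_fun do rewrite mxE; apply: measurable_funM => //.
apply: measurable_det; apply: measurable_fun_mxP => k l.
by under eq_fun do rewrite !mxE; exact: measurable_entry.
Qed.

Lemma measurable_mxtrace n (f : T -> 'M[R]_n) :
  measurable_fun setT f -> measurable_fun setT (fun t => \tr (f t)).
Proof. by move=> mf; apply: measurable_sum => i; exact: measurable_entry. Qed.

Lemma measurable_qform n (f : T -> 'M[R]_n) (g : T -> 'cV[R]_n) :
  measurable_fun setT f -> measurable_fun setT g ->
  measurable_fun setT (fun t => qform (f t) (g t)).
Proof.
move=> mf mg; apply: measurable_entry; apply: measurable_mulmx => //.
by apply: measurable_mulmx => //; exact: measurable_trmx.
Qed.

Lemma measurable_sqnorm m n (f : T -> 'M[R]_(m, n)) :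
  measurable_fun setT f -> measurable_fun setT (fun t => sqnorm (f t)).
Proof.
move=> mf; apply: measurable_sum => i; apply: measurable_sum => j.
by apply: measurable_funX; exact: measurable_entry.
Qed.

(** The definition quantifies over uncountably many vectors. Pivoting replaces it by finitely many
    measurable conditions: symmetry, a positive pivot and, recursively, a positive definite Schur
    complement. *)
Lemma measurable_spd n (f : T -> 'M[R]_n) :
  measurable_fun setT f -> measurable [set t | spd (f t)].
Proof.
elim: n f => [|n IH] f mf.
  rewrite (_ : [set t | _] = setT)//; apply/seteqP; split => // t _ /=.
  by split=> [|x]; [rewrite [LHS]flatmx0 [RHS]flatmx0|rewrite [x]flatmx0 eqxx].
pose c t := f t 0 0; pose u t := ursubmx (f t : 'M[R]_(1 + n)).
pose D t := drsubmx (f t : 'M[R]_(1 + n)).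
have mc : measurable_fun setT c by exact: measurable_entry.
have mu : measurable_fun setT u.
  apply: (measurable_mxsub (f := f : T -> 'M[R]_(1 + n))
    (r := fun i _ => lshift n i) (c := fun _ j => rshift 1 j)) => // A i j.
  by rewrite !mxE.
have mD : measurable_fun setT D.
  apply: (measurable_mxsub (f := f : T -> 'M[R]_(1 + n))
    (r := fun i _ => rshift 1 i) (c := fun _ j => rshift 1 j)) => // A i j.
  by rewrite !mxE.
have mS : measurable_fun setT (fun t => schur_complement (c t) (u t) (D t)).
  apply: measurable_mxB => //; apply: measurable_scalemx.
    exact: measurable_fun_inv.
  by apply: measurable_mulmx => //; exact: measurable_trmx.
have -> : [set t | spd (f t)] = [set t | sqnorm ((f t)^T - f t) = 0] `&`
    [set t | 0 < c t] `&` [set t | spd (schur_complement (c t) (u t) (D t))].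
  apply/seteqP; split=> t /=.
    move=> spdf; have fsym := proj1 spdf.
    move: spdf; rewrite {1}(@sym_block R n (f t) fsym) => /spd_block[c0 ?].
    split => //; split => //; rewrite fsym subrr.
    by rewrite -(scale0r 0) sqnormZ expr0n mul0r.
  move=> [[/sqnorm_eq0/eqP]]; rewrite subr_eq0 => /eqP fsym c0 spdS.
  by rewrite (@sym_block R n (f t) fsym); apply/spd_block.
apply: measurableI; last exact: IH.
apply: measurableI.
  have mg : measurable_fun setT (fun t => sqnorm ((f t)^T - f t)).
    by apply: measurable_sqnorm; apply: measurable_mxB => //; exact: measurable_trmx.
  by have := mg measurableT [set 0] (measurable_set1 _); rewrite setTI.
have := mc measurableT `]0, +oo[%classic (measurable_itv _); rewrite setTI.
by congr measurable; apply/seteqP; split => t /=; rewrite in_itv/= andbT.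
Qed.

Lemma measurable_spd_if n (f : T -> 'M[R]_n) (g : T -> R) :
  measurable_fun setT f -> measurable_fun setT g ->
  measurable_fun setT (fun t => if `[< spd (f t) >] then g t else 0).
Proof.
move=> mf mg.
have -> : (fun t => if `[< spd (f t) >] then g t else 0) =
    (fun t => g t * \1_[set t | spd (f t)] t).
  apply/funext => t; rewrite indicE; case: ifPn => [/asboolP h|/asboolP h].
    by rewrite mem_set// mulr1.
  by rewrite memNset// mulr0.
by apply: measurable_funM => //; apply: measurable_indic; exact: measurable_spd.
Qed.

Lemma spd_invmxE n (A : 'M[R]_n) : spd A -> invmx A = (\det A)^-1 *: \adj A.
Proof. by move=> /spd_unitmx uA; rewrite /invmx uA. Qed.

Lemma measurable_spd_invmx n (f : T -> 'M[R]_n) :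
  measurable_fun setT f -> measurable_fun setT (fun t => (\det (f t))^-1 *: \adj (f t)).
Proof.
move=> mf; apply: measurable_scalemx; last exact: measurable_adjugate.
by apply: measurable_fun_inv; exact: measurable_det.
Qed.

End measurable_matrix_functions.

Lemma pushforward_measure d1 d2 (T1 : measurableType d1)
    (T2 : measurableType d2) (R : realType) (mu : {measure set T1 -> \bar R})
    (f : T1 -> T2) : measurable_fun setT f ->
  exists nu : {measure set T2 -> \bar R},
    nu = pushforward mu f :> (set T2 -> \bar R).
Proof.
move=> mf; apply: measure_of_fun.
- by rewrite /pushforward preimage_set0 measure0.
- by move=> A; exact: measure_ge0.
- by apply: measure_semi_sigma_additive.
Qed.

Section lebesgue_affine.
Local Open Scope ereal_scope.
Context {R : realType}.
Notation leb := (@lebesgue_measure R).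

Lemma measurable_affine (k c : R) :
  measurable_fun setT (fun x : measurableTypeR R => (k * x + c)%R : measurableTypeR R).
Proof. by apply: measurable_funD => //; apply: measurable_funM. Qed.

(** Lebesgue measure is determined by its values on half-open intervals, where the rescaled
    pushforward has the same values. *)
Lemma lebesgue_measure_affine (k c : R) (A : set R) : (0 < k)%R -> measurable A ->
  leb A = k%:E * pushforward leb (fun x : measurableTypeR R => (k * x + c)%R : measurableTypeR R) A.
Proof.
move=> k0 mA.
pose phi x : measurableTypeR R := (k * x + c)%R.
have mphi : measurable_fun [set: measurableTypeR R] phi := measurable_affine k c.
have [nu0 nu0E] := pushforward_measure leb mphi.
pose nu := mscale (NngNum (ltW k0)) nu0.
transitivity (nu A); last by rewrite /nu /mscale/= nu0E.
apply: lebesgue_measure_unique => //.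
move=> _ [[a b]] _ <-; rewrite /nu/= /mscale/= nu0E /pushforward.
have -> : phi @^-1` `]a, b]%classic = `]((a - c) / k)%R, ((b - c) / k)%R]%classic.
  apply/seteqP; split => x /=; rewrite !in_itv/= /phi ltr_pdivrMr// ler_pdivlMr//;
    by rewrite ltrBlDr lerBrDr (mulrC x).
do 2! rewrite lebesgue_measure_itv/=; rewrite !lte_fin ltr_pM2r ?invr_gt0// ltrD2r.
case: ifPn => _; last by rewrite mule0.
by rewrite -!EFinB -EFinM; congr EFin; field; rewrite gt_eqF.
Qed.

Lemma integral_lebesgue_affine (k c : R) (F : R -> \bar R) : (0 < k)%R ->
  measurable_fun setT F -> (forall x, 0 <= F x) ->
  \int[leb]_x F x = k%:E * \int[leb]_x F (k * x + c)%R.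
Proof.
move=> k0 mF F0.
pose phi x : measurableTypeR R := (k * x + c)%R.
have mphi : measurable_fun [set: measurableTypeR R] phi := measurable_affine k c.
have [nu0 nu0E] := pushforward_measure leb mphi.
rewrite -[RHS]/(k%:E * \int[leb]_x ((F \o phi) x)).
rewrite -[in RHS](preimage_setT phi) -(ge0_integral_pushforward mphi)//.
transitivity (\int[mscale (NngNum (ltW k0)) nu0]_x F x).
  apply: eq_measure_integral => A mA _.
  by have := lebesgue_measure_affine c k0 mA; rewrite -/phi -nu0E.
by rewrite ge0_integral_mscale// nu0E.
Qed.

Lemma integral_gauss_affine (k c : R) : (0 < k)%R ->
  \int[leb]_x (expR (- (k * (x + c) ^+ 2)))%:E = (Num.sqrt pi / Num.sqrt k)%:E.
Proof.
move=> k0; have sk0 : (0 < Num.sqrt k)%R by rewrite sqrtr_gt0.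
have mg : measurable_fun setT (fun x : R => (gauss_fun x)%:E).
  by apply/measurable_EFinP; exact: measurable_gauss_fun.
have := @integralT_gauss R.
rewrite (integral_lebesgue_affine (Num.sqrt k * c) sk0 mg); last first.
  by move=> x; rewrite lee_fin gauss_fun_ge0.
have E (x : R) : gauss_fun (Num.sqrt k * x + Num.sqrt k * c)%R =
    expR (- (k * (x + c) ^+ 2)).
  by rewrite /gauss_fun -mulrDr exprMn sqr_sqrtr// ltW.
under eq_integral do rewrite E.
move=> /(congr1 (fun z => (Num.sqrt k)^-1%:E * z)).
rewrite muleA -EFinM mulVf ?gt_eqF// mul1e => ->.
by rewrite -EFinM mulrC.
Qed.

End lebesgue_affine.

Section lebesgue_matrix_integrals.
Local Open Scope ereal_scope.
Context {R : realType}.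
Notation leb := (@lebesgue_measure R).

Lemma measurable_row_cons n : measurable_fun setT (@row_cons R n).
Proof.
apply: (measurable_row_mx (n1 := 1) (n2 := n)); last exact: measurable_snd.
by apply: measurable_const_mx; exact: measurable_fst.
Qed.

Lemma measurable_sym_cons n : measurable_fun setT (@sym_cons R n).
Proof.
have h2 : measurable_fun setT
    (fun x : measurableTypeR R * 'rV[R]_n * 'M[R]_n => x.1.2).
  exact: (measurableT_comp measurable_snd measurable_fst).
apply: (measurable_block_mx (m1 := 1) (n1 := 1) (m2 := n) (n2 := n)) => //.
- by apply: measurable_const_mx; exact: (measurableT_comp measurable_fst measurable_fst).
- exact: measurable_trmx.
Qed.

Lemma measurable_vec_mx m n : measurable_fun setT (@vec_mx R m n).
Proof.
apply: measurable_fun_mxP => i j; under eq_fun do rewrite mxE.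
exact: measurable_mxE.
Qed.

Lemma integral_lebesgue_rV0 (F : 'rV[R]_0 -> \bar R) :
  measurable_fun setT F -> \int[lebesgue_rV 0]_v F v = F 0%R.
Proof. by move=> mF; rewrite /= integral_dirac// diracT mul1e. Qed.

Lemma integral_lebesgue_rVS n (F : 'rV[R]_n.+1 -> \bar R) :
  measurable_fun setT F -> (forall v, 0 <= F v) ->
  \int[lebesgue_rV n.+1]_v F v =
  \int[lebesgue_rV n]_v \int[leb]_x F (row_cons (x, v)).
Proof.
move=> mF F0 /=; rewrite ge0_integral_pushforward//; last exact: measurable_row_cons.
have mFr : measurable_fun setT (F \o @row_cons R n).
  by apply: measurableT_comp => //; exact: measurable_row_cons.
by rewrite preimage_setT fubini_tonelli2// => ?; exact: F0.
Qed.

Lemma integral_lebesgue_mx m n (F : 'M[R]_(m, n) -> \bar R) :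
  measurable_fun setT F -> (forall v, 0 <= F v) ->
  \int[lebesgue_mx m n]_v F v = \int[lebesgue_rV (m * n)]_v F (vec_mx v).
Proof.
move=> mF F0; rewrite /lebesgue_mx ge0_integral_pushforward//.
exact: measurable_vec_mx.
Qed.

Lemma integral_lebesgue_sym0 (F : 'M[R]_0 -> \bar R) :
  measurable_fun setT F -> \int[lebesgue_sym 0]_v F v = F 0%R.
Proof. by move=> mF; rewrite /= integral_dirac// diracT mul1e. Qed.

Lemma integral_lebesgue_symS n (F : 'M[R]_n.+1 -> \bar R) :
  measurable_fun setT F -> (forall v, 0 <= F v) ->
  \int[lebesgue_sym n.+1]_v F v =
  \int[leb]_x \int[lebesgue_rV n]_v \int[lebesgue_sym n]_M F (sym_cons (x, v, M)).
Proof.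
move=> mF F0 /=; rewrite ge0_integral_pushforward//; last exact: measurable_sym_cons.
rewrite preimage_setT.
apply: (integral_product3 _ _ _ (F := F \o @sym_cons R n)).
  by apply: measurableT_comp => //; exact: measurable_sym_cons.
by move=> t; exact: F0.
Qed.

End lebesgue_matrix_integrals.

(** * Translations and dilations of Lebesgue measure on spaces of matrices *)

Section changes_of_variable.
Local Open Scope ereal_scope.
Context {R : realType}.

(** Restricted to a constant Jacobian [c] and phrased with integrals of nonnegative functions, a
    form that passes to products and pushforwards, from which the matrix measures are built. *)
Definition change_of_variable d (T : measurableType d) (m : set T -> \bar R)
    (c : R) (tau : T -> T) : Prop :=
  measurable_fun setT tau /\
  forall F : T -> \bar R, measurable_fun setT F -> (forall x, 0 <= F x) ->
    \int[m]_x F x = c%:E * \int[m]_x F (tau x).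

Lemma change_of_variable_product d1 d2 (T1 : measurableType d1)
    (T2 : measurableType d2) (m1 : {sigma_finite_measure set T1 -> \bar R})
    (m2 : {sigma_finite_measure set T2 -> \bar R}) c1 c2 tau1 tau2 :
  (0 <= c2)%R -> change_of_variable m1 c1 tau1 -> change_of_variable m2 c2 tau2 ->
  change_of_variable (m1 \x m2) (c1 * c2) (fun x => (tau1 x.1, tau2 x.2)).
Proof.
move=> c20 [mt1 H1] [mt2 H2].
have mt : measurable_fun setT (fun x : T1 * T2 => (tau1 x.1, tau2 x.2)).
  by apply: measurable_fun_pair; [exact: (measurableT_comp mt1 measurable_fst)
    |exact: (measurableT_comp mt2 measurable_snd)].
split=> // F mF F0.
have mFs : measurable_fun setT (fun x => F (tau1 x.1, tau2 x.2)).
  exact: (measurableT_comp mF mt).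
rewrite [X in _ = _ * X]fubini_tonelli1//= [LHS]fubini_tonelli1//.
rewrite H1//; last 2 first.
- exact: measurable_fun_fubini_tonelli_F.
- by move=> x; exact: integral_ge0.
rewrite EFinM -muleA; congr (_ * _).
rewrite -ge0_integralZl_EFin//; last 2 first.
- by move=> x _; exact: integral_ge0.
- exact: (measurable_fun_fubini_tonelli_F (fun x => F (tau1 x.1, tau2 x.2))).
apply: eq_integral => x _; apply: H2 => //.
exact: (measurableT_comp mF (measurable_pair1 _)).
Qed.

Lemma change_of_variable_pushforward d1 d2 (T1 : measurableType d1)
    (T2 : measurableType d2) (m : {measure set T1 -> \bar R}) (phi : T1 -> T2)
    c tau tau' : measurable_fun setT phi -> measurable_fun setT tau' ->
  (forall x, phi (tau x) = tau' (phi x)) ->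
  change_of_variable m c tau -> change_of_variable (pushforward m phi) c tau'.
Proof.
move=> mphi mt' phit [mt H]; split=> // F mF F0.
have mFs : measurable_fun setT (fun x => F (tau' x)).
  exact: (measurableT_comp mF mt').
rewrite [LHS](ge0_integral_pushforward mphi)//.
rewrite [X in _ = _ * X](ge0_integral_pushforward mphi)// preimage_setT.
rewrite (H (F \o phi)); last 2 first.
- exact: measurableT_comp.
- by move=> x; exact: F0.
by congr (_ * _); apply: eq_integral => x _ /=; rewrite phit.
Qed.

Lemma lebesgue_translation (c : R) :
  change_of_variable (@lebesgue_measure R) 1 (fun x => x + c)%R.
Proof.
split=> [|F mF F0]; first exact: measurable_funD.
rewrite (integral_lebesgue_affine c ltr01 mF F0); congr (_ * _).
by apply: eq_integral => x _; rewrite mul1r.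
Qed.

Lemma measurable_translate m n (B : 'M[R]_(m, n)) :
  measurable_fun setT (fun A : 'M[R]_(m, n) => (A + B)%R).
Proof. by apply: measurable_mxD => //; exact: measurable_cst. Qed.

Lemma lebesgue_rV_translation n (w : 'rV[R]_n) :
  change_of_variable (@lebesgue_rV R n) 1 (fun v => v + w)%R.
Proof.
elim: n w => [|n IH] w.
  split => [|F mF F0]; first exact: measurable_translate.
  rewrite mul1e !integral_lebesgue_rV0 ?[w]thinmx0 ?addr0//.
  exact: (measurableT_comp mF (measurable_translate _)).
rewrite -[1%R]mulr1.
have H := change_of_variable_product ler01
  (lebesgue_translation (w 0 0)%R) (IH (rsubmx (w : 'rV[R]_(1 + n)))).
apply: change_of_variable_pushforward H.
- exact: measurable_row_cons.
- exact: measurable_translate.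
move=> [x v]; rewrite /row_cons/= -[w in RHS](@hsubmxK _ 1 1 n) (@add_row_mx _ 1 1 n).
apply: (congr1 (fun z => @row_mx _ 1 1 n z _)).
apply/matrixP => i j; rewrite !mxE !ord1; congr (_ + w _ _)%R.
exact: val_inj.
Qed.

(** The measure is carried by symmetric matrices, parametrized by the entries on and above the
    diagonal; a symmetric translation acts on these coordinates as a translation. *)
Lemma lebesgue_sym_translation n (N : 'M[R]_n) : (N^T)%R = N ->
  change_of_variable (@lebesgue_sym R n) 1 (fun M => M + N)%R.
Proof.
elim: n N => [|n IH] N Nsym.
  split => [|F mF F0]; first exact: measurable_translate.
  rewrite mul1e !integral_lebesgue_sym0 ?[N]flatmx0 ?addr0//.
  exact: (measurableT_comp mF (measurable_translate _)).
have H1 : change_of_variable (product_sfm (@lebesgue_measure R) (@lebesgue_rV R n)) (1 * 1) _ :=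
  change_of_variable_product ler01 (lebesgue_translation (N 0 0)%R)
    (lebesgue_rV_translation (ursubmx (N : 'M[R]_(1 + n)))).
have Dsym : ((drsubmx (N : 'M[R]_(1 + n)))^T)%R = drsubmx (N : 'M[R]_(1 + n)).
  by rewrite trmx_drsub Nsym.
have H2 := change_of_variable_product ler01 H1 (IH _ Dsym).
rewrite -[1%R]mulr1 -{1}[1%R]mulr1.
apply: change_of_variable_pushforward H2.
- exact: measurable_sym_cons.
- exact: measurable_translate.
move=> [[x v] M]; rewrite /sym_cons/= [N in RHS](@sym_block _ n N Nsym).
rewrite (@add_block_mx _ 1 n 1 n) -const_mx1.
have -> : ((v + ursubmx (N : 'M[R]_(1 + n)))^T =
    v^T + (ursubmx (N : 'M[R]_(1 + n)))^T)%R.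
  by apply/matrixP => i j; rewrite !mxE.
apply: (congr1 (fun z => @block_mx _ 1 n 1 n z _ _ _)).
by apply/matrixP => i j; rewrite !mxE.
Qed.

(** [N] is the dimension of the space. Its value does not matter in what follows, so it is left
    existential for the matrix measures. *)
Definition dilation_law d (T : measurableType d) (m : set T -> \bar R)
    (N : nat) (sc : R -> T -> T) : Prop :=
  forall k : R, (0 < k)%R -> change_of_variable m (k ^+ N) (sc k).

Lemma dilation_lebesgue :
  dilation_law (@lebesgue_measure R) 1 (fun k x => k * x)%R.
Proof.
move=> k k0; split=> [|F mF F0]; first exact: measurable_funM.
rewrite expr1 (integral_lebesgue_affine 0 k0 mF F0); congr (_ * _).
by apply: eq_integral => x _; rewrite addr0.
Qed.

Lemma dilation_product d1 d2 (T1 : measurableType d1) (T2 : measurableType d2)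
    (m1 : {sigma_finite_measure set T1 -> \bar R})
    (m2 : {sigma_finite_measure set T2 -> \bar R}) N1 N2 sc1 sc2 :
  dilation_law m1 N1 sc1 -> dilation_law m2 N2 sc2 ->
  dilation_law (m1 \x m2) (N1 + N2) (fun k x => (sc1 k x.1, sc2 k x.2)).
Proof.
move=> H1 H2 k k0; rewrite exprD.
apply: change_of_variable_product (H1 k k0) (H2 k k0).
by rewrite exprn_ge0// ltW.
Qed.

Lemma measurable_scale_cst m n (k : R) :
  measurable_fun setT (fun A : 'M[R]_(m, n) => (k *: A)%R).
Proof. by apply: measurable_scalemx => //; exact: measurable_cst. Qed.

Lemma dilation_lebesgue_rV n :
  exists N, dilation_law (@lebesgue_rV R n) N (fun k v => k *: v)%R.
Proof.
elim: n => [|n [N IH]].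
  exists 0%N => k k0; split => [|F mF F0]; first exact: measurable_scale_cst.
  rewrite expr0 mul1e !integral_lebesgue_rV0 ?scaler0//.
  exact: (measurableT_comp mF (measurable_scale_cst _)).
exists (1 + N)%N => k k0.
apply: change_of_variable_pushforward (dilation_product dilation_lebesgue IH k0).
- exact: measurable_row_cons.
- exact: measurable_scale_cst.
move=> [x v]; rewrite /row_cons/= (@scale_row_mx _ 1 1 n).
apply: (congr1 (fun z => @row_mx _ 1 1 n z _)).
by apply/matrixP => i j; rewrite !mxE.
Qed.

Lemma dilation_lebesgue_mx m n :
  exists N, dilation_law (@lebesgue_mx R m n) N (fun k v => k *: v)%R.
Proof.
have [N H] := dilation_lebesgue_rV (m * n); exists N => k k0.
apply: change_of_variable_pushforward (H k k0).
- exact: measurable_vec_mx.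
- exact: measurable_scale_cst.
by move=> v; rewrite linearZ.
Qed.

Lemma dilation_lebesgue_sym n :
  exists N, dilation_law (@lebesgue_sym R n) N (fun k v => k *: v)%R.
Proof.
elim: n => [|n [N IH]].
  exists 0%N => k k0; split => [|F mF F0]; first exact: measurable_scale_cst.
  rewrite expr0 mul1e !integral_lebesgue_sym0 ?scaler0//.
  exact: (measurableT_comp mF (measurable_scale_cst _)).
have [N' HN'] := dilation_lebesgue_rV n.
have H1 : dilation_law (product_sfm (@lebesgue_measure R) (@lebesgue_rV R n)) (1 + N') _ :=
  dilation_product dilation_lebesgue HN'.
exists (1 + N' + N)%N => k k0.
apply: change_of_variable_pushforward (dilation_product H1 IH k0).
- exact: measurable_sym_cons.
- exact: measurable_scale_cst.
move=> [[x v] M]; rewrite /sym_cons/= (@scale_block_mx _ 1 n 1 n) trmx_scale.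
apply: (congr1 (fun z => @block_mx _ 1 n 1 n z _ _ _)).
by apply/matrixP => i j; rewrite !mxE.
Qed.

End changes_of_variable.

(** * Gaussian integrals on row vectors *)

Section gaussian.
Local Open Scope ereal_scope.
Context {R : realType}.
Notation leb := (@lebesgue_measure R).

(** By pivoting: once the square is completed, the integral over the first coordinate is independent
    of the others, and the determinant is the pivot times that of the Schur complement. *)
Lemma integral_gaussian_rV n (C : 'M[R]_n) : spd C ->
  \int[lebesgue_rV n]_v (expR (- qform C v^T))%:E =
  (Num.sqrt pi ^+ n / Num.sqrt (\det C))%:E.
Proof.
have mE k (D : 'M[R]_k) : measurable_fun setT (fun v : 'rV[R]_k => (expR (- qform D v^T))%:E).
  apply/measurable_EFinP; apply: measurableT_comp => //.
  apply: measurable_funN; apply: measurable_qform; first exact: measurable_cst.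
  exact: measurable_trmx.
move: n C; apply: spd_ind => [C|n c u D c0 spdS IH].
  rewrite integral_lebesgue_rV0// trmx0 qform0 oppr0 expR0 expr0 det_mx00.
  by rewrite sqrtr1 divr1.
rewrite (@integral_lebesgue_rVS R n _ (mE _ _)); last first.
  by move=> v; rewrite lee_fin expR_ge0.
have E (v : 'rV[R]_n) (x : R) :
    (expR (- qform (block_mx c%:M u u^T D) (row_cons (x, v))^T))%:E =
    (expR (- qform (schur_complement c u D) v^T))%:E *
      (expR (- (c * (x + c^-1 * (u *m v^T) 0 0) ^+ 2)))%:E.
  rewrite -EFinM -expRD /row_cons/= (@tr_row_mx _ 1 1 n) trmx_const.
  by rewrite qform_block ?gt_eqF// mxE -opprD addrC.
under eq_integral => v _.
  under eq_integral do rewrite E.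
  rewrite ge0_integralZl_EFin ?expR_ge0//; last first.
    apply/measurable_EFinP; apply: measurableT_comp => //; apply: measurable_funN.
    apply: measurable_funM => //; apply: measurable_funX.
    exact: measurable_funD.
  rewrite integral_gauss_affine//.
  over.
rewrite ge0_integralZr//; last exact: mE.
have dS := spd_det_gt0 spdS.
rewrite IH -EFinM det_block ?gt_eqF// sqrtrM ?ltW// exprD expr1; congr EFin.
by field; rewrite !gt_eqF// sqrtr_gt0.
Qed.

End gaussian.

(** * The inverse-Wishart integral *)

Section integral_scale.
Context d (T : measurableType d) (R : realType) (m : {measure set T -> \bar R}).

Lemma integral_scale (k : R) (f : T -> R) : 0 <= k -> measurable_fun setT f ->
  (forall x, 0 <= f x) ->
  (\int[m]_x (k * f x)%:E = k%:E * \int[m]_x (f x)%:E)%E.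
Proof.
move=> k0 mf f0; under eq_integral do rewrite EFinM.
rewrite ge0_integralZl_EFin//; first by move=> x _; rewrite lee_fin.
exact/measurable_EFinP.
Qed.

End integral_scale.

Section integral_positivity.
Local Open Scope ereal_scope.
Context d (T : measurableType d) (R : realType) (m : {measure set T -> \bar R}).

(** If the integral of [q] is zero, then [q] vanishes almost everywhere, hence so does [f]. This
    yields positivity of integrals that are never computed. *)
Lemma integral_gt0_support (f q : T -> \bar R) : measurable_fun setT f ->
  measurable_fun setT q -> (forall x, 0 <= f x) -> (forall x, 0 <= q x) ->
  (forall x, 0 < f x -> 0 < q x) -> 0 < \int[m]_x f x -> 0 < \int[m]_x q x.
Proof.
move=> mf mq f0 q0 fq; rewrite !lt_neqAle !integral_ge0// ?andbT => If0.
apply: contra If0 => /eqP Iq0; apply/eqP/esym.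
have : \int[m]_(x in setT) `|q x| = 0.
  by rewrite Iq0; apply: eq_integral => x _; rewrite gee0_abs.
move=> /(ae_eq_integral_abs _ measurableT mq) q0ae.
have : ae_eq m setT f (cst 0).
  apply: filterS q0ae => x /= qx _; have {}qx := qx I.
  apply/eqP; rewrite eq_le f0 andbT leNgt; apply/negP => /fq.
  by rewrite qx ltxx.
move=> /(ae_eq_integral_abs _ measurableT mf) <-.
by apply: eq_integral => x _; rewrite gee0_abs.
Qed.

End integral_positivity.

Section inverse_gamma.
Context {R : realType}.
Notation leb := (@lebesgue_measure R).

(** [3 / 2] is the lower bound on the pivot exponent guaranteed in the inverse-Wishart recursion.
    The primitive is [F], which tends to [0] at infinity. *)
Lemma integral_powR_tail : (\int[leb]_(x in `[1%R, +oo[) (x `^ (- (3 / 2)))%:E < +oo)%E.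
Proof.
pose F (x : R) : R := (- 2 * x `^ (- (1 / 2)))%R.
have dF (x : R) : (0 < x)%R -> is_derive x 1 F (x `^ (- (3 / 2)))%R.
  move=> x0; have H := is_derive1_powR (- (1 / 2)) x0.
  have -> : (x `^ (- (3 / 2)) = (- 2) *: ((- (1 / 2)) * x `^ (- (1 / 2) - 1)))%R.
    rewrite /GRing.scale/= mulrA; rewrite (_ : (- 2 * - (1 / 2) = 1)%R) ?mul1r; last by field.
    by congr (x `^ _)%R; field.
  exact: is_deriveZ.
have cont (x : R) a : (0 < x)%R -> {for x, continuous (fun y : R => (y `^ a)%R)}.
  move=> x0; apply/differentiable_continuous/derivable1_diffP.
  by apply: derivable_powR; rewrite in_itv/= andbT.
rewrite (@ge0_continuous_FTC2y _ (fun x => x `^ (- (3 / 2)))%R F 1%R 0%R).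
- by rewrite -EFinB ltry.
- by move=> x _; exact: powR_ge0.
- apply: continuous_in_subspaceT => x; rewrite inE/= in_itv/= andbT => x1.
  by apply: cont; exact: lt_le_trans x1.
- apply/cvgrPdist_le => e e0; near=> x.
  have x0 : (0 < x)%R by near: x; exact: nbhs_pinfty_gt.
  rewrite sub0r normrN /F normrM normrN !ger0_norm ?powR_ge0//.
  rewrite powRN mul1r powR12_sqrt ?ltW//.
  rewrite ltr_pdivrMr ?sqrtr_gt0// mulrC -ltr_pdivrMr//.
  rewrite -(ger0_norm (x := (2 / e)%R)) ?divr_ge0 ?ltW// -sqrtr_sqr ltr_sqrt//.
  by near: x; apply: nbhs_pinfty_gt; rewrite num_real.
- by move=> x x1; have [] := dF x (lt_trans ltr01 x1).
- apply: cvg_at_right_filter; apply: cvgZr; exact: cont.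
- move=> x; rewrite in_itv/= andbT => x1.
  by rewrite derive1E; have [_ ->] := dF x (lt_trans ltr01 x1).
Unshelve. all: by end_near. Qed.

(** The unnormalized inverse-gamma density, which is the law of the pivot. *)
Definition inv_gamma_kernel (g b x : R) : R :=
  if 0 < x then x `^ (- g) * expR (- (b / x)) else 0.

Lemma inv_gamma_kernel_ge0 g b x : 0 <= inv_gamma_kernel g b x.
Proof.
by rewrite /inv_gamma_kernel; case: ifPn => // _; rewrite mulr_ge0 ?powR_ge0 ?expR_ge0.
Qed.

Lemma measurable_inv_gamma_kernel g b : measurable_fun setT (inv_gamma_kernel g b).
Proof.
have -> : inv_gamma_kernel g b =
    (fun x => (x `^ (- g) * expR (- (b / x))) * \1_(`]0, +oo[%classic : set R) x).
  apply/funext => x; rewrite /inv_gamma_kernel indicE.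
  case: ifPn => x0; first by rewrite mem_set ?mulr1//= in_itv/= x0.
  by rewrite memNset ?mulr0//= in_itv/= andbT; exact/negP.
apply: measurable_funM; last exact: measurable_indic.
apply: measurable_funM; first exact: measurable_powR.
apply: measurableT_comp => //; apply: measurable_funN; apply: measurable_funM => //.
exact: measurable_fun_inv.
Qed.

Lemma integral_inv_gamma_gt0 g b :
  (0 < \int[leb]_x (inv_gamma_kernel g b x)%:E)%E.
Proof.
apply: (integral_gt0_support (m := leb)
  (f := EFin \o \1_(`]0, 1]%classic : set R))
  (q := fun x => (inv_gamma_kernel g b x)%:E)).
- exact/measurable_EFinP/measurable_indic.
- by apply/measurable_EFinP; exact: measurable_inv_gamma_kernel.
- by move=> x /=; rewrite lee_fin.
- by move=> x; rewrite lee_fin inv_gamma_kernel_ge0.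
- move=> x /=; rewrite !lte_fin indicE.
  case: (boolP (x \in _)); last by rewrite ltxx.
  rewrite inE/= in_itv/= => /andP[x0 _] _.
  by rewrite /inv_gamma_kernel x0 mulr_gt0 ?powR_gt0 ?expR_gt0.
- by rewrite integral_indic// setIT /= lebesgue_measure_itv/= lte01 oppr0 adde0 lte_fin.
Qed.

(** From [z <= expR z] at [z = y / k.+1], raised to the power [k.+1] and inverted. It cancels the
    pole at [0] of the inverse-gamma kernel. *)
Lemma expRN_le_pow (k : nat) (y : R) : 0 < y -> expR (- y) <= (k.+1%:R / y) ^+ k.+1.
Proof.
move=> y0; have k0 : (0 : R) < k.+1%:R by rewrite ltr0n.
rewrite -invf_div exprVn expRN lef_pV2 ?posrE ?expR_gt0 ?exprn_gt0 ?divr_gt0//.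
apply: (@le_trans _ _ (expR (y / k.+1%:R) ^+ k.+1)).
  apply: lerXn2r; rewrite ?nnegrE ?expR_ge0 ?divr_ge0 ?ltW//.
  by rewrite (lt_le_trans _ (expR_ge1Dx _))// ltrDr.
by rewrite -expRM_natl mulrC -mulr_natr -mulrA mulVf ?mulr1// gt_eqF.
Qed.

Lemma integral_inv_gamma_lty g b : 0 < b -> 3 / 2 <= g ->
  (\int[leb]_x (inv_gamma_kernel g b x)%:E < +oo)%E.
Proof.
(* [k.+1] exceeds [g], so on []0, 1]] the pole [x ^ -g] is absorbed and the constant [K] dominates;
   on [[1, +oo[] the exponential is at most [1] and the power alone is integrable. *)
move=> b0 g32; pose k := Num.truncn g; pose K := (k.+1%:R / b) ^+ k.+1.
have K0 : 0 <= K by rewrite exprn_ge0// divr_ge0// ltW.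
pose h1 x : \bar R := (K * \1_(`]0, 1]%classic : set R) x)%:E.
pose h2 x : \bar R := (x `^ (- (3 / 2)) * \1_(`[1, +oo[%classic : set R) x)%:E.
have mh1 : measurable_fun setT h1.
  by apply/measurable_EFinP; apply: measurable_funM => //; exact: measurable_indic.
have mh2 : measurable_fun setT h2.
  apply/measurable_EFinP; apply: measurable_funM; last exact: measurable_indic.
  exact: measurable_powR.
have h1_ge0 x : (0 <= h1 x)%E by rewrite lee_fin mulr_ge0.
have h2_ge0 x : (0 <= h2 x)%E by rewrite lee_fin mulr_ge0 ?powR_ge0.
apply: (@le_lt_trans _ _ (\int[leb]_x (h1 x + h2 x))%E).
  apply: ge0_le_integral => //.
  - by move=> x _; rewrite lee_fin inv_gamma_kernel_ge0.
  - by apply/measurable_EFinP; exact: measurable_inv_gamma_kernel.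
  - exact: emeasurable_funD.
  move=> x _; rewrite /inv_gamma_kernel; case: ifPn => x0; last exact: adde_ge0.
  have e1 : expR (- (b / x)) <= 1.
    by rewrite -expR0 ler_expR lerNl oppr0 divr_ge0 ?ltW.
  have [x1|x1] := leP x 1.
    rewrite -[leLHS]adde0 leeD// lee_fin indicE mem_set ?mulr1; last first.
      by rewrite /= in_itv/= x0.
    have := expRN_le_pow k (divr_gt0 b0 x0) => /(ler_wpM2l (powR_ge0 x (- g))).
    move=> /le_trans; apply.
    have -> : k.+1%:R / (b / x) = (k.+1%:R / b) * x by rewrite invf_div mulrA mulrAC.
    rewrite exprMn mulrCA -[leRHS]mulr1 ler_wpM2l//.
    rewrite -(powR_mulrn _ (ltW x0)) -powRD; last by rewrite (gt_eqF x0) implybT.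
    have e0 : 0 <= - g + k.+1%:R by rewrite addrC subr_ge0 ltW// truncnS_gt.
    apply: le_trans (ge0_ler_powR e0 _ _ x1) _; rewrite ?nnegrE ?ler01 ?(ltW x0)//.
    by rewrite powR1.
  rewrite -[leLHS]add0e leeD// lee_fin indicE mem_set ?mulr1; last first.
    by rewrite /= in_itv/= andbT ltW.
  rewrite -[leRHS]mulr1 ler_pM ?powR_ge0 ?expR_ge0//.
  by apply: ler_powR; [exact: ltW|rewrite lerN2].
rewrite ge0_integralD//; apply: lte_add_pinfty.
  under eq_integral do rewrite /h1 EFinM.
  rewrite ge0_integralZl_EFin//; last first.
    by apply/measurable_EFinP; exact: measurable_indic.
  rewrite integral_indic// setIT /= lebesgue_measure_itv/= lte01 oppr0 adde0.
  by rewrite -EFinM ltry.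
apply: le_lt_trans integral_powR_tail; rewrite [leRHS]integral_mkcond.
apply: ge0_le_integral => //.
- apply/(measurable_restrictT _ _).1 => //; apply/measurable_EFinP.
  by apply: measurable_funTS; exact: measurable_powR.
- move=> x _; rewrite /h2 /patch indicE; case: ifPn => _; first by rewrite mulr1.
  by rewrite mulr0.
Qed.

End inverse_gamma.

Section inverse_wishart_integral.
Context {R : realType}.
Notation leb := (@lebesgue_measure R).

(* Agrees with [invmx] on invertible matrices, and is visibly measurable in the
   entries of [A] on all matrices ([invmx A] is [A] when [A] is singular). *)
Definition cinvmx n (A : 'M[R]_n) : 'M[R]_n := (\det A)^-1 *: \adj A.

Lemma spd_cinvmx n (A : 'M[R]_n) : spd A -> cinvmx A = invmx A.
Proof. by move=> ?; rewrite spd_invmxE. Qed.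

(** The inverse-Wishart kernel with scalar scale; the general scale is sandwiched between two of
    these in [Sigma_factor_bounds]. *)
Definition iw_kernel n (al b : R) (S : 'M[R]_n) : R :=
  if `[< spd S >] then \det S `^ (- al) * expR (- (b * \tr (invmx S))) else 0.

Lemma iw_kernel_ge0 n al b (S : 'M[R]_n) : 0 <= iw_kernel al b S.
Proof.
by rewrite /iw_kernel; case: ifPn => // _; rewrite mulr_ge0 ?powR_ge0 ?expR_ge0.
Qed.

Lemma measurable_iw_kernel n al b : measurable_fun setT (@iw_kernel n al b).
Proof.
have -> : @iw_kernel n al b = (fun S => if `[< spd S >] then
    \det S `^ (- al) * expR (- (b * \tr (cinvmx S))) else 0).
  apply/funext => S; rewrite /iw_kernel; case: ifPn => // /asboolP spdS.
  by rewrite spd_cinvmx.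
apply: measurable_spd_if; first exact: measurable_id.
apply: measurable_funM.
  by apply: (measurableT_comp (measurable_powR _)); apply: measurable_det; exact: measurable_id.
apply: measurableT_comp => //; apply: measurable_funN; apply: measurable_funM => //.
by apply: measurable_mxtrace; apply: measurable_spd_invmx; exact: measurable_id.
Qed.

(** What remains once the pivot [x] is factored out: [M] stands for the Schur complement and, given
    [x] and [M], the row [v] is Gaussian. *)
Definition iw_block_kernel n (al b x : R) (v : 'rV[R]_n) (M : 'M[R]_n) : R :=
  iw_kernel al b M * expR (- qform ((b * x ^- 2) *: cinvmx M) v^T).

Lemma iw_block_kernel_ge0 n al b x v (M : 'M[R]_n) :
  0 <= iw_block_kernel al b x v M.
Proof. by rewrite mulr_ge0 ?iw_kernel_ge0 ?expR_ge0. Qed.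

Lemma measurable_iw_block_kernel n al b x :
  measurable_fun setT
    (fun t : 'rV[R]_n * 'M[R]_n => iw_block_kernel al b x t.1 t.2).
Proof.
apply: measurable_funM.
  exact: (measurableT_comp (@measurable_iw_kernel n al b) measurable_snd).
apply: measurableT_comp => //; apply: measurable_funN; apply: measurable_qform.
  apply: measurable_scalemx; first exact: measurable_cst.
  by apply: measurable_spd_invmx; exact: measurable_snd.
by apply: measurable_trmx; exact: measurable_fst.
Qed.

(* Pivoting on the upper-left entry [x]; the third block becomes the Schur
   complement, a translate of [M] by a symmetric matrix. *)
Lemma iw_kernel_sym_cons n al b x (v : 'rV[R]_n) (M : 'M[R]_n) :
  iw_kernel al b (sym_cons (x, v, M)) =
  inv_gamma_kernel al b x *
    iw_block_kernel al b x v (M + - (x^-1 *: (v^T *m v))).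
Proof.
rewrite /sym_cons/= const_mx1 /inv_gamma_kernel /iw_block_kernel /iw_kernel.
rewrite -/(schur_complement x v M); case: ifPn => [|/asboolP nspd].
  move=> /asboolP/(@spd_block R n)[x0 spdS]; rewrite x0 asboolT// spd_cinvmx//.
  rewrite (@det_block R n) ?gt_eqF// powRM ?(ltW x0) ?(ltW (spd_det_gt0 spdS))//.
  rewrite (@mxtrace_inv_block R n) ?gt_eqF//; last 2 first.
  - exact: spd_unitmx.
  - by case: spdS.
  set S := schur_complement x v M.
  have -> : expR (- (b * (x^-1 + \tr (invmx S) + qform (x ^- 2 *: invmx S) v^T))) =
      expR (- (b / x)) * (expR (- (b * \tr (invmx S))) *
        expR (- qform ((b * x ^- 2) *: invmx S) v^T)).
    by rewrite -!expRD; congr expR; rewrite !qform_scale; ring.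
  by ring.
case: ifPn => x0; last by rewrite mul0r.
rewrite asboolF ?mul0r ?mulr0// => spdS; apply: nspd.
by apply/(@spd_block R n).
Qed.

Lemma schur_shift_sym n x (v : 'rV[R]_n) :
  (- (x^-1 *: (v^T *m v)))^T = - (x^-1 *: (v^T *m v)).
Proof. by rewrite linearN/= trmx_scale trmx_mul trmxK. Qed.

(** The Gaussian integral over [v] produces the square root of [\det M], which lowers the exponent
    [al] by one half, and the power [x ^+ n], which will shift the exponent of the pivot. *)
Lemma integral_iw_block_kernel n al b x (M : 'M[R]_n) : 0 < b -> 0 < x ->
  (\int[lebesgue_rV n]_v (iw_block_kernel al b x v M)%:E =
   (iw_kernel (al - 1 / 2) b M * ((Num.sqrt pi / Num.sqrt b) ^+ n * x ^+ n))%:E)%E.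
Proof.
move=> b0 x0; have k0 : 0 < b * x ^- 2 by rewrite mulr_gt0// invr_gt0 exprn_gt0.
under eq_integral do rewrite /iw_block_kernel EFinM.
rewrite ge0_integralZl_EFin ?iw_kernel_ge0//; last first.
  apply/measurable_EFinP; apply: measurableT_comp => //; apply: measurable_funN.
  apply: measurable_qform; first exact: measurable_cst.
  exact: measurable_trmx.
rewrite /iw_kernel; case: ifPn => [/asboolP spdM|_]; last by rewrite !mul0r mul0e.
rewrite spd_cinvmx// integral_gaussian_rV; last exact/spd_scale/spd_inv.
rewrite -EFinM; congr EFin; rewrite detZ det_inv.
have dM := spd_det_gt0 spdM.
have -> : - (al - 1 / 2) = - al + 2^-1 by rewrite opprB addrC mul1r.
rewrite powRD; last by rewrite (gt_eqF dM) implybT.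
rewrite powR12_sqrt ?(ltW dM)//.
have -> : Num.sqrt ((b * x ^- 2) ^+ n * (\det M)^-1) =
    (Num.sqrt b / x) ^+ n / Num.sqrt (\det M).
  rewrite sqrtrM ?exprn_ge0 ?(ltW k0)// sqrtrV ?(ltW dM)//; congr (_ / _).
  rewrite -{1}(sqr_sqrtr (ltW k0)) -exprM mulnC exprM sqrtr_sqr.
  rewrite ger0_norm ?exprn_ge0 ?sqrtr_ge0//; congr (_ ^+ _).
  rewrite sqrtrM ?(ltW b0)// sqrtrV ?sqr_ge0//.
  by rewrite sqrtr_sqr ger0_norm// ltW.
have sM : Num.sqrt (\det M) != 0 by rewrite gt_eqF// sqrtr_gt0.
have sb : Num.sqrt b != 0 by rewrite gt_eqF// sqrtr_gt0.
rewrite !expr_div_n; field.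
by rewrite sM !expf_neq0// gt_eqF.
Qed.

(** In the coordinates pivot, row and Schur complement the kernel splits, and the integral becomes
    an inverse-gamma integral times the same integral one size smaller. *)
Lemma integral_iw_kernelS n al b : 0 < b ->
  (\int[lebesgue_sym n.+1]_S (iw_kernel al b S)%:E =
   (((Num.sqrt pi / Num.sqrt b) ^+ n)%:E *
     \int[lebesgue_sym n]_S (iw_kernel (al - 1 / 2) b S)%:E) *
   \int[leb]_x (inv_gamma_kernel (al - n%:R) b x)%:E)%E.
Proof.
move=> b0; set K := (_ ^+ n); set J := (\int[lebesgue_sym n]_S _)%E.
have K0 : 0 <= K by rewrite exprn_ge0// divr_ge0// sqrtr_ge0.
have J0 : (0 <= J)%E by apply: integral_ge0 => M _; rewrite lee_fin iw_kernel_ge0.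
rewrite integral_lebesgue_symS; last 2 first.
- by apply/measurable_EFinP; exact: measurable_iw_kernel.
- by move=> S; rewrite lee_fin iw_kernel_ge0.
have mB x := @measurable_iw_block_kernel n al b x.
rewrite -ge0_integralZl//; last 3 first.
- by apply/measurable_EFinP; exact: measurable_inv_gamma_kernel.
- by move=> x _; rewrite lee_fin inv_gamma_kernel_ge0.
- by rewrite mule_ge0.
apply: eq_integral => x _.
have [x0|x0] := ltP 0 x; last first.
  rewrite [in RHS]/inv_gamma_kernel ltNge x0 mule0; apply: integral0_eq => v _.
  apply: integral0_eq => M _; rewrite iw_kernel_sym_cons /inv_gamma_kernel.
  by rewrite ltNge x0 mul0r.
(* For fixed [x] and [v], passing from the lower block to the Schur complement is a symmetric
   translation, of Jacobian [1]. *)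
transitivity (\int[lebesgue_rV n]_v ((inv_gamma_kernel al b x)%:E *
    \int[lebesgue_sym n]_M (iw_block_kernel al b x v M)%:E))%E.
  apply: eq_integral => v _; under eq_integral do rewrite iw_kernel_sym_cons.
  have mBv : measurable_fun setT (fun M => iw_block_kernel al b x v M).
    exact: (measurableT_comp (mB x) (measurable_pair1 v)).
  rewrite integral_scale; last 3 first.
  - exact: inv_gamma_kernel_ge0.
  - exact: (measurableT_comp mBv (measurable_translate _)).
  - by move=> M; exact: iw_block_kernel_ge0.
  have [_ H] := lebesgue_sym_translation (schur_shift_sym x v).
  have mBvE : measurable_fun setT (fun M => (iw_block_kernel al b x v M)%:E).
    exact/measurable_EFinP.
  have Bv0 M : (0 <= (iw_block_kernel al b x v M)%:E)%E.
    by rewrite lee_fin iw_block_kernel_ge0.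
  have E := H _ mBvE Bv0; rewrite mul1e in E.
  exact: (congr1 (fun z => ((inv_gamma_kernel al b x)%:E * z)%E) (esym E)).
rewrite ge0_integralZl_EFin ?inv_gamma_kernel_ge0//; last 2 first.
- by move=> v _; apply: integral_ge0 => M _; rewrite lee_fin iw_block_kernel_ge0.
- apply: (measurable_fun_fubini_tonelli_F (m2 := lebesgue_sym n)
    (fun t : 'rV[R]_n * 'M[R]_n => (iw_block_kernel al b x t.1 t.2)%:E)).
    exact/measurable_EFinP.
  by move=> t; rewrite lee_fin iw_block_kernel_ge0.
(* The row is integrated first, at a fixed Schur complement. *)
rewrite (fubini_tonelli
    (fun t : 'rV[R]_n * 'M[R]_n => (iw_block_kernel al b x t.1 t.2)%:E))/=; last 2 first.
- exact/measurable_EFinP.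
- by move=> t; rewrite lee_fin iw_block_kernel_ge0.
under eq_integral do rewrite integral_iw_block_kernel// mulrC EFinM.
rewrite ge0_integralZl_EFin//; last 3 first.
- by move=> M _; rewrite lee_fin iw_kernel_ge0.
- by apply/measurable_EFinP; exact: measurable_iw_kernel.
- by rewrite mulr_ge0// exprn_ge0// ltW.
rewrite -/J -/K muleA -EFinM muleC [in RHS]muleAC muleC -EFinM; congr (_ * _)%E.
congr EFin; rewrite /inv_gamma_kernel x0 opprB powRD; last by rewrite (gt_eqF x0) implybT.
by rewrite powR_mulrn ?(ltW x0)//; ring.
Qed.

(** At size [n.+1] the threshold gives the pivot exponent [al - n >= 3 / 2], and [al - 1 / 2] still
    satisfies the threshold at size [n]. *)
Lemma integral_iw_kernel n al b : 0 < b -> n%:R + 1 / 2 <= al ->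
  (0 < \int[lebesgue_sym n]_S (iw_kernel al b S)%:E < +oo)%E.
Proof.
move=> b0; elim: n al => [|n IH] al al0.
  have spd0 : spd (0 : 'M[R]_0).
    by split=> [|x]; [rewrite trmx0|rewrite [x]flatmx0 eqxx].
  rewrite integral_lebesgue_sym0; last by apply/measurable_EFinP; exact: measurable_iw_kernel.
  rewrite /iw_kernel asboolT// det_mx00 powR1 mul1r ltry andbT lte_fin.
  exact: expR_gt0.
have al1 : n%:R + 1 / 2 <= al - 1 / 2 by rewrite -natr1 in al0; lra.
have al2 : 3 / 2 <= al - n%:R by rewrite -natr1 in al0; lra.
have /andP[I0 Ioo] := IH _ al1.
have J0 := integral_inv_gamma_gt0 (al - n%:R) b.
have Joo := integral_inv_gamma_lty b0 al2.
have K0 : 0 < (Num.sqrt pi / Num.sqrt b) ^+ n.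
  by rewrite exprn_gt0// divr_gt0// sqrtr_gt0// pi_gt0.
rewrite integral_iw_kernelS//; apply/andP; split.
  by rewrite !mule_gt0.
have If : (\int[lebesgue_sym n]_S (iw_kernel (al - 1 / 2) b S)%:E)%E \is a fin_num.
  by rewrite ge0_fin_numE// ltW.
have Jf : (\int[leb]_x (inv_gamma_kernel (al - n%:R) b x)%:E)%E \is a fin_num.
  by rewrite ge0_fin_numE// ltW.
by rewrite -(fineK If) -(fineK Jf) -!EFinM ltry.
Qed.

End inverse_wishart_integral.

(** * Uniform ergodicity of three-block Gibbs samplers *)

Section monotone_integral.
Local Open Scope ereal_scope.
Context d (T : measurableType d) (R : realType) (m : {measure set T -> \bar R}).

(** Monotonicity read off the definition as a supremum over simple functions, convenient for nested
    integrals. *)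
Lemma le_integral_nonneg (f1 f2 : T -> \bar R) : (forall x, 0 <= f1 x) ->
  (forall x, f1 x <= f2 x) -> \int[m]_x f1 x <= \int[m]_x f2 x.
Proof.
move=> f10 f12; have f20 x : 0 <= f2 x by exact: le_trans (f10 x) (f12 x).
rewrite !ge0_integralTE//; apply: le_ereal_sup => _ [k kf <-].
by exists k => // x; exact: le_trans (kf x) (f12 x).
Qed.

End monotone_integral.

Section normalized_densities.
Context d (T : measurableType d) (R : realType) (m : {measure set T -> \bar R}).

(** Cancels the factors of the joint density that involve only the conditioning blocks. *)
Lemma normalize_densityZ (c : R) (F : T -> R) x : 0 < c ->
  measurable_fun setT F -> (forall x, 0 <= F x) ->
  normalize_density m (fun x => c * F x) x = normalize_density m F x.
Proof.
move=> c0 mF F0; rewrite /normalize_density integral_scale ?(ltW c0)//.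
(* [fine] sends [+oo] to [0], so both sides are then [0]. *)
have [I0|Ioo] := eqVneq (\int[m]_z (F z)%:E)%E +oo%E.
  by rewrite I0 mulry gtr0_sg// mul1e/= !invr0 !mulr0.
have If : (\int[m]_z (F z)%:E \is a fin_num)%E.
  by rewrite ge0_fin_numE ?ltey// integral_ge0// => z _; rewrite lee_fin.
by rewrite fineM// invfM mulrACA divff ?gt_eqF// mul1r.
Qed.

(** Enlarging the normalizing constant gives a lower bound whose denominator is free of the
    conditioning blocks. *)
Lemma normalize_density_ge (F F0 : T -> R) x :
  measurable_fun setT F -> measurable_fun setT F0 ->
  (forall x, 0 <= F x) -> (forall x, F x <= F0 x) ->
  (0 < \int[m]_z (F z)%:E)%E -> (\int[m]_z (F0 z)%:E < +oo)%E ->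
  F x / fine (\int[m]_z (F0 z)%:E) <= normalize_density m F x.
Proof.
move=> mF mF0 Fge0 FF0 I0 Ioo; rewrite /normalize_density ler_wpM2l//.
have le : (\int[m]_z (F z)%:E <= \int[m]_z (F0 z)%:E)%E.
  apply: ge0_le_integral => //.
  - by move=> z _; rewrite lee_fin.
  - exact/measurable_EFinP.
  - exact/measurable_EFinP.
  - by move=> z _; rewrite lee_fin.
have F0f : (\int[m]_z (F0 z)%:E \is a fin_num)%E.
  by rewrite ge0_fin_numE// (le_trans _ le)// ltW.
have Ff : (\int[m]_z (F z)%:E \is a fin_num)%E.
  by rewrite ge0_fin_numE ?(ltW I0)// (le_lt_trans le).
have pF : 0 < fine (\int[m]_z (F z)%:E)%E by rewrite -lte_fin fineK.
have leF : fine (\int[m]_z (F z)%:E)%E <= fine (\int[m]_z (F0 z)%:E)%E.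
  by rewrite -lee_fin !fineK.
by rewrite lef_pV2 ?posrE// (lt_le_trans pF).
Qed.

Lemma measurable_le_indicator (G : T -> R) (t : R) : measurable_fun setT G ->
  measurable_fun setT (fun z => (G z <= t)%R%:R : R).
Proof.
move=> mG.
have -> : (fun z => (G z <= t)%R%:R : R) = \1_[set z | (G z <= t)%R].
  apply/funext => z; rewrite indicE.
  have -> // : (z \in [set z | (G z <= t)%R]) = (G z <= t).
  by apply/idP/idP => [|?]; [rewrite inE|rewrite mem_set].
apply: measurable_indic; have := mG measurableT `]-oo, t]%classic (measurable_itv _).
by rewrite setTI; congr measurable; apply/seteqP; split => z /=; rewrite in_itv.
Qed.

(* Markov's inequality applied to exp(eps G), under the law with density
   proportional to F. *)
Lemma normalize_density_tail (F G : T -> R) (eps C : R) :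
  measurable_fun setT F -> measurable_fun setT G ->
  (forall x, 0 <= F x) -> 0 < eps ->
  (0 < \int[m]_z (F z)%:E)%E -> (\int[m]_z (F z)%:E < +oo)%E ->
  (\int[m]_z (F z * expR (eps * G z))%:E <= C%:E * \int[m]_z (F z)%:E)%E ->
  ((1 / 2)%:E <= \int[m]_z (normalize_density m F z *
     (G z <= 2 * C / eps)%R%:R)%:E)%E.
Proof.
move=> mF mG F0 e0 I0 Ioo tail; pose t := 2 * C / eps.
have Ff : (\int[m]_z (F z)%:E \is a fin_num)%E by rewrite ge0_fin_numE// ltW.
pose I := fine (\int[m]_z (F z)%:E)%E.
have pI : 0 < I by rewrite -lte_fin /I fineK.
have mind : measurable_fun setT (fun z => (G z <= t)%R%:R : R).
  exact: measurable_le_indicator.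
have mFt : measurable_fun setT (fun z => F z * (G z <= t)%R%:R).
  exact: measurable_funM.
have Ft0 z : 0 <= F z * (G z <= t)%R%:R by rewrite mulr_ge0.
have mFe : measurable_fun setT (fun z => F z * expR (eps * G z)).
  by apply: measurable_funM => //; apply: measurableT_comp => //; exact: measurable_funM.
have Fe0 z : 0 <= F z * expR (eps * G z) by rewrite mulr_ge0// expR_ge0.
(* A nonpositive [C] contradicts [tail], whose left-hand side is positive. *)
have [C0|C0] := leP C 0.
  have : (0 < \int[m]_z (F z * expR (eps * G z))%:E)%E.
    apply: (integral_gt0_support (f := fun z => (F z)%:E)) => //.
    - exact/measurable_EFinP.
    - exact/measurable_EFinP.
    - by move=> z; rewrite !lte_fin => Fz; rewrite mulr_gt0// expR_gt0.
  move=> /lt_le_trans/(_ tail); rewrite -(fineK Ff) -/I -EFinM lte_fin.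
  by rewrite pmulr_lgt0// ltNge C0.
pose J := fine (\int[m]_z (F z * (G z <= t)%R%:R)%:E)%E.
have Jle : (\int[m]_z (F z * (G z <= t)%R%:R)%:E <= \int[m]_z (F z)%:E)%E.
  apply: ge0_le_integral => //.
  - by move=> z _; rewrite lee_fin.
  - exact/measurable_EFinP.
  - exact/measurable_EFinP.
  - by move=> z _; rewrite lee_fin ler_piMr//; case: (G z <= t); rewrite ?lexx ?ler01.
have Jf : (\int[m]_z (F z * (G z <= t)%R%:R)%:E \is a fin_num)%E.
  rewrite ge0_fin_numE; first exact: le_lt_trans Jle Ioo.
  by apply: integral_ge0 => z _; rewrite lee_fin.
(* Where [G] exceeds [t], [expR (eps * G) >= eps * G >= 2 * C]; by [tail] the second term is then at
   most half of the total mass. *)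
have split_le : (\int[m]_z (F z)%:E <=
    \int[m]_z (F z * (G z <= t)%R%:R)%:E +
    (1 / (2 * C))%:E * \int[m]_z (F z * expR (eps * G z))%:E)%E.
  have c0 : 0 <= 1 / (2 * C) by rewrite divr_ge0// mulr_ge0// ltW.
  rewrite -integral_scale// -ge0_integralD//; last 4 first.
  - by move=> z _; rewrite lee_fin.
  - exact/measurable_EFinP.
  - by move=> z _; rewrite lee_fin mulr_ge0.
  - by apply/measurable_EFinP; exact: measurable_funM.
  apply: ge0_le_integral => //.
  - by move=> z _; rewrite lee_fin.
  - exact/measurable_EFinP.
  - by apply: emeasurable_funD; apply/measurable_EFinP => //; exact: measurable_funM.
  move=> z _; rewrite -EFinD lee_fin.
  have [Gt|Gt] := leP (G z) t.
    by rewrite mulr1 lerDl mulr_ge0.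
  rewrite mulr0 add0r mulrCA -{1}[F z]mulr1 ler_wpM2l// mul1r.
  rewrite ler_pdivlMl ?mulr_gt0// mulr1.
  apply: (@le_trans _ _ (eps * G z)); first by rewrite -ler_pdivrMl// mulrC ltW.
  by apply: le_trans (expR_ge1Dx _); rewrite lerDr.
have half : I <= J + I / 2.
  rewrite -lee_fin EFinD /J /I !fineK//; apply: le_trans split_le _.
  rewrite leeD2l//; apply: (@le_trans _ _ ((1 / (2 * C))%:E * (C%:E * I%:E))%E).
    rewrite lee_wpmul2l ?lee_fin ?divr_ge0 ?mulr_ge0 ?(ltW C0)//.
    by rewrite /I fineK.
  rewrite -!EFinM lee_fin; have E (a b : R) : 0 < a -> 1 / (2 * a) * (a * b) = b / 2.
    by move=> a0; field; rewrite gt_eqF.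
  by rewrite E.
have -> : (\int[m]_z (normalize_density m F z * (G z <= t)%R%:R)%:E)%E = (I^-1 * J)%:E.
  rewrite EFinM /J fineK// -integral_scale ?invr_ge0 ?(ltW pI)//.
  by apply: eq_integral => z _; congr EFin; rewrite /normalize_density -/I; ring.
by rewrite lee_fin ler_pdivlMl//; lra.
Qed.

End normalized_densities.

Section uniform_gibbs3.
Context d1 d2 d3 d (X1 : measurableType d1) (X2 : measurableType d2)
  (X3 : measurableType d3) (T : measurableType d) (R : realType).
Variables (m1 : {sigma_finite_measure set X1 -> \bar R})
  (m2 : {sigma_finite_measure set X2 -> \bar R})
  (m3 : {sigma_finite_measure set X3 -> \bar R})
  (m : {sigma_finite_measure set T -> \bar R}).
Variables (p1 : T -> X1) (p2 : T -> X2) (p3 : T -> X3)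
  (mk : X1 -> X2 -> X3 -> T).
Hypotheses (mp1 : measurable_fun setT p1) (mp2 : measurable_fun setT p2)
  (mp3 : measurable_fun setT p3).
Hypothesis mmk :
  measurable_fun setT (fun t : X1 * X2 * X3 => mk t.1.1 t.1.2 t.2).
Hypotheses (mk1 : forall x y z, p1 (mk x y z) = x)
  (mk2 : forall x y z, p2 (mk x y z) = y)
  (mk3 : forall x y z, p3 (mk x y z) = z)
  (mkp : forall t, mk (p1 t) (p2 t) (p3 t) = t).
Hypothesis integral_mk : forall F : T -> \bar R, measurable_fun setT F ->
  (forall t, (0 <= F t)%E) ->
  (\int[m]_t F t = \int[m1]_x \int[m2]_y \int[m3]_z F (mk x y z))%E.

(** One factor per block and a coupling [h]. As [h] is nonnegative, dropping it only enlarges the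
    normalizing constants, which makes them independent of the conditioning blocks. *)
Variables (psi : X1 -> R) (phi : X2 -> R) (g : X3 -> R)
  (h : X1 -> X2 -> X3 -> R) (f : T -> R).
Hypotheses (mpsi : measurable_fun setT psi) (mphi : measurable_fun setT phi)
  (mg : measurable_fun setT g)
  (mh : measurable_fun setT (fun t : X1 * X2 * X3 => h t.1.1 t.1.2 t.2)).
Hypotheses (psi0 : forall x, 0 < psi x) (phi0 : forall y, 0 < phi y)
  (g0 : forall z, 0 <= g z) (h0 : forall x y z, 0 <= h x y z).
Let e x y z := expR (- (h x y z / 2)).
Hypothesis fE : forall x y z, f (mk x y z) = g z * e x y z * phi y * psi x.
Hypotheses (psi_int : (0 < \int[m1]_x (psi x)%:E < +oo)%E)
  (phi_int : (0 < \int[m2]_y (phi y)%:E < +oo)%E)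
  (g_int : (0 < \int[m3]_z (g z)%:E < +oo)%E).

(** Gauges of the size of the blocks. The moment bounds on the second and third blocks concern their
    full conditionals, uniformly in the conditioning; for the first block, drawn last, a bound under
    [psi] alone suffices. *)
Variables (n1 : X1 -> R) (n2 : X2 -> R) (l : X3 -> R) (K : R).
Hypotheses (mn1 : measurable_fun setT n1) (mn2 : measurable_fun setT n2)
  (ml : measurable_fun setT l).
Hypotheses (n1_ge0 : forall x, 0 <= n1 x) (n2_ge0 : forall y, 0 <= n2 y)
  (l_ge0 : forall z, 0 <= l z) (K_ge0 : 0 <= K).
Hypothesis h_le : forall x y z, h x y z <= l z * (K * (1 + n1 x) * n2 y).

Variables (eps1 eps2 eps3 C1 C2 C3 : R).
Hypotheses (eps1_gt0 : 0 < eps1) (eps2_gt0 : 0 < eps2) (eps3_gt0 : 0 < eps3).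
Hypothesis tail1 : (\int[m1]_x (psi x * expR (eps1 * n1 x))%:E <=
  C1%:E * \int[m1]_x (psi x)%:E)%E.
Hypothesis tail2 : forall x z, 0 < g z ->
  (\int[m2]_y (e x y z * phi y * expR (eps2 * n2 y))%:E <=
  C2%:E * \int[m2]_y (e x y z * phi y)%:E)%E.
Hypothesis tail3 : forall x y,
  (\int[m3]_z (g z * e x y z * expR (eps3 * l z))%:E <=
  C3%:E * \int[m3]_z (g z * e x y z)%:E)%E.

Let e_gt0 x y z : 0 < e x y z. Proof. exact: expR_gt0. Qed.
Let e_le1 x y z : e x y z <= 1.
Proof. by rewrite -expR0 ler_expR oppr_le0 divr_ge0. Qed.

Let me3 d' (Y : measurableType d') (g1 : Y -> X1) (g2 : Y -> X2)
    (g3 : Y -> X3) : measurable_fun setT g1 -> measurable_fun setT g2 ->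
  measurable_fun setT g3 ->
  measurable_fun setT (fun y => e (g1 y) (g2 y) (g3 y)).
Proof.
move=> mg1 mg2 mg3; apply: measurableT_comp => //; apply: measurable_funN.
apply: measurable_funM => //.
have mgg : measurable_fun setT (fun y => (g1 y, g2 y, g3 y)).
  by apply: measurable_fun_pair => //; exact: measurable_fun_pair.
exact: (measurableT_comp mh mgg).
Qed.

Let me_1 y z : measurable_fun setT (fun x => e x y z).
Proof. by apply: me3 => //; exact: measurable_cst. Qed.
Let me_2 x z : measurable_fun setT (fun y => e x y z).
Proof. by apply: me3 => //; exact: measurable_cst. Qed.
Let me_3 x y : measurable_fun setT (fun z => e x y z).
Proof. by apply: me3 => //; exact: measurable_cst. Qed.

Let fpE t : f t = g (p3 t) * e (p1 t) (p2 t) (p3 t) * phi (p2 t) * psi (p1 t).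
Proof. by rewrite -{1}(mkp t) fE. Qed.

Let mf : measurable_fun setT f.
Proof.
have -> : f = (fun t => g (p3 t) * e (p1 t) (p2 t) (p3 t) * phi (p2 t) * psi (p1 t)).
  by apply/funext => t; exact: fpE.
do 3 (apply: measurable_funM; last exact: measurableT_comp||exact: me3).
exact: measurableT_comp.
Qed.

Let f0 t : 0 <= f t.
Proof. by rewrite fpE !mulr_ge0// ltW. Qed.

(** The full conditionals up to factors that depend on the conditioning blocks only. *)
Let q3 x y z := g z * e x y z.
Let q2 x z y := e x y z * phi y.
Let q1 y z x := psi x * e x y z.

Let mq3 x y : measurable_fun setT (q3 x y).
Proof. exact: measurable_funM. Qed.
Let mq2 x z : measurable_fun setT (q2 x z).
Proof. exact: measurable_funM. Qed.
Let mq1 y z : measurable_fun setT (q1 y z).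
Proof. exact: measurable_funM. Qed.
Let q3_ge0 x y z : 0 <= q3 x y z. Proof. by rewrite mulr_ge0// ltW. Qed.
Let q2_gt0 x z y : 0 < q2 x z y. Proof. by rewrite mulr_gt0. Qed.
Let q1_gt0 y z x : 0 < q1 y z x. Proof. by rewrite mulr_gt0. Qed.
Let q3_le x y z : q3 x y z <= g z. Proof. by rewrite ler_piMr. Qed.
Let q2_le x z y : q2 x z y <= phi y. Proof. by rewrite ler_piMl// ltW. Qed.
Let q1_le y z x : q1 y z x <= psi x. Proof. by rewrite ler_piMr// ltW. Qed.

Let q3_int x y : (0 < \int[m3]_z (q3 x y z)%:E < +oo)%E.
Proof.
have /andP[gp goo] := g_int; apply/andP; split.
  apply: (integral_gt0_support (f := fun z => (g z)%:E)) gp.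
  - exact/measurable_EFinP.
  - exact/measurable_EFinP.
  - by move=> z; rewrite lee_fin.
  - by move=> z; rewrite lee_fin.
  - by move=> z; rewrite !lte_fin => gz; rewrite mulr_gt0.
apply: le_lt_trans goo; apply: ge0_le_integral => //.
- by move=> z _; rewrite lee_fin.
- exact/measurable_EFinP.
- exact/measurable_EFinP.
- by move=> z _; rewrite lee_fin.
Qed.

Let q2_int x z : (0 < \int[m2]_y (q2 x z y)%:E < +oo)%E.
Proof.
have /andP[gp goo] := phi_int; apply/andP; split.
  apply: (integral_gt0_support (f := fun y => (phi y)%:E)) gp.
  - exact/measurable_EFinP.
  - exact/measurable_EFinP.
  - by move=> y; rewrite lee_fin ltW.
  - by move=> y; rewrite lee_fin ltW.
  - by move=> y _; rewrite lte_fin.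
apply: le_lt_trans goo; apply: ge0_le_integral => //.
- by move=> y _; rewrite lee_fin ltW.
- exact/measurable_EFinP.
- exact/measurable_EFinP.
- by move=> y _; rewrite lee_fin.
Qed.

Let q1_int y z : (0 < \int[m1]_x (q1 y z x)%:E < +oo)%E.
Proof.
have /andP[gp goo] := psi_int; apply/andP; split.
  apply: (integral_gt0_support (f := fun x => (psi x)%:E)) gp.
  - exact/measurable_EFinP.
  - exact/measurable_EFinP.
  - by move=> x; rewrite lee_fin ltW.
  - by move=> x; rewrite lee_fin ltW.
  - by move=> x _; rewrite lte_fin.
apply: le_lt_trans goo; apply: ge0_le_integral => //.
- by move=> x _; rewrite lee_fin ltW.
- exact/measurable_EFinP.
- exact/measurable_EFinP.
- by move=> x _; rewrite lee_fin.
Qed.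

Let f3E x y z : f (mk x y z) = (phi y * psi x) * q3 x y z.
Proof. by rewrite fE /q3; ring. Qed.
Let f2E x y z : f (mk x y z) = (g z * psi x) * q2 x z y.
Proof. by rewrite fE /q2; ring. Qed.
Let f1E x y z : f (mk x y z) = (g z * phi y) * q1 y z x.
Proof. by rewrite fE /q1; ring. Qed.

Let N3E x y : (\int[m3]_z (f (mk x y z))%:E =
  (phi y * psi x)%:E * \int[m3]_z (q3 x y z)%:E)%E.
Proof.
under eq_integral do rewrite f3E.
by apply: integral_scale => //; rewrite mulr_ge0// ltW.
Qed.
Let N2E x z : (\int[m2]_y (f (mk x y z))%:E =
  (g z * psi x)%:E * \int[m2]_y (q2 x z y)%:E)%E.
Proof.
under eq_integral do rewrite f2E.
by apply: integral_scale => //; [rewrite mulr_ge0// ltW|move=> y; exact: ltW].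
Qed.
Let N1E y z : (\int[m1]_x (f (mk x y z))%:E =
  (g z * phi y)%:E * \int[m1]_x (q1 y z x)%:E)%E.
Proof.
under eq_integral do rewrite f1E.
by apply: integral_scale => //; [rewrite mulr_ge0// ltW|move=> x; exact: ltW].
Qed.

Let positive_finite_real (A : \bar R) : (0 < A < +oo)%E -> exists2 r : R, 0 < r & A = r%:E.
Proof.
move=> A0oo; exists (fine A); first exact: fine_gt0.
by case/andP: A0oo => A0 Aoo; rewrite fineK// ge0_fin_numE// ltW.
Qed.

Let N3_gt0 x y : (0 < \int[m3]_z (f (mk x y z))%:E)%E.
Proof.
rewrite N3E; have [r r0 ->] := positive_finite_real (q3_int x y).
by rewrite -EFinM lte_fin !mulr_gt0.
Qed.
Let N3_lty x y : (\int[m3]_z (f (mk x y z))%:E < +oo)%E.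
Proof.
by rewrite N3E; have [r r0 ->] := positive_finite_real (q3_int x y); rewrite -EFinM ltry.
Qed.
Let N2_lty x z : (\int[m2]_y (f (mk x y z))%:E < +oo)%E.
Proof.
by rewrite N2E; have [r r0 ->] := positive_finite_real (q2_int x z); rewrite -EFinM ltry.
Qed.
Let N1_lty y z : (\int[m1]_x (f (mk x y z))%:E < +oo)%E.
Proof.
by rewrite N1E; have [r r0 ->] := positive_finite_real (q1_int y z); rewrite -EFinM ltry.
Qed.
Let N2_eq0 x y z : (\int[m2]_y (f (mk x y z))%:E = 0)%E -> f (mk x y z) = 0.
Proof.
rewrite N2E; have [r r0 ->] := positive_finite_real (q2_int x z).
rewrite -EFinM => -[/eqP]; rewrite f2E !mulf_eq0 (gt_eqF r0) (gt_eqF (psi0 x)).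
by rewrite !orbF => /eqP ->; rewrite !mul0r.
Qed.
Let N1_eq0 x y z : (\int[m1]_x (f (mk x y z))%:E = 0)%E -> f (mk x y z) = 0.
Proof.
rewrite N1E; have [r r0 ->] := positive_finite_real (q1_int y z).
rewrite -EFinM => -[/eqP]; rewrite f1E !mulf_eq0 (gt_eqF r0) (gt_eqF (phi0 y)).
by rewrite !orbF => /eqP ->; rewrite !mul0r.
Qed.

Let mfmk : measurable_fun setT
  (fun t : X1 * X2 * X3 => (f (mk t.1.1 t.1.2 t.2))%:E).
Proof. by apply/measurable_EFinP; exact: (measurableT_comp mf mmk). Qed.

Let Z_gt0 : (0 < \int[m]_t (f t)%:E)%E.
Proof.
have fge0 x y z : (0 <= (f (mk x y z))%:E)%E by rewrite lee_fin.
have mN3 := measurable_integral3 m3 (F := fun x y z => (f (mk x y z))%:E) fge0 mfmk.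
rewrite integral_mk; last 2 first.
- exact/measurable_EFinP.
- by move=> t; rewrite lee_fin.
have /andP[psip _] := psi_int; have /andP[phip _] := phi_int.
have inner x : (0 < \int[m2]_y \int[m3]_z (f (mk x y z))%:E)%E.
  apply: (integral_gt0_support (f := fun y => (phi y)%:E)) phip.
  - exact/measurable_EFinP.
  - exact: (measurableT_comp mN3 (measurable_pair1 x)).
  - by move=> y; rewrite lee_fin ltW.
  - by move=> y; rewrite ltW.
  - by move=> y _; exact: N3_gt0.
apply: (integral_gt0_support (f := fun x => (psi x)%:E)) psip.
- exact/measurable_EFinP.
- apply: (measurable_fun_fubini_tonelli_F (m2 := m2)
    (fun t : X1 * X2 => \int[m3]_z (f (mk t.1 t.2 z))%:E)%E) => //.
  by move=> t; rewrite ltW.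
- by move=> x; rewrite lee_fin ltW.
- by move=> x; rewrite ltW.
- by move=> x _; exact: inner.
Qed.

Let Z_lty : (\int[m]_t (f t)%:E < +oo)%E.
Proof.
rewrite integral_mk; last 2 first.
- exact/measurable_EFinP.
- by move=> t; rewrite lee_fin.
have [G G0 GE] := positive_finite_real g_int.
have [F F0 FE] := positive_finite_real phi_int.
have [H H0 HE] := positive_finite_real psi_int.
apply: (@le_lt_trans _ _ (\int[m1]_x (G * F * psi x)%:E)%E); last first.
  rewrite integral_scale ?HE ?mulr_ge0 ?(ltW G0) ?(ltW F0)// -?EFinM ?ltry//.
  by move=> x; exact: ltW.
apply: le_integral_nonneg => x.
  by apply: integral_ge0 => y _; apply: integral_ge0 => z _; rewrite lee_fin.
apply: (@le_trans _ _ (\int[m2]_y (G * psi x * phi y)%:E)%E); last first.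
  rewrite integral_scale ?FE ?mulr_ge0 ?(ltW G0) ?(ltW (psi0 x))//.
    by rewrite -EFinM lee_fin le_eqVlt; apply/orP; left; apply/eqP; ring.
  by move=> y; exact: ltW.
apply: le_integral_nonneg => y.
  by apply: integral_ge0 => z _; rewrite lee_fin.
rewrite N3E; have -> : ((G * psi x * phi y)%:E = (phi y * psi x)%:E * G%:E)%E.
  by rewrite -EFinM; congr EFin; ring.
rewrite lee_wpmul2l ?lee_fin ?mulr_ge0 ?(ltW (phi0 y)) ?(ltW (psi0 x))//.
by rewrite -GE; apply: le_integral_nonneg => z; rewrite lee_fin.
Qed.

Let c3 x y z := normalize_density m3 (fun z => f (mk x y z)) z.
Let c2 x z y := normalize_density m2 (fun y => f (mk x y z)) y.
Let c1 y z x := normalize_density m1 (fun x => f (mk x y z)) x.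

Let c3E x y z : c3 x y z = normalize_density m3 (q3 x y) z.
Proof.
rewrite /c3; have -> : (fun z => f (mk x y z)) = (fun z => (phi y * psi x) * q3 x y z).
  by apply/funext => ?; exact: f3E.
by apply: normalize_densityZ => //; rewrite mulr_gt0.
Qed.

Let c2E x z y : 0 < g z -> c2 x z y = normalize_density m2 (q2 x z) y.
Proof.
move=> gz; rewrite /c2.
have -> : (fun y => f (mk x y z)) = (fun y => (g z * psi x) * q2 x z y).
  by apply/funext => ?; exact: f2E.
by apply: normalize_densityZ => //; [rewrite mulr_gt0|move=> ?; exact: ltW].
Qed.

Let c1E y z x : 0 < g z -> c1 y z x = normalize_density m1 (q1 y z) x.
Proof.
move=> gz; rewrite /c1.
have -> : (fun x => f (mk x y z)) = (fun x => (g z * phi y) * q1 y z x).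
  by apply/funext => ?; exact: f1E.
by apply: normalize_densityZ => //; [rewrite mulr_gt0|move=> ?; exact: ltW].
Qed.

Let c3_ge0 x y z : 0 <= c3 x y z. Proof. exact: normalize_density_ge0. Qed.
Let c2_ge0 x z y : 0 <= c2 x z y. Proof. exact: normalize_density_ge0. Qed.
Let c1_ge0 y z x : 0 <= c1 y z x. Proof. exact: normalize_density_ge0. Qed.

Let Gi := fine (\int[m3]_z (g z)%:E)%E.
Let Fi := fine (\int[m2]_y (phi y)%:E)%E.
Let Hi := fine (\int[m1]_x (psi x)%:E)%E.
Let Gi_gt0 : 0 < Gi. Proof. exact: fine_gt0. Qed.
Let Fi_gt0 : 0 < Fi. Proof. exact: fine_gt0. Qed.
Let Hi_gt0 : 0 < Hi. Proof. exact: fine_gt0. Qed.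

Let c3_ge x y z : q3 x y z / Gi <= c3 x y z.
Proof.
rewrite c3E; apply: normalize_density_ge => //.
  by case/andP: (q3_int x y).
by case/andP: g_int.
Qed.

Let c2_ge x z y : 0 < g z -> q2 x z y / Fi <= c2 x z y.
Proof.
move=> gz; rewrite c2E//; apply: normalize_density_ge => //.
- by move=> ?; exact: ltW.
- by case/andP: (q2_int x z).
- by case/andP: phi_int.
Qed.

Let c1_ge y z x : 0 < g z -> q1 y z x / Hi <= c1 y z x.
Proof.
move=> gz; rewrite c1E//; apply: normalize_density_ge => //.
- by move=> ?; exact: ltW.
- by case/andP: (q1_int y z).
- by case/andP: psi_int.
Qed.

Let c3_gt0 x y z : c3 x y z != 0 -> 0 < g z.
Proof.
rewrite lt_neqAle g0 andbT; apply: contra => /eqP gz.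
by rewrite c3E /normalize_density /q3 -gz !mul0r.
Qed.

(** The thresholds of [normalize_density_tail], each keeping at least half of the mass; [kappa]
    bounds the coupling factor from below when all three gauges are within them. *)
Let t1 := 2 * C1 / eps1.
Let t2 := 2 * C2 / eps2.
Let t3 := 2 * C3 / eps3.
Let kappa := expR (- (t3 * (K * (1 + t1) * t2) / 2)).

(** [a] and [b] stay free: they are the thresholds in [kappa], but the gauges of the point itself in
    the minorizing density [q]. *)
Let e_ge x y z a b : n1 x <= t1 -> n2 y <= b -> l z <= a ->
  expR (- (a * (K * (1 + t1) * b) / 2)) <= e x y z.
Proof.
move=> nx ny lz; rewrite ler_expR lerN2 ler_pM2r ?invr_gt0//.
apply: le_trans (h_le x y z) _.
have n1x := n1_ge0 x; have n2y := n2_ge0 y; have lz0 := l_ge0 z.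
apply: ler_pM => //; first by rewrite !mulr_ge0// addr_ge0.
apply: ler_pM => //; first by rewrite mulr_ge0// addr_ge0.
by apply: ler_pM => //; [rewrite addr_ge0|rewrite lerD2l].
Qed.

(** The third block is unrestricted, since the next step redraws it without reading it. *)
Let small_set : set T := [set t | n1 (p1 t) <= t1 /\ n2 (p2 t) <= t2].

Let msmall : measurable small_set.
Proof.
apply: measurableI.
  have := measurableT_comp mn1 mp1; move=> /(_ measurableT `]-oo, t1]%classic).
  by rewrite setTI => /(_ (measurable_itv _)); congr measurable;
    apply/seteqP; split => t /=; rewrite in_itv.
have := measurableT_comp mn2 mp2; move=> /(_ measurableT `]-oo, t2]%classic).
by rewrite setTI => /(_ (measurable_itv _)); congr measurable;
  apply/seteqP; split => t /=; rewrite in_itv.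
Qed.

(** For such [y] and [z], wherever [n1 x <= t1] the conditional density of the first block is at
    least [kappa] times the normalized [psi], which gives that region mass at least one half. *)
Let mass1 y z : 0 < g z -> n2 y <= t2 -> l z <= t3 ->
  ((kappa * (1 / 2))%:E <=
   \int[m1]_x ((c1 y z x)%:E * (\1_small_set (mk x y z))%:E))%E.
Proof.
move=> gz ny lz.
have /andP[psip psioo] := psi_int.
have mnpsi : measurable_fun setT (fun x => normalize_density m1 psi x * (n1 x <= t1)%R%:R).
  apply: measurable_funM; last exact: measurable_le_indicator.
  by apply: measurable_funM => //; exact: measurable_cst.
have npsi0 x : 0 <= normalize_density m1 psi x.
  by apply: normalize_density_ge0 => ?; exact: ltW.
apply: (@le_trans _ _ (\int[m1]_x
    (kappa * (normalize_density m1 psi x * (n1 x <= t1)%R%:R))%:E)%E).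
  rewrite integral_scale ?expR_ge0//; last by move=> x; rewrite mulr_ge0.
  rewrite EFinM lee_wpmul2l ?lee_fin ?expR_ge0//.
  by apply: normalize_density_tail => // x; exact: ltW.
apply: le_integral_nonneg => x.
  by rewrite lee_fin mulr_ge0 ?expR_ge0// mulr_ge0.
rewrite -EFinM lee_fin indicE.
have [nx|nx] := leP (n1 x) t1; last by rewrite !mulr0 mulr_ge0.
rewrite mem_set ?mulr1; last by rewrite /small_set/= mk1 mk2.
apply: le_trans (c1_ge y x gz); rewrite /normalize_density -/Hi mulrA.
rewrite ler_wpM2r ?invr_ge0 ?(ltW Hi_gt0)// mulrC ler_wpM2l ?(ltW (psi0 x))//.
exact: e_ge.
Qed.

Let mass2 x z : 0 < g z -> l z <= t3 ->
  ((kappa * (1 / 2) * (1 / 2))%:E <= \int[m2]_y ((c2 x z y)%:E *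
   \int[m1]_x ((c1 y z x)%:E * (\1_small_set (mk x y z))%:E)))%E.
Proof.
move=> gz lz.
have k0 : 0 <= kappa * (1 / 2) by rewrite mulr_ge0 ?expR_ge0.
have mnq : measurable_fun setT
    (fun y => normalize_density m2 (q2 x z) y * (n2 y <= t2)%R%:R).
  apply: measurable_funM; last exact: measurable_le_indicator.
  by apply: measurable_funM => //; exact: measurable_cst.
have nq0 y : 0 <= normalize_density m2 (q2 x z) y.
  by apply: normalize_density_ge0 => ?; exact: ltW.
have /andP[qp qoo] := q2_int x z.
apply: (@le_trans _ _ (\int[m2]_y (kappa * (1 / 2) *
    (normalize_density m2 (q2 x z) y * (n2 y <= t2)%R%:R))%:E)%E).
  rewrite integral_scale//; last by move=> y; rewrite mulr_ge0.
  rewrite EFinM lee_wpmul2l ?lee_fin//.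
  by apply: normalize_density_tail => //; [move=> y; exact: ltW|exact: tail2].
apply: le_integral_nonneg => y; first by rewrite lee_fin mulr_ge0// mulr_ge0.
rewrite c2E//; have [ny|ny] := leP (n2 y) t2; last first.
  rewrite !mulr0 mule_ge0 ?lee_fin//; apply: integral_ge0 => x' _.
  by rewrite mule_ge0 ?lee_fin.
by rewrite mulr1 mulrC EFinM lee_wpmul2l ?lee_fin//; exact: mass1.
Qed.

(** Each of the three draws costs a factor one half and the coupling costs [kappa]; nothing is asked
    of the current state. *)
Let mass3 x y : ((kappa * (1 / 2) * (1 / 2) * (1 / 2))%:E <=
  \int[m3]_z ((c3 x y z)%:E * \int[m2]_y ((c2 x z y)%:E *
   \int[m1]_x ((c1 y z x)%:E * (\1_small_set (mk x y z))%:E))))%E.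
Proof.
have k0 : 0 <= kappa * (1 / 2) * (1 / 2) by rewrite !mulr_ge0 ?expR_ge0.
have mnq : measurable_fun setT
    (fun z => normalize_density m3 (q3 x y) z * (l z <= t3)%R%:R).
  apply: measurable_funM; last exact: measurable_le_indicator.
  by apply: measurable_funM => //; exact: measurable_cst.
have nq0 z : 0 <= normalize_density m3 (q3 x y) z by exact: normalize_density_ge0.
have /andP[qp qoo] := q3_int x y.
apply: (@le_trans _ _ (\int[m3]_z (kappa * (1 / 2) * (1 / 2) *
    (normalize_density m3 (q3 x y) z * (l z <= t3)%R%:R))%:E)%E).
  rewrite integral_scale//; last by move=> z; rewrite mulr_ge0.
  rewrite EFinM lee_wpmul2l ?lee_fin//.
  by apply: normalize_density_tail => //; exact: tail3.
apply: le_integral_nonneg => z; first by rewrite lee_fin mulr_ge0// mulr_ge0.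
have tail_ge0 : (0 <= \int[m2]_y ((c2 x z y)%:E *
   \int[m1]_x ((c1 y z x)%:E * (\1_small_set (mk x y z))%:E)))%E.
  apply: integral_ge0 => y' _; rewrite mule_ge0 ?lee_fin//.
  by apply: integral_ge0 => x' _; rewrite mule_ge0 ?lee_fin.
rewrite -c3E; have [lz|lz] := leP (l z) t3; last first.
  by rewrite !mulr0 mule_ge0 ?lee_fin.
(* [mass2] requires [0 < g z], which may fail only where [c3] vanishes. *)
have [c0|c0] := eqVneq (c3 x y z) 0; first by rewrite c0 mul0r mulr0 mul0e.
rewrite mulr1 mulrC EFinM lee_wpmul2l ?lee_fin//.
by apply: mass2 => //; exact: c3_gt0 c0.
Qed.

(* The transition density from [small_set] with the misfit bounded from above
   and the normalizing constants replaced by those without misfit. *)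
Let q (t : T) : R :=
  g (p3 t) * expR (- (l (p3 t) * (K * (1 + t1) * t2) / 2)) / Gi *
  (expR (- (l (p3 t) * (K * (1 + t1) * n2 (p2 t)) / 2)) * phi (p2 t) / Fi *
   (q1 (p2 t) (p3 t) (p1 t) / Hi)).

Let q_ge0 t : 0 <= q t.
Proof.
rewrite /q !mulr_ge0 ?invr_ge0 ?expR_ge0 ?(ltW Gi_gt0) ?(ltW Fi_gt0) ?(ltW Hi_gt0)//;
  exact: ltW.
Qed.

Let mq : measurable_fun setT q.
Proof.
have mpp d' (Y : measurableType d') (r : Y -> R) (p : T -> Y) :
    measurable_fun setT r -> measurable_fun setT p ->
    measurable_fun setT (fun t => r (p t)).
  by move=> mr mp; exact: (measurableT_comp mr mp).
apply: measurable_funM; last apply: measurable_funM.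
- apply: measurable_funM => //; apply: measurable_funM; first exact: mpp.
  apply: measurableT_comp => //; apply: measurable_funN; apply: measurable_funM => //.
  by apply: measurable_funM => //; exact: mpp.
- apply: measurable_funM => //; apply: measurable_funM; last exact: mpp.
  apply: measurableT_comp => //; apply: measurable_funN; apply: measurable_funM => //.
  by apply: measurable_funM; [exact: mpp|apply: measurable_funM => //; exact: mpp].
- apply: measurable_funM => //; apply: measurable_funM; first exact: mpp.
  exact: me3.
Qed.

(** The coupling is bounded differently in the three conditionals: in [c3] through the old, bounded,
    first and second blocks, in [c2] through the old first block and the new second one, and in
    [c1], which involves new blocks only, it is kept as it is. *)
Let q_le t t' : small_set t ->
  q t' <= gibbs3_density m1 m2 m3 p1 p2 p3 mk f (t, t').
Proof.
move=> [nx ny]; rewrite /gibbs3_density/= -/(c3 _ _ _) -/(c2 _ _ _) -/(c1 _ _ _).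
have [gz|gz] := ltP 0 (g (p3 t')); last first.
  have gz0 : g (p3 t') = 0 by apply/eqP; rewrite eq_le gz g0.
  by rewrite /q gz0 !mul0r mulr_ge0// mulr_ge0.
have A0 : 0 <= g (p3 t') * expR (- (l (p3 t') * (K * (1 + t1) * t2) / 2)) / Gi.
  by apply: divr_ge0; [rewrite mulr_ge0 ?expR_ge0|exact: ltW].
have B0 : 0 <= expR (- (l (p3 t') * (K * (1 + t1) * n2 (p2 t')) / 2)) * phi (p2 t') / Fi.
  by apply: divr_ge0; [apply: mulr_ge0; [exact: expR_ge0|exact: ltW]|exact: ltW].
have D0 : 0 <= q1 (p2 t') (p3 t') (p1 t') / Hi by apply: divr_ge0; exact: ltW.
apply: ler_pM => //; first exact: mulr_ge0.
  apply: le_trans (c3_ge _ _ _); rewrite ler_wpM2r ?invr_ge0 ?(ltW Gi_gt0)//.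
  by rewrite ler_wpM2l//; exact: e_ge.
apply: ler_pM => //; last exact: c1_ge.
apply: le_trans (c2_ge _ _ gz); rewrite ler_wpM2r ?invr_ge0 ?(ltW Fi_gt0)//.
by rewrite ler_wpM2r ?(ltW (phi0 _))//; exact: e_ge.
Qed.

Theorem uniform_gibbs3 : exists (Pi : probability T R) (P : R.-pker T ~> T),
  [/\ forall B, measurable B ->
        Pi B = (\int[m]_(t in B) (normalize_density m f t)%:E)%E,
      forall t B, measurable B ->
        P t B = (\int[m3]_z ((c3 (p1 t) (p2 t) z)%:E *
          \int[m2]_y ((c2 (p1 t) z y)%:E *
            \int[m1]_x ((c1 y z x)%:E * (\1_B (mk x y z))%:E))))%E &
      forall E, geometrically_ergodic E P Pi].
Proof.
have [Pi [P [PiE PE Pd inv]]] := gibbs3_sampler mp1 mp2 mp3 mmk mk1 mk2 mk3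
  integral_mk mf f0 N3_gt0 N3_lty N2_lty N2_eq0 N1_lty N1_eq0 Z_gt0 Z_lty.
exists Pi, P; split => // E.
have [Q QE] := density_measure m mq q_ge0.
apply: (@doeblin_geometrically_ergodic _ _ _ P Q small_set
  (kappa * (1 / 2) * (1 / 2) * (1 / 2))) => //.
- by rewrite !mulr_gt0// expR_gt0.
- by move=> s; rewrite PE//; exact: mass3.
- move=> z Cz B mB; rewrite QE Pd [leLHS]integral_mkcond [leRHS]integral_mkcond.
  apply: le_integral_nonneg => t; rewrite /patch; case: ifPn => _; rewrite ?lee_fin//.
  exact: q_le.
(* [q] is positive wherever [f] is, so its total mass is positive. *)
rewrite QE; apply: (integral_gt0_support (f := fun t => (f t)%:E)) Z_gt0.
- exact/measurable_EFinP.
- exact/measurable_EFinP.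
- by move=> t; rewrite lee_fin.
- by move=> t; rewrite lee_fin.
move=> t; rewrite !lte_fin fpE => ft.
have gt : 0 < g (p3 t).
  rewrite lt_neqAle g0 andbT; apply/eqP => gt.
  by move: ft; rewrite -gt !mul0r ltxx.
by rewrite /q !mulr_gt0 ?invr_gt0 ?expR_gt0.
Qed.

End uniform_gibbs3.

(** * The errors-in-variables posterior *)

Section quadratic_form_bounds.
Context {R : realType}.

Lemma spd_family_qform_ge d n (C : 'I_n -> 'M[R]_d) : (forall i, spd (C i)) ->
  exists2 c : R, 0 < c & forall i u, c * sqnorm u <= qform (C i) u.
Proof.
move=> spdC.
have H i : {b : R | 0 < b /\ forall u, b * sqnorm u <= qform (C i) u}.
  by apply: cid; have [b b0 bP] := spd_qform_ge (spdC i); exists b.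
pose b i := sval (H i).
have b0 i : 0 < b i by rewrite /b; case: (H i) => ? [].
have bP i u : b i * sqnorm u <= qform (C i) u by rewrite /b; case: (H i) => ? [].
have s0 : 0 <= \sum_i (b i)^-1 by apply: sumr_ge0 => i _; rewrite invr_ge0 ltW.
(* An explicit lower bound for all the [b i], positive also for an empty family. *)
exists (1 + \sum_i (b i)^-1)^-1 => [|i u]; first by rewrite invr_gt0 ltr_pwDl.
apply: le_trans (bP i u); rewrite ler_wpM2r ?sqnorm_ge0//.
rewrite -[leRHS]invrK lef_pV2 ?posrE ?invr_gt0 ?ltr_pwDl//.
rewrite (bigD1 i)//= addrCA lerDl addr_ge0// sumr_ge0// => j _.
by rewrite invr_ge0 ltW.
Qed.

(** The shift by [y] is absorbed by comparing the squared norms of [u] and [u - y], each at most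
    twice the other plus a constant; [K] collects the constants of both directions. *)
Lemma qform_sub_bounds d n (C : 'I_n -> 'M[R]_d) (y : 'I_n -> 'cV[R]_d) :
  (forall i, spd (C i)) ->
  exists c K : R, [/\ 0 < c, 0 <= K & forall u : 'I_n -> 'cV[R]_d,
    c * \sum_i sqnorm (u i) - K <= \sum_i qform (C i) (u i - y i) <=
    K * \sum_i sqnorm (u i) + K].
Proof.
move=> spdC; have [b b0 bP] := spd_family_qform_ge spdC.
pose S := \sum_i sqnorm (y i); pose t := \sum_i \tr (C i).
have S0 : 0 <= S by apply: sumr_ge0 => i _; exact: sqnorm_ge0.
have t0 : 0 <= t by apply: sumr_ge0 => i _; exact: spd_mxtrace_ge0.
exists (b / 2), (b * S + 2 * t + 2 * t * S); split.
- by rewrite divr_gt0.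
- by rewrite !addr_ge0// !mulr_ge0// ltW.
move=> u; set N := \sum_i sqnorm (u i).
have N0 : 0 <= N by apply: sumr_ge0 => i _; exact: sqnorm_ge0.
have lo : b * \sum_i sqnorm (u i - y i) <= \sum_i qform (C i) (u i - y i).
  by rewrite mulr_sumr; apply: ler_sum => i _.
have up : \sum_i qform (C i) (u i - y i) <= t * \sum_i sqnorm (u i - y i).
  rewrite mulr_sumr; apply: ler_sum => i _; apply: le_trans (spd_qform_le _ (spdC i)) _.
  rewrite ler_wpM2r ?sqnorm_ge0// /t (bigD1 i)//= lerDl sumr_ge0// => j _.
  exact: spd_mxtrace_ge0.
have N_le : N <= 2 * \sum_i sqnorm (u i - y i) + 2 * S.
  rewrite !mulr_sumr -big_split/=; apply: ler_sum => i _.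
  by rewrite -{1}(subrK (y i) (u i)); exact: sqnormD.
have le_N : \sum_i sqnorm (u i - y i) <= 2 * N + 2 * S.
  rewrite !mulr_sumr -big_split/=; apply: ler_sum => i _; exact: sqnormB.
set D := \sum_i sqnorm (u i - y i) in lo up N_le le_N *.
set F := \sum_i qform (C i) (u i - y i) in lo up *.
have bN := ler_wpM2l (ltW b0) N_le; have tN := ler_wpM2l t0 le_N.
have bS : 0 <= b * S by rewrite mulr_ge0// ltW.
have tS : 0 <= t * S by rewrite mulr_ge0.
have bSN : 0 <= b * S * N by rewrite mulr_ge0.
have tSN : 0 <= t * S * N by rewrite mulr_ge0.
apply/andP; split; nra.
Qed.

End quadratic_form_bounds.

Section gaussian_matrix_integrals.
Context {R : realType}.

Lemma qform_scalar_mx d (c : R) (u : 'cV[R]_d) : qform c%:M u = c * sqnorm u.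
Proof.
rewrite -[c%:M]mulmx1 mul_scalar_mx qform_scale -(mulmx1 1%:M) -{1}trmx1.
by rewrite qform_gram mul1mx.
Qed.

Lemma spd_scalar_mx d (c : R) : 0 < c -> spd (c%:M : 'M[R]_d).
Proof.
move=> c0; split; first exact: tr_scalar_mx.
move=> u u0; rewrite qform_scalar_mx mulr_gt0// lt_neqAle sqnorm_ge0 andbT.
by apply: contra_neq u0 => /esym; exact: sqnorm_eq0.
Qed.

Lemma measurable_exp_sqnorm d (T : measurableType d) a b (c : R)
    (F : T -> 'M[R]_(a, b)) : measurable_fun setT F ->
  measurable_fun setT (fun t => expR (- (c * sqnorm (F t)))).
Proof.
move=> mF; apply: measurableT_comp => //; apply: measurable_funN.
by apply: measurable_funM => //; exact: measurable_sqnorm.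
Qed.

Lemma integral_exp_sqnorm a b (c : R) : 0 < c ->
  (0 < \int[lebesgue_mx a b]_A (expR (- (c * sqnorm A)))%:E < +oo)%E.
Proof.
move=> c0; rewrite integral_lebesgue_mx; last 2 first.
- by apply/measurable_EFinP; apply: measurable_exp_sqnorm; exact: measurable_id.
- by move=> A; rewrite lee_fin expR_ge0.
have E (v : 'rV[R]_(a * b)) : (expR (- (c * sqnorm (vec_mx v))))%:E =
    (expR (- qform c%:M v^T))%:E.
  by rewrite sqnorm_vec_mx qform_scalar_mx sqnorm_tr.
under eq_integral do rewrite E.
rewrite integral_gaussian_rV; last exact: spd_scalar_mx.
rewrite ltry andbT lte_fin divr_gt0// ?exprn_gt0 ?sqrtr_gt0 ?pi_gt0//.
by apply: spd_det_gt0; exact: spd_scalar_mx.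
Qed.

(** The exponential of the sum factors, and each factor is a Gaussian integral over one space. *)
Lemma integral_exp_sqnorm3 a1 b1 a2 b2 a3 b3 (c : R) : 0 < c ->
  (0 < \int[lebesgue_mx a1 b1 \x lebesgue_mx a2 b2 \x lebesgue_mx a3 b3]_w
    (expR (- (c * (sqnorm w.1.1 + sqnorm w.1.2 + sqnorm w.2))))%:E < +oo)%E.
Proof.
move=> c0.
have [I1 p1 E1] : exists2 r : R, 0 < r &
    (\int[lebesgue_mx a1 b1]_A (expR (- (c * sqnorm A)))%:E = r%:E)%E.
  have I := integral_exp_sqnorm a1 b1 c0; eexists; first exact: (fine_gt0 I).
  by rewrite fineK// ge0_fin_numE; case/andP: I => // /ltW.
have [I2 p2 E2] : exists2 r : R, 0 < r &
    (\int[lebesgue_mx a2 b2]_A (expR (- (c * sqnorm A)))%:E = r%:E)%E.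
  have I := integral_exp_sqnorm a2 b2 c0; eexists; first exact: (fine_gt0 I).
  by rewrite fineK// ge0_fin_numE; case/andP: I => // /ltW.
have [I3 p3 E3] : exists2 r : R, 0 < r &
    (\int[lebesgue_mx a3 b3]_A (expR (- (c * sqnorm A)))%:E = r%:E)%E.
  have I := integral_exp_sqnorm a3 b3 c0; eexists; first exact: (fine_gt0 I).
  by rewrite fineK// ge0_fin_numE; case/andP: I => // /ltW.
have ms a b : measurable_fun setT (fun A : 'M[R]_(a, b) => expR (- (c * sqnorm A))).
  by apply: measurable_exp_sqnorm; exact: measurable_id.
rewrite (@integral_product3 _ _ _ _ _ _ _ (@lebesgue_mx R a1 b1)
  (@lebesgue_mx R a2 b2) (@lebesgue_mx R a3 b3)); last 2 first.
- apply/measurable_EFinP; apply: measurableT_comp => //; apply: measurable_funN.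
  apply: measurable_funM => //; apply: measurable_funD; first apply: measurable_funD.
  + apply: measurable_sqnorm; exact: (measurableT_comp measurable_fst measurable_fst).
  + apply: measurable_sqnorm; exact: (measurableT_comp measurable_snd measurable_fst).
  + apply: measurable_sqnorm; exact: measurable_snd.
- by move=> w; rewrite lee_fin expR_ge0.
have E A B D : (expR (- (c * (sqnorm A + sqnorm B + sqnorm D))))%:E =
    (expR (- (c * sqnorm (A : 'M[R]_(a1, b1)))) *
     expR (- (c * sqnorm (B : 'M[R]_(a2, b2)))) *
     expR (- (c * sqnorm (D : 'M[R]_(a3, b3)))))%:E.
  by rewrite -!expRD; congr (expR _)%:E; ring.
suff -> : (\int[lebesgue_mx a1 b1]_A \int[lebesgue_mx a2 b2]_B
    \int[lebesgue_mx a3 b3]_D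
      (expR (- (c * (sqnorm A + sqnorm B + sqnorm D))))%:E)%E = (I1 * I2 * I3)%:E.
  by rewrite ltry andbT lte_fin !mulr_gt0.
transitivity (\int[lebesgue_mx a1 b1]_A (I2 * I3 * expR (- (c * sqnorm A)))%:E)%E; last first.
  rewrite integral_scale; [|by rewrite mulr_ge0// ltW|exact: ms|
    by move=> ?; exact: expR_ge0].
  by rewrite E1 -EFinM; congr EFin; ring.
apply: eq_integral => A _.
transitivity (\int[lebesgue_mx a2 b2]_B (expR (- (c * sqnorm A)) * I3 *
    expR (- (c * sqnorm B)))%:E)%E; last first.
  rewrite integral_scale; [|by rewrite mulr_ge0 ?expR_ge0// ltW|exact: ms|
    by move=> ?; exact: expR_ge0].
  by rewrite E2 -EFinM; congr EFin; ring.
apply: eq_integral => B _; under eq_integral do rewrite E.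
rewrite integral_scale; [|by rewrite mulr_ge0 ?expR_ge0|exact: ms|
  by move=> ?; exact: expR_ge0].
by rewrite E3 -EFinM; congr EFin; ring.
Qed.

End gaussian_matrix_integrals.

Section latent_variables.
Context {R : realType}.

Lemma sqnorm_unvec a b (v : 'cV[R]_(b * a)) : sqnorm (unvec v : 'M[R]_(a, b)) = sqnorm v.
Proof. by rewrite /unvec sqnorm_tr sqnorm_vec_mx sqnorm_tr. Qed.

Lemma unvecZ a b k (v : 'cV[R]_(b * a)) :
  unvec (k *: v) = k *: unvec v :> 'M[R]_(a, b).
Proof. by rewrite /unvec trmx_scale linearZ/= trmx_scale. Qed.

Lemma sum_sqnorm_latent_response a b (v : 'cV[R]_(b * a)) :
  \sum_i sqnorm (latent_response v i) = sqnorm v.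
Proof. by rewrite -(sqnorm_unvec v) sqnorm_rows. Qed.

Lemma sum_sqnorm_latent_feature a b (A : 'M[R]_(a, b)) :
  \sum_i sqnorm (latent_feature A i) = sqnorm A.
Proof. by rewrite [RHS]sqnorm_rows. Qed.

Lemma measurable_row_tr d (T : measurableType d) a b (F : T -> 'M[R]_(a, b)) i :
  measurable_fun setT F -> measurable_fun setT (fun t => (row i (F t))^T).
Proof.
by apply: (measurable_mxsub (g := fun A : 'M[R]_(a, b) => (row i A)^T)
  (r := fun _ _ => i) (c := fun j _ => j)) => A j k; rewrite !mxE.
Qed.

Lemma measurable_unvec d (T : measurableType d) a b (F : T -> 'cV[R]_(b * a)) :
  measurable_fun setT F -> measurable_fun setT (fun t => unvec (F t) : 'M[R]_(a, b)).
Proof.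
move=> mF; apply: measurable_trmx.
exact: (measurableT_comp (@measurable_vec_mx R b a) (measurable_trmx mF)).
Qed.

Lemma measurable_latent_response d (T : measurableType d) a b
    (F : T -> 'cV[R]_(b * a)) i :
  measurable_fun setT F -> measurable_fun setT (fun t => latent_response (F t) i).
Proof. by move=> mF; apply: measurable_row_tr; exact: measurable_unvec. Qed.

End latent_variables.

(** * The factors of the posterior density and their bounds *)

Section posterior_blocks.
Context {R : realType} (m n p q : nat).
Variables (U : 'I_n -> 'M[R]_m) (V : 'I_n -> 'M[R]_p) (Z : 'I_n -> 'cV[R]_q).
Variables (y : 'I_n -> 'cV[R]_m) (x : 'I_n -> 'cV[R]_p).
Variables (a0 : nat) (B0 : 'M[R]_m).
Variables (j0 : 'cV[R]_(m * q + m * p)) (J0 : 'M[R]_(m * q + m * p)).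
Hypotheses (spdU : forall i, spd (U i)) (spdV : forall i, spd (V i)).
Hypotheses (a0_ge : (m <= a0)%N) (spdB0 : spd B0) (spdJ0 : spd J0).

Local Notation latent := ('cV[R]_(m * n) * 'cV[R]_(m * q) * 'cV[R]_(m * p))%type.

Definition residual (A : 'M[R]_(n, p)) (w : latent) (i : 'I_n) : 'cV[R]_m :=
  latent_response w.1.1 i - regression_mean Z A w.1.2 w.2 i.

Definition feature_factor (A : 'M[R]_(n, p)) : R :=
  expR (- (\sum_(i < n) qform (invmx (V i)) (latent_feature A i - x i)) / 2).

Definition latent_factor (w : latent) : R :=
  expR (- (\sum_(i < n) qform (invmx (U i)) (latent_response w.1.1 i - y i)) / 2
        - qform (invmx J0) (col_mx w.1.2 w.2 - j0) / 2).

Let al : R := (n + a0 + m + 1)%:R / 2.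

Definition Sigma_factor (S : 'M[R]_m) : R :=
  if `[< spd S >] then \det S `^ (- al) * expR (- (\tr (invmx S *m B0) / 2)) else 0.

(* [misfit] and [inv_trace] are set to 0 off the positive definite matrices, so
   that their bounds hold for all matrices. *)
Definition misfit (A : 'M[R]_(n, p)) (w : latent) (S : 'M[R]_m) : R :=
  if `[< spd S >] then \sum_(i < n) qform (invmx S) (residual A w i) else 0.

Definition inv_trace (S : 'M[R]_m) : R :=
  if `[< spd S >] then \tr (invmx S) else 0.

Definition latent_sqnorm (w : latent) : R :=
  sqnorm w.1.1 + sqnorm w.1.2 + sqnorm w.2.

Definition latent_scale (k : R) (w : latent) : latent :=
  (k *: w.1.1, k *: w.1.2, k *: w.2).

(** The factorization required by the abstract sampler; off the positive definite matrices both
    sides are [0] because [Sigma_factor] is. *)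
Lemma eiv_posteriorE A (w : latent) S :
  eiv_posterior U V Z y x a0 B0 j0 J0 (A, w.1.1, w.1.2, w.2, S) =
  Sigma_factor S * expR (- (misfit A w S / 2)) * latent_factor w * feature_factor A.
Proof.
rewrite /eiv_posterior /Sigma_factor /misfit; case: ifPn => _; last by rewrite !mul0r.
rewrite -!mulrA; congr (_ * _).
rewrite -!expRD; congr expR; rewrite /residual; ring.
Qed.

(** The observations [y] and [x] do not enter the residual, which is therefore linear, not merely
    affine, in the three latent components taken together. *)
Lemma residualZ A k w i : residual A (latent_scale k w) i = k *: residual A w i.
Proof.
rewrite /residual /latent_response /regression_mean/= !unvecZ.
rewrite scalerBr scalerDr !trmx_scale -!scalemxAl; congr (_ - _).
by apply/matrixP => r c; rewrite !mxE.
Qed.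

Lemma misfitZ A k w S : misfit A (latent_scale k w) S = k ^+ 2 * misfit A w S.
Proof.
rewrite /misfit; case: ifPn => _; last by rewrite mulr0.
by rewrite mulr_sumr; apply: eq_bigr => i _; rewrite residualZ qformZ.
Qed.

Lemma misfit_ge0 A w S : 0 <= misfit A w S.
Proof.
rewrite /misfit; case: ifPn => // /asboolP spdS; apply: sumr_ge0 => i _.
by apply: spd_qform_ge0; exact: spd_inv.
Qed.

Lemma inv_trace_ge0 S : 0 <= inv_trace S.
Proof.
rewrite /inv_trace; case: ifPn => // /asboolP spdS.
by apply: spd_mxtrace_ge0; exact: spd_inv.
Qed.

Lemma latent_sqnorm_ge0 w : 0 <= latent_sqnorm w.
Proof. by rewrite !addr_ge0// sqnorm_ge0. Qed.

(** The trace bounds the form of [invmx S], and the residuals are bounded componentwise; the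
    constant is chosen so that the bound is a product of gauges. *)
Lemma misfit_le A w S : misfit A w S <=
  inv_trace S * ((4 + 4 * \sum_i sqnorm (Z i)) * (1 + sqnorm A) * latent_sqnorm w).
Proof.
rewrite /misfit /inv_trace; case: ifPn => [/asboolP spdS|_]; last by rewrite mul0r.
apply: (@le_trans _ _ (\tr (invmx S) * \sum_i sqnorm (residual A w i))).
  rewrite mulr_sumr; apply: ler_sum => i _; apply: spd_qform_le; exact: spd_inv.
rewrite ler_wpM2l ?spd_mxtrace_ge0//; first exact: spd_inv.
set z := \sum_i sqnorm (Z i).
have z0 : 0 <= z by apply: sumr_ge0 => i _; exact: sqnorm_ge0.
have n1 := sqnorm_ge0 w.1.1; have n2 := sqnorm_ge0 w.1.2.
have n3 := sqnorm_ge0 w.2; have nA := sqnorm_ge0 A.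
(* Two uses of the bound of a squared norm of a sum by twice the sum of the squared norms: [2] on
   the response, [4] on each regression term. *)
apply: (@le_trans _ _ (2 * sqnorm w.1.1 + 4 * (sqnorm w.1.2 * z) + 4 * (sqnorm w.2 * sqnorm A))).
  rewrite -(sum_sqnorm_latent_response w.1.1) -(sum_sqnorm_latent_feature A).
  rewrite !mulr_sumr -!big_split/=; apply: ler_sum => i _.
  apply: le_trans (sqnormB _ _) _; rewrite -addrA lerD2l.
  have H1 : sqnorm ((unvec w.1.2)^T *m Z i) <= sqnorm w.1.2 * sqnorm (Z i).
    by apply: le_trans (sqnorm_mulmx _ _) _; rewrite sqnorm_tr sqnorm_unvec.
  have H2 : sqnorm ((unvec w.2)^T *m latent_feature A i) <=
      sqnorm w.2 * sqnorm (latent_feature A i).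
    by apply: le_trans (sqnorm_mulmx _ _) _; rewrite sqnorm_tr sqnorm_unvec.
  have := sqnormD ((unvec w.1.2)^T *m Z i) ((unvec w.2)^T *m latent_feature A i).
  by rewrite /regression_mean; lra.
rewrite /latent_sqnorm.
have h1 : 0 <= sqnorm w.1.1 * z by rewrite mulr_ge0.
have h2 : 0 <= sqnorm w.2 * z by rewrite mulr_ge0.
have h3 : 0 <= sqnorm w.1.1 * sqnorm A by rewrite mulr_ge0.
have h4 : 0 <= sqnorm w.1.2 * sqnorm A by rewrite mulr_ge0.
have h5 : 0 <= sqnorm w.1.1 * sqnorm A * z by rewrite !mulr_ge0.
have h6 : 0 <= sqnorm w.1.2 * sqnorm A * z by rewrite !mulr_ge0.
have h7 : 0 <= sqnorm w.2 * sqnorm A * z by rewrite !mulr_ge0.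
have h8 : 0 <= sqnorm w.1.2 * z by rewrite mulr_ge0.
nra.
Qed.

Lemma feature_factor_bounds : exists c K : R, [/\ 0 < c, 0 <= K &
  forall A, expR (- (K * sqnorm A + K)) <= feature_factor A <=
            expR (K - c * sqnorm A)].
Proof.
have [c [K [c0 K0 H]]] := qform_sub_bounds x (fun i => spd_inv (spdV i)).
exists (c / 2), K; split => //; first by rewrite divr_gt0.
move=> A; have := H (latent_feature A); rewrite sum_sqnorm_latent_feature.
have nA := sqnorm_ge0 A; have KA : 0 <= K * sqnorm A by rewrite mulr_ge0.
by move=> /andP[lo up]; rewrite /feature_factor !ler_expR; apply/andP; split; lra.
Qed.

Lemma latent_factor_bounds : exists c K : R, [/\ 0 < c, 0 <= K &
  forall w, expR (- (K * latent_sqnorm w + K)) <= latent_factor w <=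
            expR (K - c * latent_sqnorm w)].
Proof.
have [c1 [K1 [c10 K10 H1]]] := qform_sub_bounds y (fun i => spd_inv (spdU i)).
(* The prior of the coefficients is treated as a family with one member. *)
have [c2 [K2 [c20 K20 H2]]] := qform_sub_bounds (fun _ : 'I_1 => j0)
  (fun _ : 'I_1 => spd_inv spdJ0).
pose c := Num.min c1 c2; have c0 : 0 < c by rewrite lt_min c10.
have cc1 : c <= c1 by rewrite ge_min lexx.
have cc2 : c <= c2 by rewrite ge_min lexx orbT.
exists (c / 2), (K1 + K2); split => //; first by rewrite divr_gt0.
  by rewrite addr_ge0.
move=> w; have := H1 (latent_response w.1.1); rewrite sum_sqnorm_latent_response.
have := H2 (fun _ => col_mx w.1.2 w.2); rewrite !big_ord1 sqnorm_col_mx.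
move=> /andP[lo2 up2] /andP[lo1 up1].
have n1 := sqnorm_ge0 w.1.1; have n2 := sqnorm_ge0 w.1.2; have n3 := sqnorm_ge0 w.2.
have h1 : 0 <= K1 * sqnorm w.1.1 by rewrite mulr_ge0.
have h2 : 0 <= K1 * sqnorm w.1.2 by rewrite mulr_ge0.
have h3 : 0 <= K1 * sqnorm w.2 by rewrite mulr_ge0.
have h4 : 0 <= K2 * sqnorm w.1.1 by rewrite mulr_ge0.
have h5 : 0 <= K2 * sqnorm w.1.2 by rewrite mulr_ge0.
have h6 : 0 <= K2 * sqnorm w.2 by rewrite mulr_ge0.
have h7 : c * sqnorm w.1.1 <= c1 * sqnorm w.1.1 by rewrite ler_wpM2r.
have h8 : c * (sqnorm w.1.2 + sqnorm w.2) <= c2 * (sqnorm w.1.2 + sqnorm w.2).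
  by rewrite ler_wpM2r// addr_ge0.
rewrite /latent_factor /latent_sqnorm !ler_expR; apply/andP; split; lra.
Qed.

(** Sandwiches the matrix scale [B0] between scalar scales, where the integral is known. The last
    clause is the decay later traded for an exponential moment. *)
Lemma Sigma_factor_bounds : exists b1 b2 : R, [/\ 0 < b1, 0 < b2,
  forall S, iw_kernel al b2 S <= Sigma_factor S <= iw_kernel al b1 S &
  forall S, spd S -> 2 * b1 * \tr (invmx S) <= \tr (invmx S *m B0)].
Proof.
have [b b0 bP] := spd_qform_ge spdB0.
have lo S : spd S -> b * \tr (invmx S) <= \tr (invmx S *m B0).
  by move=> spdS; apply: mxtrace_mul_ge => //; exact: spd_inv.
have t0 := spd_mxtrace_ge0 spdB0.
(* The halves come from the [/ 2] in the exponent of [Sigma_factor]; the added [1] makes the larger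
   scale visibly positive. *)
exists (b / 2), (\tr B0 + 1); split => //; first by rewrite divr_gt0.
- by rewrite ltr_wpDl.
- move=> S; rewrite /iw_kernel /Sigma_factor; case: ifPn => [/asboolP spdS|_].
    have spdI := spd_inv spdS.
    have := lo _ spdS; have := mxtrace_mul_le spdI spdB0.
    have tI := spd_mxtrace_ge0 spdI; have tt : 0 <= \tr B0 * \tr (invmx S) by rewrite mulr_ge0.
    move=> h1 h2; apply/andP; split; rewrite ler_wpM2l ?powR_ge0// ler_expR; lra.
  by rewrite lexx.
- by move=> S spdS; have := lo _ spdS; rewrite mulrCA divff// mulr1.
Qed.

End posterior_blocks.

Section integral_comparison.
Local Open Scope ereal_scope.
Context {R : realType}.

Lemma ereal_ratio_bound (A B : \bar R) : 0 <= A -> A < +oo -> 0 < B -> B < +oo ->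
  exists C : R, A <= C%:E * B.
Proof.
move=> A0 Aoo B_gt0 Boo.
have Af : A \is a fin_num by rewrite ge0_fin_numE.
have Bf : B \is a fin_num by rewrite ge0_fin_numE// ltW.
have b0 : (0 < fine B)%R by apply: fine_gt0; rewrite B_gt0.
exists (fine A / fine B)%R; rewrite -{1}(fineK Af) -{2}(fineK Bf) -EFinM lee_fin.
by rewrite divfK// gt_eqF.
Qed.

End integral_comparison.

(** * Normalizing constants and exponential moments of the factors *)

Section posterior_integrals.
Context {R : realType} (m n p q : nat).
Variables (U : 'I_n -> 'M[R]_m) (V : 'I_n -> 'M[R]_p) (Z : 'I_n -> 'cV[R]_q).
Variables (y : 'I_n -> 'cV[R]_m) (x : 'I_n -> 'cV[R]_p).
Variables (a0 : nat) (B0 : 'M[R]_m).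
Variables (j0 : 'cV[R]_(m * q + m * p)) (J0 : 'M[R]_(m * q + m * p)).
Hypotheses (spdU : forall i, spd (U i)) (spdV : forall i, spd (V i)).
Hypotheses (a0_ge : (m <= a0)%N) (spdB0 : spd B0) (spdJ0 : spd J0).

Local Notation latent := ('cV[R]_(m * n) * 'cV[R]_(m * q) * 'cV[R]_(m * p))%type.
Local Notation feature_factor := (feature_factor V x).
Local Notation latent_factor := (latent_factor U y j0 J0).
Local Notation Sigma_factor := (Sigma_factor n a0 B0).
Local Notation misfit := (misfit Z).
Let al : R := (n + a0 + m + 1)%:R / 2.

Lemma measurable_sum_qform d (T : measurableType d) a b (C : T -> 'M[R]_a)
    (u : T -> 'I_b -> 'cV[R]_a) : measurable_fun setT C ->
  (forall i, measurable_fun setT (fun t => u t i)) ->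
  measurable_fun setT (fun t => \sum_(i < b) qform (C t) (u t i)).
Proof.
by move=> mC mu; apply: measurable_sum => i; exact: measurable_qform.
Qed.

Lemma measurable_feature_factor : measurable_fun setT feature_factor.
Proof.
apply: measurableT_comp => //; apply: measurable_funM => //; apply: measurable_funN.
apply: measurable_sum => i; apply: measurable_qform; first exact: measurable_cst.
apply: measurable_mxB; last exact: measurable_cst.
by apply: measurable_row_tr; exact: measurable_id.
Qed.

Lemma measurable_latent_factor : measurable_fun setT latent_factor.
Proof.
have m11 : measurable_fun setT (fun w : latent => w.1.1).
  exact: (measurableT_comp measurable_fst measurable_fst).
have m12 : measurable_fun setT (fun w : latent => w.1.2).
  exact: (measurableT_comp measurable_snd measurable_fst).
apply: measurableT_comp => //; apply: measurable_funB.
  apply: measurable_funM => //; apply: measurable_funN.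
  apply: measurable_sum => i; apply: measurable_qform; first exact: measurable_cst.
  apply: measurable_mxB; last exact: measurable_cst.
  exact: measurable_latent_response.
apply: measurable_funM => //; apply: measurable_qform; first exact: measurable_cst.
apply: measurable_mxB; last exact: measurable_cst.
by apply: measurable_col_mx => //; exact: measurable_snd.
Qed.

Lemma measurable_Sigma_factor : measurable_fun setT Sigma_factor.
Proof.
have -> : Sigma_factor = (fun S => if `[< spd S >] then
    \det S `^ (- al) * expR (- (\tr (cinvmx S *m B0) / 2)) else 0).
  apply/funext => S; rewrite /Sigma_factor.
  by case: ifPn => // /asboolP spdS; rewrite spd_cinvmx.
apply: measurable_spd_if; first exact: measurable_id.
apply: measurable_funM.
  by apply: (measurableT_comp (measurable_powR _)); apply: measurable_det; exact: measurable_id.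
apply: measurableT_comp => //; apply: measurable_funN; apply: measurable_funM => //.
apply: measurable_mxtrace; apply: measurable_mulmx; last exact: measurable_cst.
by apply: measurable_spd_invmx; exact: measurable_id.
Qed.

Lemma measurable_inv_trace : measurable_fun setT (@inv_trace R m).
Proof.
have -> : @inv_trace R m = (fun S => if `[< spd S >] then \tr (cinvmx S) else 0).
  apply/funext => S; rewrite /inv_trace.
  by case: ifPn => // /asboolP spdS; rewrite spd_cinvmx.
apply: measurable_spd_if; first exact: measurable_id.
by apply: measurable_mxtrace; apply: measurable_spd_invmx; exact: measurable_id.
Qed.

Lemma measurable_residual d (T : measurableType d) (A : T -> 'M[R]_(n, p))
    (w : T -> latent) i : measurable_fun setT A -> measurable_fun setT w ->
  measurable_fun setT (fun t => residual Z (A t) (w t) i).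
Proof.
move=> mA mw.
have m11 : measurable_fun setT (fun t => (w t).1.1).
  exact: (measurableT_comp measurable_fst (measurableT_comp measurable_fst mw)).
have m12 : measurable_fun setT (fun t => (w t).1.2).
  exact: (measurableT_comp measurable_snd (measurableT_comp measurable_fst mw)).
have m2 : measurable_fun setT (fun t => (w t).2).
  exact: (measurableT_comp measurable_snd mw).
apply: measurable_mxB; first exact: measurable_latent_response.
apply: measurable_mxD.
  apply: measurable_mulmx; last exact: measurable_cst.
  by apply: measurable_trmx; exact: measurable_unvec.
apply: measurable_mulmx; last exact: measurable_row_tr.
by apply: measurable_trmx; exact: measurable_unvec.
Qed.

Lemma measurable_misfit : measurable_fun setT
  (fun t : 'M[R]_(n, p) * latent * 'M[R]_m => misfit t.1.1 t.1.2 t.2).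
Proof.
have -> : (fun t : 'M[R]_(n, p) * latent * 'M[R]_m => misfit t.1.1 t.1.2 t.2) =
    (fun t => if `[< spd t.2 >] then
       \sum_(i < n) qform (cinvmx t.2) (residual Z t.1.1 t.1.2 i) else 0).
  apply/funext => t; rewrite /misfit.
  by case: ifPn => // /asboolP spdS; rewrite spd_cinvmx.
apply: measurable_spd_if; first exact: measurable_snd.
apply: measurable_sum_qform.
  by apply: measurable_spd_invmx; exact: measurable_snd.
move=> i; apply: measurable_residual.
  exact: (measurableT_comp measurable_fst measurable_fst).
exact: (measurableT_comp measurable_snd measurable_fst).
Qed.

Lemma measurable_latent_sqnorm : measurable_fun setT (@latent_sqnorm R m n p q).
Proof.
apply: measurable_funD; first apply: measurable_funD; apply: measurable_sqnorm.
- exact: (measurableT_comp measurable_fst measurable_fst).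
- exact: (measurableT_comp measurable_snd measurable_fst).
- exact: measurable_snd.
Qed.

Lemma feature_factor_gt0 A : 0 < feature_factor A.
Proof. exact: expR_gt0. Qed.

Lemma latent_factor_gt0 w : 0 < latent_factor w.
Proof. exact: expR_gt0. Qed.

Lemma Sigma_factor_ge0 S : 0 <= Sigma_factor S.
Proof.
rewrite /Sigma_factor; case: ifPn => // _.
by rewrite mulr_ge0 ?powR_ge0 ?expR_ge0.
Qed.

Lemma feature_factor_integral :
  (0 < \int[lebesgue_mx n p]_A (feature_factor A)%:E < +oo)%E.
Proof.
have [c [K [c0 K0 H]]] := feature_factor_bounds x spdV.
have mf := measurable_feature_factor.
have me (b : R) : measurable_fun setT (fun A : 'M[R]_(n, p) => expR (- (b * sqnorm A))).
  by apply: measurable_exp_sqnorm; exact: measurable_id.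
apply/andP; split.
  have /andP[I1 _] := integral_exp_sqnorm n p (@ltr01 R).
  apply: integral_gt0_support I1 => //.
  - exact/measurable_EFinP.
  - exact/measurable_EFinP.
  - by move=> A; rewrite lee_fin ltW// feature_factor_gt0.
  - by move=> A _; rewrite lte_fin feature_factor_gt0.
have /andP[_ Ioo] := integral_exp_sqnorm n p c0.
apply: (@le_lt_trans _ _ (\int[lebesgue_mx n p]_A (expR K * expR (- (c * sqnorm A)))%:E)%E).
  apply: le_integral_nonneg => A; first by rewrite lee_fin ltW// feature_factor_gt0.
  by rewrite lee_fin -expRD; have /andP[] := H A.
rewrite integral_scale; [|exact: expR_ge0|exact: me|by move=> A; exact: expR_ge0].
by rewrite lte_mul_pinfty ?lee_fin ?expR_ge0.
Qed.

(** Half of the Gaussian decay is spent on the exponential moment. No conditioning variable occurs,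
    so finiteness of one integral and positivity of the other already give a constant. *)
Lemma feature_factor_tail : exists eps C : R, 0 < eps /\
  (\int[lebesgue_mx n p]_A (feature_factor A * expR (eps * sqnorm A))%:E <=
   C%:E * \int[lebesgue_mx n p]_A (feature_factor A)%:E)%E.
Proof.
have [c [K [c0 K0 H]]] := feature_factor_bounds x spdV.
have me (b : R) : measurable_fun setT (fun A : 'M[R]_(n, p) => expR (- (b * sqnorm A))).
  by apply: measurable_exp_sqnorm; exact: measurable_id.
have c20 : 0 < c / 2 by rewrite divr_gt0.
have /andP[F0 Foo] := feature_factor_integral.
have [C HC] : exists C : R,
    (\int[lebesgue_mx n p]_A (feature_factor A * expR (c / 2 * sqnorm A))%:E <=
     C%:E * \int[lebesgue_mx n p]_A (feature_factor A)%:E)%E.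
  apply: ereal_ratio_bound => //.
    by apply: integral_ge0 => A _; rewrite lee_fin mulr_ge0 ?expR_ge0// ltW// feature_factor_gt0.
  have /andP[_ Ioo] := integral_exp_sqnorm n p c20.
  apply: (@le_lt_trans _ _
    (\int[lebesgue_mx n p]_A (expR K * expR (- (c / 2 * sqnorm A)))%:E)%E).
    apply: le_integral_nonneg => A.
      by rewrite lee_fin mulr_ge0 ?expR_ge0// ltW// feature_factor_gt0.
    rewrite lee_fin; apply: (@le_trans _ _ (expR (K - c * sqnorm A) * expR (c / 2 * sqnorm A))).
      by rewrite ler_wpM2r ?expR_ge0//; have /andP[] := H A.
    by rewrite -!expRD ler_expR; lra.
  rewrite integral_scale; [|exact: expR_ge0|exact: me|by move=> A; exact: expR_ge0].
  by rewrite lte_mul_pinfty ?lee_fin ?expR_ge0.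
by exists (c / 2), C.
Qed.

Let mu2 := (lebesgue_mx (m * n) 1 \x lebesgue_mx (m * q) 1 \x lebesgue_mx (m * p) 1)%E
  : set latent -> \bar R.

Lemma latent_factor_integral : (0 < \int[mu2]_w (latent_factor w)%:E < +oo)%E.
Proof.
have [c [K [c0 K0 H]]] := latent_factor_bounds y j0 spdU spdJ0.
have mf := measurable_latent_factor.
have me (b : R) : measurable_fun setT (fun w : latent => expR (- (b * latent_sqnorm w))).
  apply: measurableT_comp => //; apply: measurable_funN; apply: measurable_funM => //.
  exact: measurable_latent_sqnorm.
apply/andP; split.
  have /andP[I1 _] := integral_exp_sqnorm3 (R := R) (m * n) 1 (m * q) 1 (m * p) 1 (@ltr01 R).
  apply: integral_gt0_support I1 => //.
  - by apply/measurable_EFinP; exact: me.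
  - exact/measurable_EFinP.
  - by move=> w; rewrite lee_fin ltW// latent_factor_gt0.
  - by move=> w _; rewrite lte_fin latent_factor_gt0.
have /andP[_ Ioo] := integral_exp_sqnorm3 (m * n) 1 (m * q) 1 (m * p) 1 c0.
apply: (@le_lt_trans _ _ (\int[mu2]_w (expR K * expR (- (c * latent_sqnorm w)))%:E)%E).
  apply: le_integral_nonneg => w; first by rewrite lee_fin ltW// latent_factor_gt0.
  by rewrite lee_fin -expRD; have /andP[] := H w.
rewrite integral_scale; [|exact: expR_ge0|exact: me|by move=> A; exact: expR_ge0].
by rewrite lte_mul_pinfty ?lee_fin ?expR_ge0.
Qed.

Lemma dilation_latent : exists N, dilation_law mu2 N (@latent_scale R m n p q).
Proof.
have [N1 H1] := @dilation_lebesgue_mx R (m * n) 1.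
have [N2 H2] := @dilation_lebesgue_mx R (m * q) 1.
have [N3 H3] := @dilation_lebesgue_mx R (m * p) 1.
have H12 : dilation_law
    (product_sfm (@lebesgue_mx R (m * n) 1) (@lebesgue_mx R (m * q) 1)) (N1 + N2) _ :=
  dilation_product H1 H2.
by exists (N1 + N2 + N3)%N; exact: (dilation_product H12 H3).
Qed.

(** The mass on the right may be arbitrarily small, so the two integrals are compared by dilating
    [w]. A dilation factor above [1] increases the misfit, and a large enough one brings the
    Gaussian upper bound on [latent_factor], moment included, below a multiple of its lower
    bound. *)
Lemma latent_factor_tail : exists eps C : R, 0 < eps /\ forall A S,
  (\int[mu2]_w (expR (- (misfit A w S / 2)) * latent_factor w *
     expR (eps * latent_sqnorm w))%:E <=
   C%:E * \int[mu2]_w (expR (- (misfit A w S / 2)) * latent_factor w)%:E)%E.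
Proof.
have [c [K [c0 K0 H]]] := latent_factor_bounds y j0 spdU spdJ0.
have [N HN] := dilation_latent.
(* The scale [s >= 1] is such that [s ^+ 2 * (c / 2) >= K]. *)
pose s := Num.sqrt (2 * K / c + 1).
have Kc : 0 <= 2 * K / c by rewrite divr_ge0 ?mulr_ge0// ltW.
have s2 : s ^+ 2 = 2 * K / c + 1 by rewrite sqr_sqrtr// addr_ge0.
have s0 : 0 < s by rewrite sqrtr_gt0 ltr_wpDl.
(* The constant of the upper bound on [latent_factor], the Jacobian of the dilation, and the
   constant of the lower bound. *)
exists (c / 2), (expR K * s ^+ N * expR K); split; first by rewrite divr_gt0.
move=> A S.
have mmis : measurable_fun setT (fun w => misfit A w S).
  have mg : measurable_fun setT (fun w : latent => (A, w, S)).
    by apply: measurable_fun_pair; [apply: measurable_fun_pair => //|];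
      exact: measurable_cst.
  exact: (measurableT_comp measurable_misfit mg).
have me : measurable_fun setT (fun w => expR (- (misfit A w S / 2))).
  by apply: measurableT_comp => //; apply: measurable_funN; exact: measurable_funM.
pose G w := expR (- (misfit A w S / 2)) * expR (- (c / 2 * latent_sqnorm w)).
have G0 w : 0 <= G w by rewrite mulr_ge0 ?expR_ge0.
have mG : measurable_fun setT G.
  apply: measurable_funM => //; apply: measurableT_comp => //; apply: measurable_funN.
  by apply: measurable_funM => //; exact: measurable_latent_sqnorm.
have ml := measurable_latent_factor.
have mel : measurable_fun setT (fun w => expR (- (misfit A w S / 2)) * latent_factor w).
  exact: measurable_funM.
have el0 w : 0 <= expR (- (misfit A w S / 2)) * latent_factor w.
  by rewrite mulr_ge0 ?expR_ge0// ltW// latent_factor_gt0.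
apply: (@le_trans _ _ (\int[mu2]_w (expR K * G w)%:E)%E).
  apply: le_integral_nonneg => w; first by rewrite lee_fin mulr_ge0// expR_ge0.
  rewrite lee_fin /G [leRHS]mulrCA -[leLHS]mulrA ler_wpM2l ?expR_ge0//.
  apply: (@le_trans _ _ (expR (K - c * latent_sqnorm w) * expR (c / 2 * latent_sqnorm w))).
    by rewrite ler_wpM2r ?expR_ge0//; have /andP[] := H w.
  by rewrite -!expRD ler_expR; lra.
rewrite integral_scale; [|exact: expR_ge0|exact: mG|exact: G0].
have [_ dil] := HN s s0.
have mGE : measurable_fun setT (EFin \o G) by exact/measurable_EFinP.
have E := dil (EFin \o G) mGE (fun w => G0 w).
rewrite [X in (_ * X)%E]E muleA -EFinM.
have sN : 0 <= expR K * s ^+ N by rewrite mulr_ge0 ?expR_ge0// exprn_ge0// ltW.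
rewrite [in leRHS]EFinM -[leRHS]muleA lee_wpmul2l ?lee_fin//.
rewrite -integral_scale; [|exact: expR_ge0|exact: mel|exact: el0].
apply: le_integral_nonneg => w; first by rewrite lee_fin.
rewrite /= lee_fin /G misfitZ mulrCA.
have h0 := misfit_ge0 Z A w S; have n0 := latent_sqnorm_ge0 w.
have lsZ : latent_sqnorm (latent_scale s w) = s ^+ 2 * latent_sqnorm w.
  by rewrite /latent_sqnorm /latent_scale/= !sqnormZ; ring.
apply: ler_pM; rewrite ?expR_ge0//.
  rewrite ler_expR lerN2 s2 ler_wpM2r// mulrDl mul1r lerDr mulr_ge0//.
apply: (@le_trans _ _ (expR K * expR (- (K * latent_sqnorm w + K)))); last first.
  by rewrite ler_wpM2l ?expR_ge0//; have /andP[] := H w.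
rewrite -expRD ler_expR lsZ s2.
have -> : c / 2 * ((2 * K / c + 1) * latent_sqnorm w) =
    K * latent_sqnorm w + c / 2 * latent_sqnorm w.
  by field; rewrite gt_eqF.
have : 0 <= c / 2 * latent_sqnorm w by rewrite mulr_ge0// divr_ge0// ltW.
lra.
Qed.

(** The integrability threshold of [integral_iw_kernel]; the condition [m <= a0] enters here. *)
Lemma al_ge : m%:R + 1 / 2 <= al.
Proof.
have : (m%:R : R) <= a0%:R by rewrite ler_nat.
have : (0 : R) <= n%:R by [].
by rewrite /al !natrD; lra.
Qed.

Lemma Sigma_factor_integral :
  (0 < \int[lebesgue_sym m]_S (Sigma_factor S)%:E < +oo)%E.
Proof.
have [b1 [b2 [b10 b20 H _]]] := Sigma_factor_bounds n a0 spdB0.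
have /andP[I1 _] := integral_iw_kernel b20 al_ge.
have /andP[_ I2] := integral_iw_kernel b10 al_ge.
apply/andP; split.
  apply: (lt_le_trans I1); apply: le_integral_nonneg => S.
    by rewrite lee_fin iw_kernel_ge0.
  by rewrite lee_fin; have /andP[] := H S.
apply: le_lt_trans I2; apply: le_integral_nonneg => S.
  by rewrite lee_fin Sigma_factor_ge0.
by rewrite lee_fin; have /andP[] := H S.
Qed.

(** Passing from [S] to [2 *: S] halves the trace and the misfit and multiplies the determinant by a
    constant. The quarter of [\tr (invmx S *m B0)] so released covers the exponential moment,
    whatever the misfit. *)
Lemma Sigma_factor_tail : exists eps C : R, 0 < eps /\
  forall (A : 'M[R]_(n, p)) (w : latent),
  (\int[lebesgue_sym m]_S (Sigma_factor S * expR (- (misfit A w S / 2)) *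
     expR (eps * inv_trace S))%:E <=
   C%:E * \int[lebesgue_sym m]_S (Sigma_factor S * expR (- (misfit A w S / 2)))%:E)%E.
Proof.
have [b1 [b2 [b10 b20 _ H]]] := Sigma_factor_bounds n a0 spdB0.
have [N HN] := @dilation_lebesgue_sym R m.
(* Compensates the power of the determinant at [2 *: S]; the Jacobian [2 ^+ N] divides the final
   constant. *)
pose k : R := (2 ^+ m) `^ al.
have k0 : 0 <= k by exact: powR_ge0.
exists (b1 / 2), (k / 2 ^+ N); split; first by rewrite divr_gt0.
move=> A w.
have mmis : measurable_fun setT (fun S => misfit A w S).
  have mg : measurable_fun setT (fun S : 'M[R]_m => (A, w, S)).
    by apply: measurable_fun_pair => //; exact: measurable_cst.
  exact: (measurableT_comp measurable_misfit mg).
pose G S := Sigma_factor S * expR (- (misfit A w S / 2)).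
have G0 S : 0 <= G S by rewrite mulr_ge0 ?expR_ge0 ?Sigma_factor_ge0.
have mG : measurable_fun setT G.
  apply: measurable_funM; first exact: measurable_Sigma_factor.
  by apply: measurableT_comp => //; apply: measurable_funN; exact: measurable_funM.
have [m2 dil] := HN 2 (ltr0n _ 2).
have mGE : measurable_fun setT (EFin \o G) by exact/measurable_EFinP.
have E := dil (EFin \o G) mGE (fun S => G0 S).
have mG2 : measurable_fun setT (fun S : 'M[R]_m => G (2 *: S)) by exact: (measurableT_comp mG m2).
rewrite -[X in (_ <= _ * X)%E]/(\int[lebesgue_sym m]_S (EFin \o G) S)%E E muleA -EFinM.
rewrite divfK ?expf_neq0//.
rewrite -(integral_scale _ k0 mG2 (fun S => G0 _)).
apply: le_integral_nonneg => S.
  by rewrite lee_fin; apply: mulr_ge0; [exact: G0|exact: expR_ge0].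
rewrite lee_fin /G /Sigma_factor /misfit /inv_trace.
case: ifPn => [/asboolP spdS|_]; last first.
  by rewrite !mul0r mulr_ge0// mulr_ge0 ?expR_ge0//; case: ifPn => // _;
    rewrite mulr_ge0 ?powR_ge0 ?expR_ge0.
rewrite asboolT; last exact: spd_scale.
have dS := spd_det_gt0 spdS.
rewrite invmxZ; last by apply: spd_unitmx; exact: spd_scale.
rewrite detZ powRM ?exprn_ge0 ?(ltW dS)// -/al.
have -> : k * (((2 ^+ m) `^ (- al) * \det S `^ (- al)) *
    expR (- (\tr (2^-1 *: invmx S *m B0) / 2)) *
    expR (- ((\sum_(i < n) qform (2^-1 *: invmx S) (residual Z A w i)) / 2))) =
    \det S `^ (- al) * (expR (- (\tr (2^-1 *: invmx S *m B0) / 2)) *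
    expR (- ((\sum_(i < n) qform (2^-1 *: invmx S) (residual Z A w i)) / 2))).
  rewrite /k powRN; field; rewrite gt_eqF// powR_gt0// exprn_gt0//.
rewrite -!mulrA ler_wpM2l ?powR_ge0// -!expRD ler_expR.
rewrite -scalemxAl mxtraceZ.
have -> : \sum_(i < n) qform (2^-1 *: invmx S) (residual Z A w i) =
    2^-1 * \sum_(i < n) qform (invmx S) (residual Z A w i).
  by rewrite mulr_sumr; apply: eq_bigr => i _; rewrite qform_scale.
have h0 : 0 <= \sum_(i < n) qform (invmx S) (residual Z A w i).
  by apply: sumr_ge0 => i _; apply: spd_qform_ge0; exact: spd_inv.
have := H S spdS; lra.
Qed.

End posterior_integrals.

Section tonelli5.
Local Open Scope ereal_scope.
Context d1 d2 d3 d4 d5 (X1 : measurableType d1) (X2 : measurableType d2)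
  (X3 : measurableType d3) (X4 : measurableType d4) (X5 : measurableType d5)
  (R : realType).
Variables (m1 : {sigma_finite_measure set X1 -> \bar R})
  (m2 : {sigma_finite_measure set X2 -> \bar R})
  (m3 : {sigma_finite_measure set X3 -> \bar R})
  (m4 : {sigma_finite_measure set X4 -> \bar R})
  (m5 : {sigma_finite_measure set X5 -> \bar R}).

(** The order of the five integrals is unchanged; only the middle three are bracketed together, as
    the block drawn jointly. *)
Lemma integral_product5_regroup (F : X1 * X2 * X3 * X4 * X5 -> \bar R) :
  measurable_fun setT F -> (forall t, 0 <= F t) ->
  \int[m1 \x m2 \x m3 \x m4 \x m5]_t F t =
  \int[m1]_x \int[m2 \x m3 \x m4]_w \int[m5]_z F (x, w.1.1, w.1.2, w.2, z).
Proof.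
move=> mF F0.
pose m12 := product_sfm m1 m2.
pose m1234 := product_sfm (product_sfm m12 m3) m4.
rewrite (fubini_tonelli1 (m1 := m1234) F mF F0).
pose G := fubini_F m5 F.
have mG : measurable_fun setT G by exact: measurable_fun_fubini_tonelli_F.
have G0 t : 0 <= G t by exact: integral_ge0.
rewrite [LHS](integral_product3 m12 m3 m4 mG G0).
pose G1 (t : X1 * X2) := \int[m3]_u \int[m4]_v G (t, u, v).
have mG1 : measurable_fun setT G1.
  pose G2 (t : X1 * X2 * X3) := \int[m4]_v G (t, v).
  have mG2 : measurable_fun setT G2 by exact: (measurable_fun_fubini_tonelli_F (m2 := m4) G).
  have G20 t : 0 <= G2 t by exact: integral_ge0.
  exact: (measurable_fun_fubini_tonelli_F (m2 := m3) G2).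
have G10 t : 0 <= G1 t by apply: integral_ge0 => u _; exact: integral_ge0.
rewrite (fubini_tonelli1 (m1 := m1) (m2 := m2) G1 mG1 G10).
apply: eq_integral => x _.
pose H (w : X2 * X3 * X4) := G (x, w.1.1, w.1.2, w.2).
have mH : measurable_fun setT H.
  apply: (measurableT_comp mG).
  apply: measurable_fun_pair => //; apply: measurable_fun_pair.
    apply: measurable_fun_pair; first exact: measurable_cst.
    exact: (measurableT_comp measurable_fst measurable_fst).
  exact: (measurableT_comp measurable_snd measurable_fst).
exact: (esym (integral_product3 m2 m3 m4 mH (fun w => G0 _))).
Qed.

End tonelli5.

(** * The abstract result applied to the posterior *)

Section posterior_sampler.
Context {R : realType} (m n p q : nat).
Variables (U : 'I_n -> 'M[R]_m) (V : 'I_n -> 'M[R]_p) (Z : 'I_n -> 'cV[R]_q).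
Variables (y : 'I_n -> 'cV[R]_m) (x : 'I_n -> 'cV[R]_p).
Variables (a0 : nat) (B0 : 'M[R]_m).
Variables (j0 : 'cV[R]_(m * q + m * p)) (J0 : 'M[R]_(m * q + m * p)).
Hypotheses (spdU : forall i, spd (U i)) (spdV : forall i, spd (V i)).
Hypotheses (a0_ge : (m <= a0)%N) (spdB0 : spd B0) (spdJ0 : spd J0).

Local Notation latent := ('cV[R]_(m * n) * 'cV[R]_(m * q) * 'cV[R]_(m * p))%type.
Local Notation state := (eiv_state R m n p q).

Let nuM : {sigma_finite_measure set _ -> \bar R} := @lebesgue_mx R (m * n) 1.
Let thM : {sigma_finite_measure set _ -> \bar R} := @lebesgue_mx R (m * q) 1.
Let beM : {sigma_finite_measure set _ -> \bar R} := @lebesgue_mx R (m * p) 1.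
Let AM : {sigma_finite_measure set _ -> \bar R} := @lebesgue_mx R n p.
Let SM : {sigma_finite_measure set _ -> \bar R} := @lebesgue_sym R m.
Let latentM := product_sfm (product_sfm nuM thM) beM.
Let stateM := product_sfm (product_sfm (product_sfm (product_sfm AM nuM) thM) beM) SM.

Let mk (A : 'M[R]_(n, p)) (w : latent) (S : 'M[R]_m) : state :=
  (A, w.1.1, w.1.2, w.2, S).

(** The features are the first block, the latent responses with the coefficients the second, and
    [Sigma] the third, since the abstract sampler draws the third block first. *)
Lemma posterior_sampler : let f := eiv_posterior U V Z y x a0 B0 j0 J0 in
  exists (Pi : probability state R) (P : R.-pker state ~> state),
    [/\ has_density_proportional_to f Pi,
        forall s B, measurable B -> P s B = gibbs_transition f s B
      & geometrically_ergodic (eiv_space m n p q) P Pi].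
Proof.
move=> f.
have [eps1 [C1 [e10 tail1]]] := feature_factor_tail x spdV.
have [eps2 [C2 [e20 tail2]]] := latent_factor_tail Z y j0 spdU spdJ0.
have [eps3 [C3 [e30 tail3]]] := Sigma_factor_tail p Z a0 spdB0.
have m1 : measurable_fun setT (fun s : state => s.1).
  exact: measurable_fst.
have m11 : measurable_fun setT (fun s : state => s.1.1).
  exact: (measurableT_comp measurable_fst m1).
have m111 : measurable_fun setT (fun s : state => s.1.1.1).
  exact: (measurableT_comp measurable_fst m11).
have mp1 : measurable_fun setT (fun s : state => s.1.1.1.1).
  exact: (measurableT_comp measurable_fst m111).
have mp2 : measurable_fun setT (fun s : state => (s.1.1.1.2, s.1.1.2, s.1.2) : latent).
  apply: measurable_fun_pair; last exact: (measurableT_comp measurable_snd m1).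
  apply: measurable_fun_pair; last exact: (measurableT_comp measurable_snd m11).
  exact: (measurableT_comp measurable_snd m111).
have mp3 : measurable_fun setT (fun s : state => s.2) by exact: measurable_snd.
have mmk : measurable_fun setT (fun t : 'M[R]_(n, p) * latent * 'M[R]_m => mk t.1.1 t.1.2 t.2).
  have mw : measurable_fun setT (fun t : 'M[R]_(n, p) * latent * 'M[R]_m => t.1.2).
    exact: (measurableT_comp measurable_snd measurable_fst).
  apply: measurable_fun_pair => //; apply: measurable_fun_pair; last first.
    exact: (measurableT_comp measurable_snd mw).
  apply: measurable_fun_pair; last first.
    exact: (measurableT_comp measurable_snd (measurableT_comp measurable_fst mw)).
  apply: measurable_fun_pair; last first.
    exact: (measurableT_comp measurable_fst (measurableT_comp measurable_fst mw)).
  exact: (measurableT_comp measurable_fst measurable_fst).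
have int_mk F : measurable_fun setT F -> (forall t, (0 <= F t)%E) ->
    (\int[stateM]_t F t = \int[AM]_A \int[latentM]_w \int[SM]_S F (mk A w S))%E.
  by move=> mF F0; exact: (integral_product5_regroup AM nuM thM beM SM mF F0).
have Kge0 : 0 <= 4 + 4 * \sum_i sqnorm (Z i).
  by rewrite addr_ge0// mulr_ge0// sumr_ge0// => i _; exact: sqnorm_ge0.
have msq : measurable_fun setT (@sqnorm R n p).
  by apply: measurable_sqnorm; exact: measurable_id.
have mk2 A (w : latent) S : ((mk A w S).1.1.1.2, (mk A w S).1.1.2, (mk A w S).1.2) = w.
  by case: w => [[]].
have mkp (s : state) : mk s.1.1.1.1 (s.1.1.1.2, s.1.1.2, s.1.2) s.2 = s.
  by case: s => [[[[]]]].
have [Pi [P [PiE PE erg]]] := uniform_gibbs3 (m1 := AM) (m2 := latentM) (m3 := SM)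
  (m := stateM) mp1 mp2 mp3 mmk (fun _ _ _ => erefl) mk2 (fun _ _ _ => erefl) mkp int_mk
  (measurable_feature_factor V x) (measurable_latent_factor (q := q) (p := p) U y j0 J0)
  (measurable_Sigma_factor n a0 B0) (measurable_misfit Z)
  (feature_factor_gt0 V x) (latent_factor_gt0 U y j0 J0) (Sigma_factor_ge0 n a0 B0)
  (misfit_ge0 Z) (fun A w S => eiv_posteriorE U V Z y x a0 B0 j0 J0 A w S)
  (feature_factor_integral x spdV) (latent_factor_integral y j0 spdU spdJ0)
  (Sigma_factor_integral n a0_ge spdB0) msq (@measurable_latent_sqnorm R m n p q)
  (@measurable_inv_trace R m) (@sqnorm_ge0 R n p) (@latent_sqnorm_ge0 R m n p q)
  (@inv_trace_ge0 R m) Kge0 (misfit_le Z) e10 e20 e30 tail1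
  (fun A S _ => tail2 A S) tail3.
exists Pi, P; split => //.
  move=> [[[[A nu] th] be] S] B mB; exact: PE.
Qed.

End posterior_sampler.

(** * The posterior as the model density up to a constant *)

Section model_density.
Context {R : realType} (m n p q : nat).
Variables (U : 'I_n -> 'M[R]_m) (V : 'I_n -> 'M[R]_p) (Z : 'I_n -> 'cV[R]_q).
Variables (y : 'I_n -> 'cV[R]_m) (x : 'I_n -> 'cV[R]_p).
Variables (a0 : nat) (B0 : 'M[R]_m).
Variables (j0 : 'cV[R]_(m * q + m * p)) (J0 : 'M[R]_(m * q + m * p)).
Hypotheses (spdU : forall i, spd (U i)) (spdV : forall i, spd (V i)).
Hypotheses (a0_ge : (m <= a0)%N) (spdB0 : spd B0) (spdJ0 : spd J0).

Let normal_const d (C : 'M[R]_d) := (Num.sqrt ((2 * pi) ^+ d * \det C))^-1.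

Let normal_const_gt0 d (C : 'M[R]_d) : spd C -> 0 < normal_const C.
Proof.
move=> spdC; rewrite invr_gt0 sqrtr_gt0 mulr_gt0 ?spd_det_gt0//.
by rewrite exprn_gt0// mulr_gt0// pi_gt0.
Qed.

Let normal_const_det d (C : 'M[R]_d) : spd C ->
  normal_const C = normal_const (1%:M : 'M[R]_d) * \det C `^ (- (1 / 2)).
Proof.
move=> spdC; rewrite /normal_const det1 mulr1 sqrtrM; last first.
  by rewrite exprn_ge0// mulr_ge0// pi_ge0.
by rewrite invfM powRN mul1r powR12_sqrt// ltW// spd_det_gt0.
Qed.

(** With no observations [Sigma_factor] is the unnormalized prior density of [Sigma]. *)
Let Iw := fine (\int[lebesgue_sym m]_S (Sigma_factor 0 a0 B0 S)%:E)%E.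

Let Iw_gt0 : 0 < Iw.
Proof. by apply: fine_gt0; exact: Sigma_factor_integral. Qed.

(** Among the normal constants only those of the latent responses depend on the state: each
    contributes the determinant of [Sigma] to the power [- (1 / 2)], which accounts for the [n] in
    the exponent of the posterior. *)
Lemma model_density_proportional : exists2 c : R, 0 < c &
  forall s : eiv_state R m n p q, spd s.2 ->
    eiv_model_density U V Z y x a0 B0 j0 J0 s =
    c * eiv_posterior U V Z y x a0 B0 j0 J0 s.
Proof.
pose c1 := \prod_(i < n) (normal_const (U i) * normal_const (1%:M : 'M[R]_m) *
  normal_const (V i)).
have spd1 : spd (1%:M : 'M[R]_m) by exact: spd_scalar_mx.
exists (c1 / Iw * normal_const J0).
  rewrite mulr_gt0 ?normal_const_gt0// divr_gt0//.
  by apply: prodr_gt0 => i _; rewrite !mulr_gt0// normal_const_gt0.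
move=> [[[[A nu] th] be] S] /= spdS; rewrite asboolT//.
have dS := spd_det_gt0 spdS.
pose u i := latent_response nu i - y i.
pose r i := latent_response nu i - regression_mean Z A th be i.
pose v i := latent_feature A i - x i.
have -> : invwishart_pdf a0 B0 S =
    \det S `^ (- ((a0 + m + 1)%:R / 2)) * expR (- (\tr (invmx S *m B0) / 2)) / Iw.
  by rewrite /invwishart_pdf /normalize_density asboolT.
have -> : \prod_(i < n)
     (mvnormal_pdf (latent_response nu i) (U i) (y i) *
      mvnormal_pdf (regression_mean Z A th be i) S (latent_response nu i) *
      mvnormal_pdf (x i) (V i) (latent_feature A i)) =
   c1 * (\det S `^ (- (1 / 2))) ^+ n *
   expR (\sum_(i < n) (- (qform (invmx (U i)) (u i) / 2) -
     qform (invmx S) (r i) / 2 - qform (invmx (V i)) (v i) / 2)).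
  have -> : (\det S `^ (- (1 / 2))) ^+ n = \prod_(i < n) \det S `^ (- (1 / 2)).
    by rewrite prodr_const card_ord.
  rewrite expR_sum -!big_split/=.
  apply: eq_bigr => i _; rewrite !expRD /mvnormal_pdf -/(normal_const (U i))
    -/(normal_const S) -/(normal_const (V i)) (normal_const_det spdS).
  (* The model centres the observation at the latent response, the posterior the reverse; the form
     is even. *)
  rewrite -(qformN _ (y i - _)) opprB -/(u i) -/(r i) -/(v i); ring.
rewrite /mvnormal_pdf -/(normal_const J0) !sumrB sumrN -!mulr_suml.
have -> : - ((n + a0 + m + 1)%:R / 2) = (- (1 / 2)) * n%:R - ((a0 + m + 1)%:R / 2) :> R.
  by rewrite -!addnA natrD; field.
rewrite powRD; last by rewrite (gt_eqF dS) implybT.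
rewrite powRrM powR_mulrn ?powR_ge0//.
rewrite !expRD mulNr; ring.
Qed.

End model_density.

Theorem corollary3 (R : realType) (m n p q : nat)
    (U : 'I_n -> 'M[R]_m) (V : 'I_n -> 'M[R]_p) (Z : 'I_n -> 'cV[R]_q)
    (a0 : nat) (B0 : 'M[R]_m)
    (j0 : 'cV[R]_(m * q + m * p)) (J0 : 'M[R]_(m * q + m * p))
    (y : 'I_n -> 'cV[R]_m) (x : 'I_n -> 'cV[R]_p) :
  (0 < m)%N -> (0 < n)%N -> (0 < p)%N -> (0 < q)%N ->
  (forall i, spd (U i)) -> (forall i, spd (V i)) ->
  (m <= a0)%N -> spd B0 -> spd J0 ->
  let pi_n := eiv_posterior U V Z y x a0 B0 j0 J0 in
  (exists2 c : R, 0 < c & forall s : eiv_state R m n p q, spd s.2 ->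
     eiv_model_density U V Z y x a0 B0 j0 J0 s = c * pi_n s) /\
  exists (Pi : probability (eiv_state R m n p q) R)
         (P : R.-pker (eiv_state R m n p q) ~> (eiv_state R m n p q)),
    [/\ has_density_proportional_to pi_n Pi,
        forall s B, measurable B -> P s B = gibbs_transition pi_n s B
      & geometrically_ergodic (eiv_space m n p q) P Pi].
Proof.
move=> _ _ _ _ spdU spdV a0_ge spdB0 spdJ0 pi_n; split.
  exact: model_density_proportional.
exact: posterior_sampler.
Qed.
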